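(* The algebra $\mathbf{S}(\pi)$ is isomorphic to the quotient algebra $\mathbf{U}/I$, where $I$ is the ideal of $\mathbf{U}$ consisting of all elements of $\mathbf{U}$ which annihilate every $\mathbf{U}$-module belonging to $\pi$. Thus $\mathbf{S}(\pi)$ is a generalized $q$-Schur algebra in the sense of Donkin.
   Context: Root data. Let $(a_{ij})_{1\le i,j\le n}$ be a Cartan matrix of finite type (not assumed indecomposable): integers with $a_{ii}=2$, $a_{ij}\le 0$ for $i\ne j$, and there are $d_i\in\{1,2,3\}$ with $(d_ia_{ij})$ symmetric and positive definite. Let $\mathfrak{g}$ be the corresponding semisimple Lie algebra over $\mathbb{Q}$, $\mathfrak{h}$ its Cartan subalgebra, $\alpha_i\in\mathfrak{h}^*$ the simple roots, $\alpha_i^\vee\in\mathfrak{h}$ the simple coroots, $\langle\alpha_i^\vee,\alpha_j\rangle=a_{ij}$, $W$ the Weyl group. Let $X=\{\lambda\in\mathfrak{h}^*\mid\langle\alpha_i^\vee,\lambda\rangle\in\mathbb{Z}\ \forall i\}$, $X^+=\{\lambda\in X\mid\langle\alpha_i^\vee,\lambda\rangle\ge0\ \forall i\}$, and write $\lambda\le\mu$ if $\mu-\lambda\in\sum_i\mathbb{N}\alpha_i$. Let $\pi\subset X^+$ be a finite saturated set, i.e. $\mu\in\pi$, $\lambda\in X^+$, $\lambda\le\mu$ imply $\lambda\in\pi$. Let $W\pi=\{w\mu\mid w\in W,\mu\in\pi\}$. Quantum notation. $v$ is an indeterminate, $v_i=v^{d_i}$, $[a]_i=(v_i^a-v_i^{-a})/(v_i-v_i^{-1})$,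 $\begin{bmatrix}a\\t\end{bmatrix}_i=\prod_{s=0}^{t-1}(v_i^{a-s}-v_i^{-a+s})/\prod_{s=1}^t(v_i^s-v_i^{-s})$ for $a\in\mathbb{Z}$, $t\in\mathbb{N}$. The algebra $\mathbf{S}(\pi)$. It is the associative unital $\mathbb{Q}(v)$-algebra with generators $E_i,F_i$ ($1\le i\le n$), $1_\lambda$ ($\lambda\in W\pi$) and relations: $1_\lambda1_\mu=\delta_{\lambda\mu}1_\lambda$, $\sum_{\lambda\in W\pi}1_\lambda=1$; $E_iF_j-F_jE_i=\delta_{ij}\sum_{\lambda\in W\pi}[\langle\alpha_i^\vee,\lambda\rangle]_i1_\lambda$; $E_i1_\lambda=1_{\lambda+\alpha_i}E_i$ if $\lambda+\alpha_i\in W\pi$ and $E_i1_\lambda=0$ otherwise; $F_i1_\lambda=1_{\lambda-\alpha_i}F_i$ if $\lambda-\alpha_i\in W\pi$ and $F_i1_\lambda=0$ otherwise; $1_\lambda E_i=E_i1_{\lambda-\alpha_i}$ if $\lambda-\alpha_i\in W\pi$ and $1_\lambda E_i=0$ otherwise; $1_\lambda F_i=F_i1_{\lambda+\alpha_i}$ if $\lambda+\alpha_i\in W\pi$ and $1_\lambda F_i=0$ otherwise; and for $i\ne j$ the quantum Serre relations $\sum_{s=0}^{1-a_{ij}}(-1)^s\begin{bmatrix}1-a_{ij}\\ s\end{bmatrix}_iE_i^{1-a_{ij}-s}E_jE_i^s=0$ and the same with $F$ in place of $E$. The algebra $\mathbf{U}$. It is the associative unital $\mathbb{Q}(v)$-algebra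 with generators $E_i,F_i,K_i,K_i^{-1}$ ($1\le i\le n$) and relations $K_iK_j=K_jK_i$, $K_iK_i^{-1}=1=K_i^{-1}K_i$; $E_iF_j-F_jE_i=\delta_{ij}(K_i-K_i^{-1})/(v_i-v_i^{-1})$; $K_iE_j=v_i^{a_{ij}}E_jK_i$, $K_iF_j=v_i^{-a_{ij}}F_jK_i$; and the same quantum Serre relations in the $E$'s and in the $F$'s for $i\neq j$. For $\lambda\in X^+$, $\Lambda_\lambda$ denotes the simple finite-dimensional $\mathbf{U}$-module of type $\mathbf{1}$ of highest weight $\lambda$ (each $K_i$ acts on the highest weight vector by $v_i^{\langle\alpha_i^\vee,\lambda\rangle}$). A (finite-dimensional) $\mathbf{U}$-module belongs to $\pi$ if all its composition factors are of the form $\Lambda_\lambda$ with $\lambda\in\pi$. The generalized $q$-Schur algebra in Donkin's sense attached to $\pi$ is the quotient of $\mathbf{U}$ by the ideal of all elements annihilating every $\mathbf{U}$-module belonging to $\pi$. *)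

(* Defs.v *)
From HB Require Import structures.
From mathcomp Require Import all_boot all_order all_algebra.
From mathcomp Require Import boolp classical_sets functions cardinality fsbigop.
From mathcomp.multinomials Require Import monalg.

Set Implicit Arguments.
Unset Strict Implicit.
Unset Printing Implicit Defensive.

Import Order.TTheory GRing.Theory Num.Theory.
Local Open Scope classical_set_scope.
Local Open Scope ring_scope.
Local Open Scope quotient_scope.

(* Associative unital K-algebras, presented as a ring with a central ring
   morphism from K.  The library's [algType] forces 1 != 0, whereas S(pi) is the
   zero ring when pi is empty. *)
HB.mixin Record isPzAlgebra (K : comPzRingType) A of GRing.PzRing A := {
  alg_const : {rmorphism K -> A};
  alg_const_central : forall (k : K) (x : A), alg_const k * x = x * alg_const k
}.

#[short(type="pzAlgType")]
HB.structure Definition PzAlgebra (K : comPzRingType) :=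
  {A of GRing.PzRing A & isPzAlgebra K A}.

Definition alg_isomorphic (K : comPzRingType) (A B : pzAlgType K) : Prop :=
  exists f : {rmorphism A -> B},
    (forall k : K, f (alg_const k) = alg_const k) /\ bijective f.

Section Submodules.
Context {R : pzRingType} {V : lmodType R} (N : submodClosed V).

Definition submod_pred : {pred V} := fun x => x \in N.

Fact submod_pred_closed : submod_closed submod_pred.
Proof. exact: submodClosedP. Qed.
HB.instance Definition _ :=
  GRing.isSubmodClosed.Build R V submod_pred submod_pred_closed.
HB.instance Definition _ :=
  GRing.isZmodClosed.Build V submod_pred (GRing.submod_closedB submod_pred_closed).

Definition submod : Type := {x : V | x \in submod_pred}.
HB.instance Definition _ := SubChoice.on submod.
HB.instance Definition _ :=
  GRing.SubChoice_isSubLmodule.Build R V submod_pred submod submod_pred_closed.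

Definition quotmod : Type := Quotient.quot submod_pred.
HB.instance Definition _ := GRing.Zmodule.on quotmod.
HB.instance Definition _ : EqQuotient V _ quotmod := EqQuotient.on quotmod.

Definition quotmod_scale (c : R) (x : quotmod) : quotmod :=
  \pi_quotmod (c *: repr x).

Fact quotmod_eqP (x y : V) :
  reflect (\pi_quotmod x = \pi_quotmod y) (x - y \in submod_pred).
Proof. by rewrite Quotient.idealrBE; apply: eqP. Qed.

Fact quotmod_scaleE c x : quotmod_scale c (\pi_quotmod x) = \pi_quotmod (c *: x).
Proof.
apply/quotmod_eqP; rewrite -scalerBr.
by apply: rpredZ; apply/quotmod_eqP; rewrite reprK.
Qed.

Fact quotmodD x y : \pi_quotmod (x + y) = \pi_quotmod x + \pi_quotmod y.
Proof. exact: (raddfD \pi_(Quotient.quot submod_pred)). Qed.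

Fact quotmod_scalerA a b x :
  quotmod_scale a (quotmod_scale b x) = quotmod_scale (a * b) x.
Proof. by rewrite -[x]reprK (quotmod_scaleE b) !quotmod_scaleE scalerA. Qed.

Fact quotmod_scale1r : left_id 1 quotmod_scale.
Proof. by move=> x; rewrite -[x]reprK !quotmod_scaleE scale1r. Qed.

Fact quotmod_scalerDr : right_distributive quotmod_scale +%R.
Proof.
move=> c x y; rewrite -[x]reprK -[y]reprK -quotmodD !quotmod_scaleE.
by rewrite scalerDr quotmodD.
Qed.

Fact quotmod_scalerDl x : {morph quotmod_scale^~ x : a b / a + b}.
Proof.
by move=> a b; rewrite -[x]reprK !quotmod_scaleE scalerDl quotmodD.
Qed.

HB.instance Definition _ := GRing.Zmodule_isLmodule.Build R quotmod
  quotmod_scalerA quotmod_scale1r quotmod_scalerDr quotmod_scalerDl.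

End Submodules.
Arguments submod {R V} N.
Arguments quotmod {R V} N.

Section Factor.
Context {R : pzRingType} {V : lmodType R} (N' N : submodClosed V).

Definition pull_pred : {pred submod N} := fun x => val x \in N'.

Fact pull_pred_closed : submod_closed pull_pred.
Proof.
split=> [|c x y xN yN]; first exact: rpred0.
by rewrite unfold_in linearP; apply: rpredD => //; apply: rpredZ.
Qed.
HB.instance Definition _ :=
  GRing.isSubmodClosed.Build R (submod N) pull_pred pull_pred_closed.

(* N / N', for N' included in N *)
Definition factor : lmodType R := quotmod pull_pred.
End Factor.

Definition simple_module (R : pzRingType) (V : lmodType R) : Prop :=
  (exists x : V, x != 0) /\
  forall N : submodClosed V,
    (forall x, x \in N -> x = 0) \/ (forall x, x \in N).

(* 0 = N 0 < N 1 < ... < N r = V; the values N i for i > r are irrelevant *)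
Definition composition_series (R : pzRingType) (V : lmodType R) (r : nat)
    (N : nat -> submodClosed V) : Prop :=
  [/\ forall x, (x \in N 0%N) = (x == 0),
      forall x, x \in N r,
      forall i, (i < r)%N -> {subset N i <= N i.+1}
    & forall i, (i < r)%N -> simple_module (factor (N i) (N i.+1))].

Section Ideals.
Context {A : pzRingType}.

Definition ideal_closed (I : set A) : Prop :=
  [/\ I 0, forall x y, I x -> I y -> I (x + y)
    & forall a x b, I x -> I (a * x * b)].

Record ideal := Ideal { ideal_set :> set A; idealP : ideal_closed ideal_set }.

Definition gen_ideal_set (X : set A) : set A := smallest ideal_closed X.

Fact gen_ideal_closed X : ideal_closed (gen_ideal_set X).
Proof.
split=> [I [[I0 _ _] _]|x y Ix Iy I IX|a x b Ix I IX]; first exact: I0.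
  by have [[_ ID _] _] := IX; apply: ID; [apply: Ix | apply: Iy].
by have [[_ _ IM] _] := IX; apply: IM; apply: Ix.
Qed.

Definition gen_ideal (X : set A) : ideal := Ideal (gen_ideal_closed X).

Section Quotient.
Variable I : ideal.

Definition ideal_pred : {pred A} := fun x => x \in ideal_set I.

Fact ideal_predP x : reflect (ideal_set I x) (x \in ideal_pred).
Proof. by rewrite unfold_in; apply: (iffP idP); rewrite inE. Qed.

Fact ideal_predM a x b : x \in ideal_pred -> a * x * b \in ideal_pred.
Proof. by case: (idealP I) => _ _ IM /ideal_predP Ix; apply/ideal_predP/IM. Qed.

Fact ideal_pred_zmod : zmod_closed ideal_pred.
Proof.
case: (idealP I) => I0 ID _; split=> [|x y /ideal_predP xI yI].
  exact/ideal_predP.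
apply/ideal_predP/ID => //; apply/ideal_predP.
by rewrite -[- y]mulN1r -[_ * y]mulr1 ideal_predM.
Qed.
HB.instance Definition _ := GRing.isZmodClosed.Build A ideal_pred ideal_pred_zmod.

Definition quotring : Type := Quotient.quot ideal_pred.
HB.instance Definition _ := GRing.Zmodule.on quotring.
HB.instance Definition _ : EqQuotient A _ quotring := EqQuotient.on quotring.

Definition quotring_one : quotring := \pi_quotring 1.
Definition quotring_mul (x y : quotring) : quotring :=
  \pi_quotring (repr x * repr y).

Fact quotring_eqP (x y : A) :
  reflect (\pi_quotring x = \pi_quotring y) (x - y \in ideal_pred).
Proof. by rewrite Quotient.idealrBE; apply: eqP. Qed.

Fact quotring_mulE x y :
  quotring_mul (\pi_quotring x) (\pi_quotring y) = \pi_quotring (x * y).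
Proof.
set x' := repr (\pi_quotring x); set y' := repr (\pi_quotring y).
have xx' : x' - x \in ideal_pred by apply/quotring_eqP; rewrite reprK.
have yy' : y' - y \in ideal_pred by apply/quotring_eqP; rewrite reprK.
apply/quotring_eqP; rewrite -/x' -/y'.
have -> : x' * y' - x * y = 1 * (x' - x) * y' + x * (y' - y) * 1.
  by rewrite mul1r mulr1 mulrBl mulrBr addrA subrK.
by apply: rpredD; apply: ideal_predM.
Qed.

Fact quotringD x y : \pi_quotring (x + y) = \pi_quotring x + \pi_quotring y.
Proof. exact: (raddfD \pi_(Quotient.quot ideal_pred)). Qed.

Fact quotring_mulA : associative quotring_mul.
Proof.
move=> x y z; rewrite -[x]reprK -[y]reprK -[z]reprK.
rewrite (quotring_mulE (repr y) (repr z)) (quotring_mulE (repr x) (repr y)).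
by rewrite !quotring_mulE mulrA.
Qed.

Fact quotring_mul1x : left_id quotring_one quotring_mul.
Proof. by move=> x; rewrite -[x]reprK !quotring_mulE mul1r. Qed.

Fact quotring_mulx1 : right_id quotring_one quotring_mul.
Proof. by move=> x; rewrite -[x]reprK !quotring_mulE mulr1. Qed.

Fact quotring_mulDl : left_distributive quotring_mul +%R.
Proof.
move=> x y z; rewrite -[x]reprK -[y]reprK -[z]reprK -quotringD !quotring_mulE.
by rewrite mulrDl quotringD.
Qed.

Fact quotring_mulDr : right_distributive quotring_mul +%R.
Proof.
move=> x y z; rewrite -[x]reprK -[y]reprK -[z]reprK -quotringD !quotring_mulE.
by rewrite mulrDr quotringD.
Qed.

HB.instance Definition _ := GRing.Zmodule_isPzRing.Build quotring
  quotring_mulA quotring_mul1x quotring_mulx1 quotring_mulDl quotring_mulDr.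

Definition quot_proj (x : A) : quotring := \pi_quotring x.

Fact quot_proj_zmod : zmod_morphism quot_proj.
Proof. exact: (raddfB \pi_(Quotient.quot ideal_pred)). Qed.

Fact quot_proj_monoid : monoid_morphism quot_proj.
Proof. by split=> // x y; rewrite /quot_proj -quotring_mulE. Qed.

HB.instance Definition _ :=
  GRing.isZmodMorphism.Build A quotring quot_proj quot_proj_zmod.
HB.instance Definition _ :=
  GRing.isMonoidMorphism.Build A quotring quot_proj quot_proj_monoid.

End Quotient.
End Ideals.
Arguments ideal A : clear implicits.

Section QuotientAlgebra.
Context (K : comPzRingType) (A : pzAlgType K) (I : ideal A).

Definition quotalg : Type := quotring I.
HB.instance Definition _ := GRing.PzRing.on quotalg.

Definition quotalg_const : {rmorphism K -> quotalg} :=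
  (quot_proj I : {rmorphism A -> quotalg}) \o (alg_const : {rmorphism K -> A}).

Fact quotalg_const_central k (x : quotalg) :
  quotalg_const k * x = x * quotalg_const k.
Proof.
rewrite -[x]reprK -!/(quot_proj I (repr x)) /=.
by rewrite -!rmorphM alg_const_central.
Qed.

HB.instance Definition _ :=
  isPzAlgebra.Build K quotalg quotalg_const_central.
End QuotientAlgebra.
Arguments quotalg {K A} I.

(* The free associative algebra on G: finitely supported K-valued functions
   on the words in G. *)
Section FreeAlgebra.
Context (K : fieldType) (G : choiceType).

Definition free_alg : Type := {malg K[{fmonom G}]}.
HB.instance Definition _ := GRing.Lalgebra.on free_alg.

Definition free_gen (g : G) : free_alg := << fmu g >>.

Fact free_alg_const_central (k : K) (x : free_alg) :
  (in_alg free_alg) k * x = x * (in_alg free_alg) k.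
Proof.
rewrite /= -[k *: 1]mul_malgC mulr1.
apply: (etrans (fgmulUg k _ x)); apply: (etrans _ (esym (fgmulgU k _ x))).
by apply: eq_bigr => m _; rewrite mulrC mul1m mulm1.
Qed.

HB.instance Definition _ := isPzAlgebra.Build K free_alg free_alg_const_central.

Definition presented_ideal (Rel : free_alg -> free_alg -> Prop) :
  ideal free_alg := gen_ideal [set z | exists x y, Rel x y /\ z = x - y].

Definition presented_alg (Rel : free_alg -> free_alg -> Prop) : pzAlgType K :=
  quotalg (presented_ideal Rel).

Definition presented_gen (Rel : free_alg -> free_alg -> Prop) (g : G) :
  presented_alg Rel := quot_proj (presented_ideal Rel) (free_gen g).
End FreeAlgebra.
Arguments presented_ideal {K G} Rel.
Arguments presented_alg {K G} Rel.
Arguments presented_gen {K G} Rel g.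

Notation Qv := {fraction {poly rat}}.
Definition qv : Qv := tofrac 'X.

Section QuantumNumbers.
Variable q : Qv.

Definition qint (a : int) : Qv := (q ^ a - q ^ (- a)) / (q - q^-1).

Definition qbinom (a : int) (t : nat) : Qv :=
  (\prod_(0 <= s < t) (q ^ (a - s%:Z) - q ^ (- a + s%:Z))) /
  (\prod_(1 <= s < t.+1) (q ^ s%:Z - q ^ (- s%:Z))).
End QuantumNumbers.

Definition cartan_finite_type (n : nat) (a : 'M[int]_n) (d : 'I_n -> nat)
    : Prop :=
  [/\ forall i, a i i = 2,
      forall i j, i != j -> a i j <= 0,
      forall i, d i \in [:: 1; 2; 3]%N,
      forall i j, (d i)%:Z * a i j = (d j)%:Z * a j i
    & forall x : 'rV[rat]_n, x != 0 ->
        0 < \sum_i \sum_j x 0 i * ((d i)%:Z * a i j)%:~R * x 0 j].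

Section Weights.
Context {n : nat} (a : 'M[int]_n).

(* The simple coroots form a basis of h, so an integral weight lambda in X is
   determined by the integers <alpha_i^vee, lambda>, which can be prescribed
   arbitrarily; these are the entries of the row vector. *)
Definition weight := 'rV[int]_n.

Definition pairing (i : 'I_n) (lam : weight) : int := lam 0 i.

Definition simple_root (j : 'I_n) : weight := \row_i a i j.

Definition dominant : set weight := [set lam | forall i, 0 <= pairing i lam].

Definition weight_le (lam mu : weight) : Prop :=
  exists k : 'I_n -> nat, mu - lam = \sum_i simple_root i *+ k i.

Definition saturated (pi : set weight) : Prop :=
  pi `<=` dominant /\
  forall lam mu, pi mu -> dominant lam -> weight_le lam mu -> pi lam.

Definition reflection (i : 'I_n) (lam : weight) : weight :=
  lam - simple_root i *~ pairing i lam.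

(* The simple reflections are involutions, so the monoid that they generate is
   the Weyl group. *)
Inductive weyl : (weight -> weight) -> Prop :=
| weyl_id : weyl id
| weyl_refl i w : weyl w -> weyl (reflection i \o w).

Definition weyl_orbits (pi : set weight) : set weight :=
  [set w mu | w in weyl & mu in pi].
End Weights.
Arguments weight n : clear implicits.

Section SerreRelation.
Context {n : nat} (a : 'M[int]_n) (d : 'I_n -> nat).

Definition qvi (i : 'I_n) : Qv := qv ^+ d i.

Definition serre (A : lalgType Qv) (x : 'I_n -> A) (i j : 'I_n) : A :=
  let m := `|1 - a i j|%N in
  \sum_(0 <= s < m.+1)
    ((-1) ^+ s * qbinom (qvi i) (1 - a i j) s) *:
      (x i ^+ (m - s) * x j * x i ^+ s).
End SerreRelation.

Section SAlgebra.
Context {n : nat} (a : 'M[int]_n) (d : 'I_n -> nat) (pi : set (weight n)).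

Let Wpi := set_type (weyl_orbits a pi).

Inductive S_generator : Type :=
| S_E of 'I_n | S_F of 'I_n | S_one of Wpi.
HB.instance Definition _ := gen_eqMixin S_generator.
HB.instance Definition _ := gen_choiceMixin S_generator.

Local Notation E i := (free_gen Qv (S_E i)).
Local Notation F i := (free_gen Qv (S_F i)).
Local Notation one lam := (free_gen Qv (S_one lam)).

(* The finitely supported sums are genuine sums over W pi, a finite set whenever
   pi is finite and [a] is of finite type. *)
Inductive S_relation : free_alg Qv S_generator -> free_alg Qv S_generator -> Prop :=
| S_one_mul (lam mu : Wpi) :
    S_relation (one lam * one mu) ((lam == mu)%:R *: one lam)
| S_one_sum :
    S_relation (\sum_(lam \in [set: Wpi]) one lam) 1
| S_EF i j :
    S_relation (E i * F j - F j * E i)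
      ((i == j)%:R *:
        \sum_(lam \in [set: Wpi]) qint (qvi d i) (pairing i (val lam)) *: one lam)
| S_E_one i (lam mu : Wpi) : val mu = val lam + simple_root a i ->
    S_relation (E i * one lam) (one mu * E i)
| S_E_one0 i (lam : Wpi) : ~ weyl_orbits a pi (val lam + simple_root a i) ->
    S_relation (E i * one lam) 0
| S_F_one i (lam mu : Wpi) : val mu = val lam - simple_root a i ->
    S_relation (F i * one lam) (one mu * F i)
| S_F_one0 i (lam : Wpi) : ~ weyl_orbits a pi (val lam - simple_root a i) ->
    S_relation (F i * one lam) 0
| S_one_E i (lam mu : Wpi) : val mu = val lam - simple_root a i ->
    S_relation (one lam * E i) (E i * one mu)
| S_one_E0 i (lam : Wpi) : ~ weyl_orbits a pi (val lam - simple_root a i) ->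
    S_relation (one lam * E i) 0
| S_one_F i (lam mu : Wpi) : val mu = val lam + simple_root a i ->
    S_relation (one lam * F i) (F i * one mu)
| S_one_F0 i (lam : Wpi) : ~ weyl_orbits a pi (val lam + simple_root a i) ->
    S_relation (one lam * F i) 0
| S_serre_E i j : i != j ->
    S_relation (serre a d (fun k => E k) i j) 0
| S_serre_F i j : i != j ->
    S_relation (serre a d (fun k => F k) i j) 0.

Definition S_alg : pzAlgType Qv := presented_alg S_relation.
End SAlgebra.

Section UAlgebra.
Context {n : nat} (a : 'M[int]_n) (d : 'I_n -> nat).

Inductive U_generator : Type :=
| U_E of 'I_n | U_F of 'I_n | U_K of 'I_n | U_Kinv of 'I_n.
HB.instance Definition _ := gen_eqMixin U_generator.
HB.instance Definition _ := gen_choiceMixin U_generator.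

Local Notation E i := (free_gen Qv (U_E i)).
Local Notation F i := (free_gen Qv (U_F i)).
Local Notation K i := (free_gen Qv (U_K i)).
Local Notation Kinv i := (free_gen Qv (U_Kinv i)).
Local Notation v_ i := (qvi d i).

Inductive U_relation : free_alg Qv U_generator -> free_alg Qv U_generator -> Prop :=
| U_K_comm i j : U_relation (K i * K j) (K j * K i)
| U_K_Kinv i : U_relation (K i * Kinv i) 1
| U_Kinv_K i : U_relation (Kinv i * K i) 1
| U_EF i j :
    U_relation (E i * F j - F j * E i)
      (((i == j)%:R / (v_ i - (v_ i)^-1)) *: (K i - Kinv i))
| U_K_E i j : U_relation (K i * E j) (v_ i ^ a i j *: (E j * K i))
| U_K_F i j : U_relation (K i * F j) (v_ i ^ (- a i j) *: (F j * K i))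
| U_serre_E i j : i != j ->
    U_relation (serre a d (fun k => E k) i j) 0
| U_serre_F i j : i != j ->
    U_relation (serre a d (fun k => F k) i j) 0.

Definition U_alg : pzAlgType Qv := presented_alg U_relation.
Definition U_gen (g : U_generator) : U_alg := presented_gen U_relation g.
End UAlgebra.

(* Finite-dimensionality over the ground field K of a left A-module, on which K
   acts through A. *)
Definition finite_dim (K : comPzRingType) (A : pzAlgType K) (M : lmodType A)
    : Prop :=
  exists s : seq M, forall x, exists c : nat -> K,
    x = \sum_(i < size s) (alg_const (c i) : A) *: s`_i.

Section Donkin.
Context {n : nat} (a : 'M[int]_n) (d : 'I_n -> nat).
Local Notation U := (U_alg a d).

(* L is isomorphic to Lambda_lam, which is defined only up to isomorphism.
   Prescribing the eigenvalues v_i^<alpha_i^vee, lam>, without signs, on the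
   highest weight vector is what makes L of type 1. *)
Definition is_Lambda (lam : weight n) (L : lmodType U) : Prop :=
  [/\ simple_module L, finite_dim L &
    exists x : L, [/\ x != 0,
      forall i, U_gen a d (U_E i) *: x = 0 &
      forall i, U_gen a d (U_K i) *: x =
        (alg_const (qvi d i ^ pairing i lam) : U) *: x]].

Definition belongs_to (pi : set (weight n)) (M : lmodType U) : Prop :=
  finite_dim M /\
  forall (r : nat) (N : nat -> submodClosed M), composition_series r N ->
    forall i, (i < r)%N ->
      exists2 lam, pi lam & is_Lambda lam (factor (N i) (N i.+1)).

Definition annihilator_set (pi : set (weight n)) : set U :=
  [set u | forall M : lmodType U, belongs_to pi M -> forall x : M, u *: x = 0].

Fact annihilator_closed pi : ideal_closed (annihilator_set pi).
Proof.
split=> [M _ x|u w Iu Iw M piM x|u w z Iw M piM x]; first exact: scale0r.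
  by rewrite scalerDl (Iu M) // (Iw M) // addr0.
by rewrite -!scalerA (Iw M) // scaler0.
Qed.

Definition annihilator (pi : set (weight n)) : ideal U :=
  Ideal (annihilator_closed pi).

Definition donkin_qSchur_alg (pi : set (weight n)) : pzAlgType Qv :=
  quotalg (annihilator pi).
End Donkin.

(* Main.v *)
Require Import Defs.
From HB Require Import structures.
From mathcomp Require Import all_boot all_order all_algebra.
From mathcomp Require Import boolp classical_sets functions cardinality fsbigop.
From mathcomp.multinomials Require Import monalg.
From mathcomp Require Import zify ring lra.

Set Implicit Arguments.
Unset Strict Implicit.
Unset Printing Implicit Defensive.

Import Order.TTheory GRing.Theory Num.Theory.
Local Open Scope classical_set_scope.
Local Open Scope ring_scope.
Local Open Scope quotient_scope.

(** Both S(pi) and the algebra of Donkin are quotients of U, and the proof shows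
    that they are quotients by the same ideal.

    Let P be the finite set W pi of weights, and call a U-module weighted if it
    is spanned by weight vectors, on which K_i acts by v_i^<alpha_i^vee, nu>,
    with nu in P.  The key fact is that a finite-dimensional U-module belongs to
    pi if and only if it is weighted.

    A weighted module belongs to pi ([weighted_belongs]).  The component of a
    vector at a weight is the image of this vector under an element of U, so
    that submodules and quotients of weighted modules are weighted.  A simple
    weighted module contains a highest weight vector, because heights of weights
    are bounded on P; its weight is dominant by the representation theory of
    quantum sl2, and the dominant elements of P are in pi, since an orbit of W
    contains at most one dominant weight ([dominant_orbit_eq]).

    A module that belongs to pi is weighted ([belongs_weighted]).  For Lambda_lam
    with lam in pi, the set of weights is stable under the simple reflections in
    the direction that makes a weight larger; hence every weight can be moved by
    W to a dominant weight below lam, which is in pi by saturation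
    ([Lambda_weighted]).  For a module with several composition factors the
    question is whether the K_i remain diagonalizable.  They do, because a Jordan
    block of K_i at a highest weight vector would be detected by the quantum
    Casimir element ([k_semisimple]).

    Now S(pi), on which U acts through E_i, F_i and
    K_i |-> sum_lam v_i^<alpha_i^vee, lam> 1_lam, is a weighted module, and it is
    finite-dimensional because it is spanned by the products of F's, an
    idempotent 1_lam and E's ([S_finite_dim]).  So it belongs to pi, and an
    element of U that annihilates all such modules vanishes in S(pi): this gives
    a morphism from U / I to S(pi).  Conversely, for each lam in P a product of
    linear polynomials in the K_i acts on all weighted modules as the projector
    to the weight lam ([weight_projector_exists]).  The relations of S(pi) hold
    for the actions of these projectors and of the E_i, F_i on weighted modules,
    hence they hold in U / I, and this gives a morphism from S(pi) to U / I
    ([psi_exists]).  The two morphisms are inverse to each other on generators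
    ([alg_isomorphic_donkin]). *)

(** * Roots, weights and the Weyl group *)
Section RootCoordinates.
Context {n : nat} {a : 'M[int]_n} {d : 'I_n -> nat}.
Hypothesis aP : cartan_finite_type a d.

Local Notation V := 'rV[rat]_n.
Implicit Types (i j k : 'I_n) (x y : V) (w u : seq 'I_n) (lam mu : weight n).

(** A finite-type Cartan matrix is invertible over the rationals, so roots and
    weights can both be written in rational coordinates on the simple roots.
    For [x] written in this way, [copair i x] is the pairing of the i-th simple
    coroot with [x]. *)
Definition copair (i : 'I_n) (x : V) : rat := \sum_k (a i k)%:~R * x 0 k.

Definition vrefl (i : 'I_n) (x : V) : V := x - copair i x *: delta_mx 0 i.

Definition word_act (w : seq 'I_n) (x : V) : V := foldr vrefl x w.

Definition bform (x y : V) : rat := \sum_i (d i)%:R * x 0 i * copair i y.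

Fact copair_linear i : scalar (copair i).
Proof.
move=> c x y; rewrite /copair mulr_sumr -big_split /=.
by apply: eq_bigr => k _; rewrite !mxE /= mulrDr mulrCA.
Qed.
HB.instance Definition _ i := GRing.isLinear.Build _ _ _ _ (copair i) (copair_linear i).

Lemma copair_delta i j : copair i (delta_mx 0 j) = (a i j)%:~R.
Proof.
rewrite /copair (bigD1 j) //= mxE !eqxx mulr1 big1 ?addr0 // => k kj.
by rewrite mxE (negbTE kj) mulr0.
Qed.

Fact vrefl_linear i : linear (vrefl i).
Proof.
move=> c x y; rewrite /vrefl linearP scalerDl scalerBr /= !scalerA.
by rewrite opprD addrACA.
Qed.
HB.instance Definition _ i := GRing.isLinear.Build _ _ _ _ (vrefl i) (vrefl_linear i).

Lemma copair_refl i x : copair i (vrefl i x) = - copair i x.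
Proof.
case: aP => a2 _ _ _ _.
rewrite /vrefl linearB linearZ /= copair_delta a2.
by rewrite /=; ring.
Qed.

Lemma vreflK i : involutive (vrefl i).
Proof.
move=> x; rewrite {1}/vrefl copair_refl {1}/vrefl scaleNr opprK.
by rewrite subrK.
Qed.

Fact word_act_linear w : linear (word_act w).
Proof. by move=> c x y; elim: w => //= i w ->; rewrite linearP. Qed.
HB.instance Definition _ w :=
  GRing.isLinear.Build _ _ _ _ (word_act w) (word_act_linear w).

Lemma word_act_cat w u x : word_act (w ++ u) x = word_act w (word_act u x).
Proof. by rewrite /word_act foldr_cat. Qed.

Lemma word_act_revK w : cancel (word_act (rev w)) (word_act w).
Proof.
move=> x; elim: w x => //= i w IH x.
by rewrite rev_cons -cats1 word_act_cat /= IH vreflK.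
Qed.

Lemma d_gt0 i : (0 : rat) < (d i)%:R.
Proof. by case: aP => _ _ /(_ i); rewrite !inE ltr0n => /or3P[]/eqP->. Qed.

Lemma bform_sumE x y :
  bform x y = \sum_i \sum_j x 0 i * ((d i)%:Z * a i j)%:~R * y 0 j.
Proof.
apply: eq_bigr => i _; rewrite /copair mulr_sumr; apply: eq_bigr => j _.
by rewrite intrM; ring.
Qed.

Lemma bformC x y : bform x y = bform y x.
Proof.
case: aP => _ _ _ sym _.
rewrite !bform_sumE exchange_big /=; apply: eq_bigr => i _.
by apply: eq_bigr => j _; rewrite sym; ring.
Qed.

Lemma bform_gt0 x : x != 0 -> 0 < bform x x.
Proof. by case: aP => _ _ _ _ pos x0; rewrite bform_sumE pos. Qed.

Fact bform_linear x : scalar (bform x).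
Proof.
move=> c y z; rewrite /bform mulr_sumr -big_split /=.
by apply: eq_bigr => k _; rewrite linearP /= mulrDr /=; ring.
Qed.
HB.instance Definition _ x := GRing.isLinear.Build _ _ _ _ (bform x) (bform_linear x).

Lemma bform_deltal i y : bform (delta_mx 0 i) y = (d i)%:R * copair i y.
Proof.
rewrite /bform (bigD1 i) //= mxE !eqxx mulr1 big1 ?addr0 // => k ki.
by rewrite mxE (negbTE ki) mulr0 mul0r.
Qed.

Lemma bform_deltar i x : bform x (delta_mx 0 i) = (d i)%:R * copair i x.
Proof. by rewrite bformC bform_deltal. Qed.

Lemma bform_reflC i x y : bform (vrefl i x) y = bform x (vrefl i y).
Proof.
rewrite {2}/vrefl linearB linearZ /= bform_deltar bformC {1}/vrefl.
rewrite linearB linearZ /= bform_deltar bformC /=; ring.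
Qed.

Lemma bform_word w x y : bform (word_act w x) y = bform x (word_act (rev w) y).
Proof.
elim: w x y => // i w IH x y /=.
by rewrite bform_reflC IH rev_cons -cats1 word_act_cat.
Qed.

Lemma bform_word_word w x y : bform (word_act w x) (word_act w y) = bform x y.
Proof. by rewrite bform_word -{2}[w]revK word_act_revK. Qed.

(** Cauchy-Schwarz: expand the square of [bform x x *: y - bform x y *: x]. *)
Lemma bform_CS x y : bform x y ^+ 2 <= bform x x * bform y y.
Proof.
have [->|x0] := eqVneq x 0.
  by rewrite [bform 0 y]bformC !linear0 expr0n mul0r.
have xx := bform_gt0 x0.
pose z := bform x x *: y - bform x y *: x.
have : 0 <= bform z z.
  by have [->|z0] := eqVneq z 0; rewrite ?linear0 // ltW // bform_gt0.
rewrite {2}/z linearB !linearZ /= ![bform z _]bformC /z.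
rewrite !linearB !linearZ /= [bform y x]bformC /=.
move: xx; set A := bform x x; set b := bform x y; set C := bform y y => A0.
have -> : A * (A * C - b * b) - b * (A * b - b * A) = A * (A * C - b ^+ 2) by ring.
by rewrite pmulr_rge0 // subr_ge0.
Qed.

(** As (alpha_i, alpha_i) = 2 d_i, the second condition says that the multiple
    2x / (alpha_i, alpha_i) of [x] is an integral combination of the simple
    coroots.  Every root that is conjugate to alpha_i satisfies both conditions. *)
Definition coroot_lattice i x : Prop :=
  forall j, x 0 j \is a Num.int /\ (d j)%:R * x 0 j / (d i)%:R \is a Num.int.

Lemma coroot_lattice_delta i : coroot_lattice i (delta_mx 0 i).
Proof.
move=> j; rewrite mxE !eqxx /=; split; first exact: rpred_nat.
have [->|_] := eqVneq j i; last by rewrite mulr0 mul0r rpred0.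
by rewrite mulr1 divff ?gt_eqF ?d_gt0 ?rpred1.
Qed.

Lemma coroot_lattice_refl i j x : coroot_lattice i x -> coroot_lattice i (vrefl j x).
Proof.
move=> lx k; have [xk xk'] := lx k.
rewrite /vrefl !mxE eqxx /=; have [->|_] := eqVneq k j; last first.
  by rewrite mulr0 subr0.
rewrite mulr1; have [xj xj'] := lx j.
split.
  by rewrite rpredB // rpred_sum // => l _; rewrite rpredM ?rpred_int //; case: (lx l).
rewrite mulrBr mulrBl rpredB // /copair !mulr_sumr mulr_suml rpred_sum // => l _.
have -> : (d j)%:R * ((a j l)%:~R * x 0 l) / (d i)%:R =
   (a l j)%:~R * ((d l)%:R * x 0 l / (d i)%:R) :> rat.
  have /(congr1 (fun z : int => z%:~R : rat)) : (d j)%:Z * a j l = (d l)%:Z * a l j.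
    by case: aP.
  rewrite !intrM /= => e.
  by rewrite mulrA e; ring.
by rewrite rpredM ?rpred_int //; case: (lx l).
Qed.

Lemma sum_sym_split (T : 'I_n -> 'I_n -> rat) :
  (forall i j, T i j = T j i) ->
  \sum_i \sum_j T i j =
  2 * (\sum_(i < n) \sum_(j < n | (j < i)%N) T i j) + \sum_i T i i.
Proof.
move=> symT.
have -> : \sum_i \sum_j T i j =
   \sum_(i < n) \sum_(j < n | (j < i)%N) T i j +
   \sum_(i < n) \sum_(j < n | (i < j)%N) T i j + \sum_i T i i.
  rewrite -!big_split /=; apply: eq_bigr => i _.
  rewrite (bigID (fun j => (j < i)%N)) /= -addrA; congr (_ + _).
  rewrite (bigID (fun j => (i < j)%N)) /=; congr (_ + _).
    by apply: eq_bigl => j; case: ltngtP.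
  rewrite (big_pred1 i) // => j; rewrite -!leqNgt -eqn_leq.
  by rewrite eq_sym.
rewrite [X in _ + X + _](exchange_big_dep xpredT) //=.
under [X in _ + X + _]eq_bigr do under eq_bigr do rewrite symT.
by ring.
Qed.

(** On this lattice the form takes values in the multiples of 2 d_i: in the
    double sum the terms (j, k) and (k, j) agree and are multiples of d_i, and
    the diagonal terms are multiples of 2 d_i because a_jj = 2. *)
Lemma bform_lattice i x : coroot_lattice i x -> x != 0 -> 2 * (d i)%:R <= bform x x.
Proof.
move=> lx x0; have di := d_gt0 i.
case: aP => a2 _ _ sym _.
suff /intrP[m em] : bform x x / (2 * (d i)%:R) \is a Num.int.
  have : 0 < bform x x / (2 * (d i)%:R) by rewrite divr_gt0 ?mulr_gt0 ?bform_gt0.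
  rewrite em ltr0z => m0.
  have : 1 <= bform x x / (2 * (d i)%:R) by rewrite em ler1z; lia.
  by rewrite ler_pdivlMr ?mul1r ?mulr_gt0.
rewrite bform_sumE sum_sym_split; last by move=> j k; rewrite sym; ring.
have split2 (p q r : rat) : r != 0 -> (2 * p + q) / (2 * r) = p / r + q / (2 * r).
  by move=> r0; field.
rewrite split2 ?gt_eqF // !mulr_suml rpredD // rpred_sum // => j _;
  have [xj xj'] := lx j; last first.
  rewrite a2 intrM; have -> : x 0 j * ((d j)%:~R * 2%:~R) * x 0 j / (2 * (d i)%:R) =
     ((d j)%:R * x 0 j / (d i)%:R) * x 0 j by field; rewrite gt_eqF.
  by rewrite rpredM.
rewrite mulr_suml rpred_sum // => k _; have [xk _] := lx k.
have -> : x 0 j * ((d j)%:Z * a j k)%:~R * x 0 k / (d i)%:R =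
     ((d j)%:R * x 0 j / (d i)%:R) * (a j k)%:~R * x 0 k by rewrite intrM; ring.
by apply: rpredM => //; apply: rpredM => //; apply: rpred_int.
Qed.

Definition nonneg_coords (x : V) : Prop := forall j, 0 <= x 0 j.

Lemma coroot_lattice_word i w : coroot_lattice i (word_act w (delta_mx 0 i)).
Proof.
elim: w => [|j w IH] /=; first exact: coroot_lattice_delta.
exact: coroot_lattice_refl.
Qed.

Lemma bform_root w i :
  bform (word_act w (delta_mx 0 i)) (word_act w (delta_mx 0 i)) = 2 * (d i)%:R.
Proof.
by case: aP => a2 _ _ _ _; rewrite bform_word_word bform_deltal copair_delta a2 mulrC.
Qed.

(** Write [x] as the difference of its positive and negative parts.  Both are in
    the lattice, and their product is at most 0 since they have disjoint supports
    and the off-diagonal entries of the form are at most 0.  If both were non-zero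
    then (x, x) would be at least 4 d_i, but it is 2 d_i. *)
Lemma root_sign w i (x := word_act w (delta_mx 0 i)) :
  nonneg_coords x \/ nonneg_coords (- x).
Proof.
pose xp : V := \row_j Num.max (x 0 j) 0.
pose xm : V := \row_j Num.max (- x 0 j) 0.
have ex : x = xp - xm.
  apply/rowP => j; rewrite !mxE.
  by case: (ltrP (x 0 j) 0); case: (ltrP (- x 0 j) 0) => ? ?; lra.
have lx : coroot_lattice i x by apply: coroot_lattice_word.
have lp : coroot_lattice i xp.
  by move=> j; rewrite mxE; case: ltrP => // _; rewrite mulr0 mul0r rpred0.
have lm : coroot_lattice i xm.
  move=> j; rewrite mxE; case: ltrP => [_|_]; first by rewrite mulr0 mul0r rpred0.
  by rewrite mulrN mulNr !rpredN; apply: lx.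
have pm : bform xp xm <= 0.
  rewrite bform_sumE sumr_le0 // => j _; rewrite sumr_le0 // => k _.
  rewrite !mxE; have [->|jk] := eqVneq j k.
    by case: (ltrP (x 0 k) 0); case: (ltrP (- x 0 k) 0) => ? ?;
      rewrite ?(mulr0, mul0r) //; (have -> : x 0 k = 0 by lra); rewrite !mul0r.
  have s0 : ((d j)%:Z * a j k)%:~R <= 0 :> rat.
    case: aP => _ /(_ _ _ jk) ajk _ _ _; rewrite lerz0 pmulr_rle0 //.
    by move: (d_gt0 j); rewrite ltr0n.
  by rewrite mulrAC mulr_ge0_le0 // mulr_ge0 // le_max lexx orbT.
have xx : bform x x = 2 * (d i)%:R by apply: bform_root.
have di := d_gt0 i.
have [xp0|xp0] := eqVneq xp 0.
  right=> j; rewrite ex xp0 sub0r opprK mxE le_max lexx orbT //.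
have [xm0|xm0] := eqVneq xm 0.
  left=> j; rewrite ex xm0 subr0 mxE le_max lexx orbT //.
have bp := bform_lattice lp xp0; have bm := bform_lattice lm xm0.
have : bform (xp - xm) (xp - xm) = bform xp xp - 2 * bform xp xm + bform xm xm.
  rewrite linearB /= [bform _ xp]bformC [bform _ xm]bformC !linearB /= [bform xm xp]bformC.
  ring.
rewrite -ex; lra.
Qed.

(** The reflection s_j changes only the j-th coordinate, so a positive root that
    it makes negative is a multiple of alpha_j, and its reflection is s_j. *)
Lemma refl_sign_change u i j (g := word_act u (delta_mx 0 i)) :
  nonneg_coords g -> ~ nonneg_coords (vrefl j g) ->
  forall y, word_act u (vrefl i (word_act (rev u) y)) = vrefl j y.
Proof.
move=> gp gn y.
have gm : nonneg_coords (- vrefl j g).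
  by case: (root_sign (j :: u) i).
have eg : g = g 0 j *: delta_mx 0 j.
  apply/rowP => k; rewrite !mxE eqxx /=; have [->|kj] := eqVneq k j; first by rewrite mulr1.
  move: (gp k) (gm k); rewrite !mxE (negbTE kj) !mulr0 subr0; lra.
have nn : g 0 j ^+ 2 * (d j)%:R = (d i)%:R.
  have a2 : a j j = 2 by case: aP.
  have := bform_root u i; rewrite -/g eg; move: (g 0 j) => c.
  rewrite linearZ /= bform_deltar linearZ /= copair_delta a2.
  rewrite (_ : 2%:~R = 2) // => e; apply: (mulfI (_ : (2 : rat) != 0)) => //.
  by rewrite -e !mxE !eqxx mulr1; ring.
rewrite /vrefl linearB linearZ /= word_act_revK -/g; congr (_ - _).
have /eqP := bform_word u (delta_mx 0 i) y; rewrite -/g bform_deltal {1}eg.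
rewrite bformC linearZ /= bform_deltar => /eqP e.
rewrite eg scalerA; congr (_ *: _).
have di := d_gt0 i.
apply: (mulfI (lt0r_neq0 di)).
rewrite mulrA -e -[in RHS]nn; ring.
Qed.

(** The exchange condition, for the reflection u s_i u^-1 in the root
    u alpha_i: apply the letters of [w] to this root one after the other, and
    remove the letter that makes it negative. *)
Lemma exchange u i w : nonneg_coords (word_act u (delta_mx 0 i)) ->
  nonneg_coords (word_act (rev w) (word_act u (delta_mx 0 i))) \/
  exists2 w', (size w' < size w)%N & forall y,
    word_act u (vrefl i (word_act (rev u) (word_act w y))) = word_act w' y.
Proof.
elim: w u => [|j w IH] u gp; first by left.
have [gn|gn] := pselect (nonneg_coords (vrefl j (word_act u (delta_mx 0 i)))).
  case: (IH (j :: u) gn) => [h|[w' sw' h]].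
    by left; rewrite rev_cons -cats1 word_act_cat.
  right; exists (j :: w') => // y /=.
  by rewrite -h rev_cons -cats1 word_act_cat /= vreflK.
by right; exists w => // y; rewrite (refl_sign_change gp gn) vreflK.
Qed.

Definition vdominant (x : V) : Prop := forall i, 0 <= copair i x.

(** By induction on the length of w = s_i w'.  If the root w'^-1 alpha_i is
    positive, then dominance of [x] and of w x forces s_i to fix w' x; otherwise
    the exchange condition gives a shorter word with the same effect. *)
Lemma dominant_orbit_eq w x : vdominant x -> vdominant (word_act w x) -> word_act w x = x.
Proof.
have [N] := ubnP (size w); elim: N w => // N IH [|i w] //= sw dx dwx.
have pi0 : copair i (word_act w x) <= 0.
  by move: (dwx i); rewrite copair_refl oppr_ge0.
have e0 : nonneg_coords (word_act [::] (delta_mx 0 i)).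
  by move=> j; rewrite mxE ler0n.
case: (exchange w e0) => [pos|[w' sw' h]] /=.
  have p0 : 0 <= copair i (word_act w x).
    rewrite -(pmulr_rge0 _ (d_gt0 i)) -bform_deltal bformC bform_word bformC.
    by rewrite sumr_ge0 // => j _; rewrite !mulr_ge0.
  have : vrefl i (word_act w x) = word_act w x.
    by rewrite /vrefl (le_anti (introT andP (conj pi0 p0))) scale0r subr0.
  by move=> e; rewrite e; apply: IH => //; rewrite -e.
move: dwx; have /= -> := h x; apply: IH => //.
by apply: (leq_trans sw'); apply: ltnW.
Qed.

Definition cartan_rat : 'M[rat]_n := map_mx intr a.

Lemma copair_mulmx i x : copair i x = (x *m cartan_rat^T) 0 i.
Proof.
by rewrite mxE; apply: eq_bigr => k _; rewrite !mxE mulrC.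
Qed.

Lemma cartan_unit : cartan_rat^T \in unitmx.
Proof.
rewrite -row_free_unit -kermx_eq0; apply/negPn/negP => /rowV0Pn[y /sub_kermxP y0 /bform_gt0].
rewrite lt_neqAle eq_sym => /andP[/negP[]]; apply/eqP.
by rewrite /bform big1 // => i _; rewrite copair_mulmx y0 mxE mulr0.
Qed.

Lemma copair_inj x y : (forall i, copair i x = copair i y) -> x = y.
Proof.
move=> e; rewrite -[x](mulmxK cartan_unit) -[y](mulmxK cartan_unit); congr (_ *m _).
by apply/rowP => i; rewrite -!copair_mulmx e.
Qed.

Definition root_coords (lam : weight n) : V :=
  map_mx intr lam *m invmx cartan_rat^T.

Lemma copair_coords i lam : copair i (root_coords lam) = (pairing i lam)%:~R.
Proof. by rewrite copair_mulmx /root_coords mulmxKV ?cartan_unit // mxE. Qed.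

Lemma root_coords_inj : injective root_coords.
Proof.
move=> lam mu e; apply/rowP => i; apply: (@intr_inj rat).
by rewrite -!/(pairing i _) -!copair_coords e.
Qed.

Fact root_coords_zmod : zmod_morphism root_coords.
Proof. by move=> lam mu; rewrite /root_coords map_mxB mulmxBl. Qed.
HB.instance Definition _ := GRing.isZmodMorphism.Build _ _ root_coords root_coords_zmod.

Lemma root_coords_simple j : root_coords (simple_root a j) = delta_mx 0 j.
Proof. by apply: copair_inj => i; rewrite copair_coords copair_delta /pairing mxE. Qed.

Lemma root_coords_refl i lam : root_coords (reflection a i lam) = vrefl i (root_coords lam).
Proof.
rewrite /reflection raddfB raddfMz /= root_coords_simple /vrefl copair_coords.
by rewrite scaler_int.
Qed.

Definition height lam : rat := \sum_j root_coords lam 0 j.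

Fact height_zmod : zmod_morphism height.
Proof.
by move=> lam mu; rewrite /height raddfB -sumrB; apply: eq_bigr => j _; rewrite !mxE.
Qed.
HB.instance Definition _ := GRing.isZmodMorphism.Build _ _ height height_zmod.

Lemma height_simple j : height (simple_root a j) = 1.
Proof.
rewrite /height root_coords_simple (bigD1 j) //= mxE !eqxx big1 ?addr0 // => k kj.
by rewrite mxE (negbTE kj) andbF.
Qed.

Lemma weyl_word (s : weight n -> weight n) : weyl a s ->
  exists u, forall lam, root_coords (s lam) = word_act u (root_coords lam).
Proof.
elim=> [|i v _ [u eu]]; first by exists [::].
by exists (i :: u) => lam /=; rewrite root_coords_refl eu.
Qed.

Lemma weyl_orbits_dominant (pi : set (weight n)) lam :
  saturated a pi -> weyl_orbits a pi lam -> dominant lam -> pi lam.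
Proof.
move=> [pid _] [w ww [mu pmu <-]] domw; have [u eu] := weyl_word ww.
suff -> : w mu = mu by [].
apply: root_coords_inj; rewrite eu; apply: dominant_orbit_eq => i.
  by rewrite copair_coords ler0z; apply: pid.
by rewrite -eu copair_coords ler0z; apply: domw.
Qed.

Lemma weyl_orbits_sub (pi : set (weight n)) lam : pi lam -> weyl_orbits a pi lam.
Proof. by move=> plam; exists id; [exact: weyl_id|exists lam]. Qed.

Lemma weyl_orbits_refl (pi : set (weight n)) i lam :
  weyl_orbits a pi lam -> weyl_orbits a pi (reflection a i lam).
Proof. by move=> [w ww [mu pmu <-]]; exists (reflection a i \o w); [constructor|exists mu]. Qed.

Lemma reflectionK i : involutive (reflection a i).
Proof. by move=> lam; apply: root_coords_inj; rewrite !root_coords_refl vreflK. Qed.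

(** The square of a weight is invariant under W, and by Cauchy-Schwarz it bounds
    the coordinates of all conjugates. *)
Lemma weyl_orbits_finite (pi : set (weight n)) :
  finite_set pi -> finite_set (weyl_orbits a pi).
Proof.
move=> fpi.
pose orb mu := [set lam : weight n | exists2 s, weyl a s & lam = s mu].
suff fo mu : finite_set (orb mu).
  apply: (@sub_finite_set _ _ (\bigcup_(mu in pi) orb mu)).
    by move=> _ [w ww [mu pmu <-]]; exists mu => //; exists w.
  exact: bigcup_finite.
pose Q := bform (root_coords mu) (root_coords mu).
pose B := Num.bound (2 * Q).
pose f (g : {ffun 'I_n -> 'I_(B.*2.+1)}) : weight n := \row_i ((g i)%:Z - B%:Z).
have Q0 : 0 <= Q.
  have [/eqP e|e] := eqVneq (root_coords mu) 0; last by rewrite ltW // bform_gt0.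
  by rewrite /Q (eqP e) linear0.
apply: (@sub_finite_set _ _ [set f g | g in [set: {ffun 'I_n -> 'I_(B.*2.+1)}]]); last first.
  exact/finite_image/finite_finset.
move=> lam [w ww elam].
have bd i : `|lam 0 i| <= B%:Z.
  have [u eu] := weyl_word ww.
  have := bform_CS (delta_mx 0 i) (root_coords lam).
  rewrite {2 3}elam eu bform_word_word -/Q bform_deltal copair_coords bform_deltal copair_delta.
  have -> : a i i = 2 by case: aP.
  have di : (1 : rat) <= (d i)%:R by have := d_gt0 i; rewrite ltr0n ler1n.
  rewrite /pairing; set l := lam 0 i => h.
  have h2 : (l ^+ 2)%:~R <= 2 * Q.
    rewrite rmorphXn /=; move: h; rewrite (_ : 2%:~R = 2) //.
    set D : rat := (d i)%:R in di *; move: (l%:~R : rat) => r h.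
    have : D * (D * r ^+ 2) <= D * (2 * Q) by nra.
    rewrite ler_pM2l; last lra.
    by apply: le_trans; have := sqr_ge0 r; nra.
  have h3 : (l ^+ 2)%:~R < (B%:Z%:~R : rat).
    by apply: (le_lt_trans h2); apply: archi_boundP; lra.
  move: h3; rewrite ltr_int; move: (l) (B) => ? ?; nia.
(* coordinates lie in [-B, B]; they are shifted by B to fit an ordinal type *)
exists [ffun i => inord (absz (lam 0 i + B%:Z))] => //.
apply/rowP => i; rewrite !mxE ffunE inordK; have := bd i; lia.
Qed.

End RootCoordinates.

(** * Modules over quantum sl2 *)
Section GroundScaling.
Context {K : comPzRingType} {A : pzAlgType K} {M : lmodType A}.
Implicit Types (c b : K) (u : A) (x y : M).

Definition kscale (c : K) (x : M) : M := (alg_const c : A) *: x.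

Local Notation "c *:: x" := (kscale c x) (at level 40, left associativity).

Fact kscale_zmod c : zmod_morphism (kscale c).
Proof. by move=> x y; rewrite /kscale scalerBr. Qed.
HB.instance Definition _ c := GRing.isZmodMorphism.Build M M (kscale c) (kscale_zmod c).

Lemma kscaleA b c x : b *:: (c *:: x) = (b * c) *:: x.
Proof. by rewrite /kscale scalerA rmorphM. Qed.

Lemma kscaleDl b c x : (b + c) *:: x = b *:: x + c *:: x.
Proof. by rewrite /kscale rmorphD scalerDl. Qed.

Lemma kscaleDr c x y : c *:: (x + y) = c *:: x + c *:: y.
Proof. exact: raddfD. Qed.

Lemma kscaleBr c x y : c *:: (x - y) = c *:: x - c *:: y.
Proof. exact: raddfB. Qed.

Lemma kscaleNl c x : (- c) *:: x = - (c *:: x).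
Proof. by rewrite /kscale rmorphN scaleNr. Qed.

Lemma kscaleBl b c x : (b - c) *:: x = b *:: x - c *:: x.
Proof. by rewrite kscaleDl kscaleNl. Qed.

Lemma kscale0 x : 0 *:: x = 0.
Proof. by rewrite /kscale rmorph0 scale0r. Qed.

Lemma kscale1 x : 1 *:: x = x.
Proof. by rewrite /kscale rmorph1 scale1r. Qed.

Lemma kscaler0 c : c *:: (0 : M) = 0.
Proof. exact: raddf0. Qed.

Lemma scaler_kscale u c x : u *: (c *:: x) = c *:: (u *: x).
Proof. by rewrite /kscale !scalerA alg_const_central. Qed.

Lemma kscale_scaler u c x : (alg_const c * u) *: x = c *:: (u *: x).
Proof. by rewrite /kscale scalerA. Qed.
End GroundScaling.

Notation "c *:: x" := (kscale c x) (at level 40, left associativity) : ring_scope.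

Lemma kscale_eq0 (K : fieldType) (A : pzAlgType K) (M : lmodType A) (c : K) (x : M) :
  c *:: x = 0 -> c = 0 \/ x = 0.
Proof.
move=> cx; have [->|c0] := eqVneq c 0; [by left|right].
by rewrite -[x]kscale1 -(mulVf c0) -kscaleA cx kscaler0.
Qed.

Section QuantumSL2.
Context {K : fieldType} {A : pzAlgType K} (q : K) (e f k k' : A).

Definition sl2_triple : Prop :=
  [/\ k * k' = 1 /\ k' * k = 1, k * e = alg_const (q ^+ 2) * (e * k),
      k * f = alg_const (q ^- 2) * (f * k)
    & e * f - f * e = alg_const (q - q^-1)^-1 * (k - k')].

Definition weightvec (M : lmodType A) (m : int) (x : M) : Prop := k *: x = (q ^ m) *:: x.

Lemma weightvecZ (M : lmodType A) m b (x : M) :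
  weightvec m x -> weightvec m (b *:: x).
Proof. by move=> wx; rewrite /weightvec scaler_kscale wx !kscaleA mulrC. Qed.

Lemma weightvecD (M : lmodType A) m (x y : M) :
  weightvec m x -> weightvec m y -> weightvec m (x + y).
Proof. by move=> wx wy; rewrite /weightvec scalerDr wx wy -kscaleDr. Qed.
End QuantumSL2.

Section SL2Flip.
Context {K : fieldType} {A : pzAlgType K} (q : K) (e f k k' : A).
Hypothesis q_neq0 : q != 0.
Hypothesis T : sl2_triple q e f k k'.

(** Exchanging raising and lowering operators: what is proved below for highest
    weight vectors also applies to lowest weight vectors. *)
Lemma sl2_flip : sl2_triple q f e k' k.
Proof.
case: T => [[kk' k'k] ke kf ef].
have unit2 : alg_const (q ^+ 2) * alg_const (q ^- 2) = 1 :> A.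
  by rewrite -rmorphM mulfV ?rmorph1 // expf_neq0.
have flip z c b : alg_const c * alg_const b = 1 :> A ->
    k * z = alg_const b * (z * k) -> k' * z = alg_const c * (z * k').
  move=> cb kz; have zk : z * k = alg_const c * (k * z) by rewrite kz mulrA cb mul1r.
  rewrite -[in LHS](mulr1 z) -kk' [z * _]mulrA zk -!mulrA !(alg_const_central c) !mulrA.
  by rewrite k'k mul1r.
split=> //; first exact: flip kf; first by apply: flip ke; rewrite -alg_const_central.
- by rewrite -opprB ef -mulrN opprB.
Qed.

Lemma weightvec_flip (M : lmodType A) m (x : M) :
  weightvec q k m x -> weightvec q k' (- m) x.
Proof.
case: T => [[kk' k'k] _ _ _] kx.
rewrite /weightvec -[in RHS](scale1r x) -k'k -scalerA kx scaler_kscale kscaleA.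
by rewrite -expfzDr // addNr kscale1.
Qed.
End SL2Flip.

Section SL2Theory.
Context {K : fieldType} {A : pzAlgType K} {M : lmodType A} (q : K) (e f k k' : A).
Hypothesis q_neq0 : q != 0.
Hypothesis q_free : forall m : int, q ^ m = 1 -> m = 0.
Hypothesis T : sl2_triple q e f k k'.
Implicit Types (x y z : M) (m p : int).

Local Notation c := (q - q^-1)^-1.
Local Notation wt := (weightvec q k).

Lemma qpow_sub_neq0 (m : int) : m != 0 -> q ^ m - q ^ (- m) != 0.
Proof.
move=> m0; rewrite subr_eq0; apply: contra m0 => /eqP h.
suff /q_free : q ^ (m + m) = 1 by lia.
by rewrite expfzDr // {1}h -expfzDr // addNr.
Qed.

Lemma qdenom_neq0 : q - q^-1 != 0.
Proof. by have := @qpow_sub_neq0 1 isT; rewrite expr1z exprN1. Qed.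

Lemma actE x : k *: (e *: x) = (q ^+ 2) *:: (e *: (k *: x)).
Proof. by case: T => _ ke _ _; rewrite scalerA ke kscale_scaler scalerA. Qed.

Lemma actF x : k *: (f *: x) = (q ^- 2) *:: (f *: (k *: x)).
Proof. by case: T => _ _ kf _; rewrite scalerA kf kscale_scaler scalerA. Qed.

Lemma actF' x : k' *: (f *: x) = (q ^+ 2) *:: (f *: (k' *: x)).
Proof. by case: (sl2_flip q_neq0 T) => _ kf _ _; rewrite scalerA kf kscale_scaler scalerA. Qed.

Lemma actE' x : k' *: (e *: x) = (q ^- 2) *:: (e *: (k' *: x)).
Proof. by case: (sl2_flip q_neq0 T) => _ _ ke _; rewrite scalerA ke kscale_scaler scalerA. Qed.

Lemma actEF x : e *: (f *: x) = f *: (e *: x) + c *:: (k *: x - k' *: x).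
Proof.
case: T => _ _ _ ef; apply/eqP; rewrite -subr_eq0 opprD addrA !scalerA -!scalerBl.
by rewrite ef /kscale scalerA subrr.
Qed.

Lemma actKK' x : k *: (k' *: x) = x.
Proof. by case: T => [[kk' _] _ _ _]; rewrite scalerA kk' scale1r. Qed.

Lemma actK'K x : k' *: (k *: x) = x.
Proof. by case: T => [[_ kk'] _ _ _]; rewrite scalerA kk' scale1r. Qed.

Lemma weightvec_e m x : wt m x -> wt (m + 2) (e *: x).
Proof.
move=> kx; rewrite /weightvec actE kx scaler_kscale kscaleA expfzDr //.
by rewrite mulrC.
Qed.

Lemma weightvec_f m x : wt m x -> wt (m - 2) (f *: x).
Proof.
move=> kx; rewrite /weightvec actF kx scaler_kscale kscaleA expfzDr //.
by rewrite mulrC.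
Qed.

Lemma weightvec_e_exp s m x : wt m x -> wt (m + 2 * s%:Z) (e ^+ s *: x).
Proof.
elim: s m x => [|s IH] m x wx; first by rewrite scale1r mulr0 addr0.
rewrite exprSr -scalerA (_ : m + _ = (m + 2) + 2 * s%:Z); last lia.
exact/IH/weightvec_e.
Qed.

Lemma weightvec_f_exp s m x : wt m x -> wt (m - 2 * s%:Z) (f ^+ s *: x).
Proof.
elim: s m x => [|s IH] m x wx; first by rewrite scale1r mulr0 subr0.
rewrite exprSr -scalerA (_ : m - _ = (m - 2) - 2 * s%:Z); last lia.
exact/IH/weightvec_f.
Qed.

Definition ef_coef (s : nat) : K := c * ((q ^+ s.+1 - q ^- s.+1) / (q - q^-1)).

Lemma ef_coef_neq0 s : ef_coef s != 0.
Proof.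
rewrite /ef_coef !mulf_neq0 ?invr_eq0 ?qdenom_neq0 //.
exact: (@qpow_sub_neq0 s.+1).
Qed.

Lemma actK_fexp s x : k *: (f ^+ s *: x) = (q ^- s) ^+ 2 *:: (f ^+ s *: (k *: x)).
Proof.
elim: s x => [|s IH] x; first by rewrite !scale1r expr0 invr1 expr1n kscale1.
rewrite exprSr -!scalerA IH actF scaler_kscale kscaleA !scalerA; congr (_ *:: _).
by rewrite [q ^+ s.+1]exprS; field; rewrite q_neq0 expf_neq0.
Qed.

Lemma actK'_fexp s x : k' *: (f ^+ s *: x) = (q ^+ s) ^+ 2 *:: (f ^+ s *: (k' *: x)).
Proof.
elim: s x => [|s IH] x; first by rewrite !scale1r expr0 expr1n kscale1.
rewrite exprSr -!scalerA IH actF' scaler_kscale kscaleA !scalerA; congr (_ *:: _).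
by rewrite [q ^+ s.+1]exprS; ring.
Qed.

Lemma ef_exp s x : e *: x = 0 ->
  e *: (f ^+ s.+1 *: x) =
  ef_coef s *:: (f ^+ s *: ((q ^- s) *:: (k *: x) - (q ^+ s) *:: (k' *: x))).
Proof.
have q1 := qdenom_neq0.
move=> ex; elim: s => [|s IH].
  rewrite expr1 actEF ex scaler0 add0r expr0 invr1 scale1r !kscale1 /ef_coef.
  by rewrite !expr1 divff // mulr1.
rewrite exprS -scalerA actEF IH actK_fexp actK'_fexp.
rewrite scaler_kscale !scalerBr !scaler_kscale [f *: _]scalerA -exprS.
rewrite [f *: (f ^+ s *: (k' *: x))]scalerA -exprS !kscaleBr !kscaleA.
rewrite addrACA -opprD -!kscaleDl.
have q21 : q * q - 1 != 0.
  by have := mulf_neq0 q_neq0 q1; rewrite mulrBr mulfV.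
congr (_ *:: _ - _ *:: _); rewrite /ef_coef [q ^+ s.+2]exprS [q ^+ s.+1]exprS;
  move: (q ^+ s) (expf_neq0 s q_neq0) => t t0; field; rewrite q_neq0 t0 q21 //.
Qed.

Lemma weightvec_inv m x : wt m x -> k' *: x = (q ^ (- m)) *:: x.
Proof. by move=> wx; have := weightvec_flip q_neq0 T wx. Qed.

Lemma ef_exp_weight s m x : e *: x = 0 -> wt m x ->
  e *: (f ^+ s.+1 *: x) =
  (ef_coef s * (q ^ (m - s%:Z) - q ^ (- (m - s%:Z)))) *:: (f ^+ s *: x).
Proof.
move=> ex wx; rewrite ef_exp // wx (weightvec_inv wx) !kscaleA -kscaleBl.
rewrite scaler_kscale kscaleA; congr (_ * _ *:: _).
by rewrite expfzDr // opprB expfzDr // exprnN mulrC.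
Qed.

Lemma ef_weight_coef_neq0 s m : m != s%:Z ->
  ef_coef s * (q ^ (m - s%:Z) - q ^ (- (m - s%:Z))) != 0.
Proof. by move=> ms; rewrite mulf_neq0 ?ef_coef_neq0 // qpow_sub_neq0 // subr_eq0. Qed.

(** [e] sends f^(t+1) x to a multiple of f^t x, and the factor [t+1] [m-t] is
    non-zero for m <> t. *)
Lemma fexp_neq0 s m x : x != 0 -> e *: x = 0 -> wt m x ->
  (forall t : nat, (t < s)%N -> m != t%:Z) -> f ^+ s *: x != 0.
Proof.
move=> x0 ex wx; elim: s => [|s IH] ms; first by rewrite scale1r.
apply/eqP => fx.
have := ef_exp_weight s ex wx; rewrite fx scaler0 => /esym/kscale_eq0[].
  by apply/eqP; apply: ef_weight_coef_neq0; apply: ms.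
by apply/eqP; apply: IH => t ts; apply: ms; apply: leqW.
Qed.

Lemma highest_weight_ge0 N m x : x != 0 -> e *: x = 0 -> wt m x ->
  f ^+ N *: x = 0 -> 0 <= m.
Proof.
move=> x0 ex wx; apply: contra_eqT; rewrite -ltNge => m0.
by apply: (fexp_neq0 x0 ex wx) => t _; lia.
Qed.

(** The vector in the conclusion has weight -m: weights are symmetric.  It is
    obtained by raising [x] to the top of its string, where the weight is m + 2s,
    and lowering the result m + s times, which does not reach its bottom. *)
Lemma string_reflect N m x : x != 0 -> wt m x -> 0 <= m -> e ^+ N *: x = 0 ->
  exists s, f ^+ (`|m| + s)%N *: (e ^+ s *: x) != 0.
Proof.
move=> x0 wx m0 eN.
have exN : exists s, e ^+ s *: x == 0 by exists N; apply/eqP.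
case: (ex_minnP exN) => [[|s]] => [|/eqP es mins].
  by rewrite scale1r (negbTE x0).
have ys : e ^+ s *: x != 0 by apply/negP => /mins; rewrite ltnn.
exists s; apply: (fexp_neq0 ys _ (weightvec_e_exp s wx)); first by rewrite scalerA -exprS.
by move=> t ts; lia.
Qed.

(** The action of the quantum Casimir element; [casimir_value m] is its
    eigenvalue on highest weight vectors of weight [m]. *)
Definition casimir (x : M) : M :=
  f *: (e *: x) + (c ^+ 2) *:: (q *:: (k *: x) + q^-1 *:: (k' *: x)).

Definition casimir_value (m : int) : K := c ^+ 2 * (q ^ (m + 1) + q ^ (- (m + 1))).

(** The product of the operators C - c_(m+2i) for i < j, where C is the Casimir
    operator and c_p stands for [casimir_value p]. *)
Fixpoint casimir_prod (m : int) (j : nat) (x : M) : M :=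
  if j is j'.+1 then
    let y := casimir_prod (m + 2) j' x in casimir y - casimir_value m *:: y
  else x.

Definition central_op (phi : M -> M) : Prop :=
  [/\ zmod_morphism phi, forall b x, phi (b *:: x) = b *:: phi x
    & forall x, [/\ phi (e *: x) = e *: phi x, phi (f *: x) = f *: phi x
        & phi (k *: x) = k *: phi x]].

Lemma casimirE m x : wt m x -> casimir x = f *: (e *: x) + casimir_value m *:: x.
Proof.
move=> wx; rewrite /casimir wx (weightvec_inv wx) !kscaleA -kscaleDl kscaleA.
congr (_ + (_ * (_ + _)) *:: _); first by rewrite expfzDr // expr1z mulrC.
by rewrite opprD expfzDr // exprN1 mulrC.
Qed.

Lemma casimir_central : central_op casimir.
Proof.
have q1 := qdenom_neq0.
have q21 : q * q - 1 != 0.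
  by have := mulf_neq0 q_neq0 q1; rewrite mulrBr mulfV.
split=> [x y|b x|x].
- rewrite /casimir !scalerBr !kscaleBr opprD [RHS]addrACA -[in RHS]kscaleBr.
  by congr (_ + _ *:: _); rewrite opprD addrACA.
- rewrite /casimir !scaler_kscale !kscaleA !kscaleDr !kscaleA.
  by congr (_ + (_ *:: _ + _ *:: _)); ring.
rewrite /casimir; split.
- rewrite [RHS]scalerDr actEF -[RHS]addrA actE actE'; congr (_ + _).
  rewrite !scaler_kscale scalerDr !scaler_kscale kscaleBr !kscaleDr !kscaleA -kscaleNl.
  rewrite addrACA -!kscaleDl.
  by congr (_ *:: _ + _ *:: _); field; rewrite q_neq0 q21.
- rewrite actEF actF actF' !scalerDr -[LHS]addrA; congr (_ + _).
  rewrite !scaler_kscale scalerBr scalerDr !scaler_kscale kscaleBr !kscaleDr !kscaleA -kscaleNl.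
  rewrite addrACA -!kscaleDl.
  by congr (_ *:: _ + _ *:: _); field; rewrite q_neq0 q21.
- rewrite [RHS]scalerDr actF actE !scaler_kscale kscaleA scalerDr !scaler_kscale.
  rewrite mulVf ?expf_neq0 // kscale1.
  by rewrite actKK' actK'K.
Qed.


Lemma central_comm phi : central_op phi ->
  forall x, phi (casimir x) = casimir (phi x).
Proof.
move=> [pB pZ pefk] x.
have p0 : phi 0 = 0 by have := pB 0 0; rewrite !subrr.
have pN z : phi (- z) = - phi z by rewrite -sub0r pB p0 sub0r.
have pD y z : phi (y + z) = phi y + phi z by rewrite -{1}[z]opprK pB pN opprK.
have pk' y : phi (k' *: y) = k' *: phi y.
  by have [_ _ h] := pefk (k' *: y); rewrite -[RHS]/(k' *: phi y) -{2}(actKK' y) h actK'K.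
rewrite /casimir !(pD, pZ) pk'.
by have [_ -> _] := pefk (e *: x); have [-> _ ->] := pefk x.
Qed.

Lemma central_prod m j : central_op (casimir_prod m j).
Proof.
have [cB cZ cefk] := casimir_central.
elim: j m => [|j IH] m; first by split.
have [pB pZ pefk] := IH (m + 2); split=> [x y|b x|x] /=.
- by rewrite pB cB kscaleBr !opprD !opprK addrACA.
- by rewrite pZ cZ kscaleBr !kscaleA mulrC.
- have [-> -> ->] := pefk x; have [-> -> ->] := cefk (casimir_prod (m + 2) j x).
  by rewrite !scalerBr !scaler_kscale.
Qed.

(** On a vector of weight m the operator C - c_m acts as f e, and the other
    factors commute with [f]; so the claim for [x] follows from the one for e x,
    whose weight is m + 2. *)
Lemma casimir_prod_kill m j x : wt m x -> e ^+ j *: x = 0 -> casimir_prod m j x = 0.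
Proof.
elim: j m x => [|j IH] m x wx; first by rewrite scale1r.
rewrite exprSr -scalerA => ex /=.
have [pB pZ pefk] := central_prod (m + 2) j.
rewrite -(central_comm (central_prod _ _)) -pZ -pB (casimirE wx) addrK.
have [_ -> _] := pefk (e *: x).
by rewrite IH ?scaler0 //; apply: weightvec_e.
Qed.

Lemma casimir_prod_hw m p j x : e *: x = 0 -> wt m x ->
  casimir_prod p j x = (\prod_(i < j) (casimir_value m - casimir_value (p + 2 * i%:Z))) *:: x.
Proof.
move=> ex wx; elim: j p => [|j IH] p /=; first by rewrite big_ord0 kscale1.
rewrite IH big_ord_recl mulr0 addr0.
have [_ -> _] := casimir_central.
rewrite (casimirE wx) ex scaler0 add0r !kscaleA -kscaleBl; congr (_ *:: _).
rewrite mulrC -mulrBl; congr (_ * _).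
apply: eq_bigr => i _; congr (_ - casimir_value _).
by rewrite /= /bump /=; lia.
Qed.


Hypothesis two_neq0 : (2 : K) != 0.

(** The difference c_m - c_p is a non-zero multiple of the product of
    q^h - q^-h for h = (m - p) / 2 and h = (m + p + 2) / 2. *)
Lemma casimir_value_sep m i : 0 <= m ->
  casimir_value m - casimir_value (m + 2 + 2 * i%:Z) != 0.
Proof.
move=> m0; have c0 : c ^+ 2 != 0 by rewrite expf_neq0 // invr_eq0 qdenom_neq0.
rewrite -mulrBr mulf_neq0 //.
have -> : q ^ (m + 1) + q ^ (- (m + 1)) -
    (q ^ (m + 2 + 2 * i%:Z + 1) + q ^ (- (m + 2 + 2 * i%:Z + 1))) =
  - ((q ^ (m + 2 + i%:Z) - q ^ (- (m + 2 + i%:Z))) * (q ^ (1 + i%:Z) - q ^ (- (1 + i%:Z)))).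
  rewrite mulrBl !mulrBr -!expfzDr // !opprB.
  rewrite (_ : m + 2 + i%:Z + (1 + i%:Z) = m + 2 + 2 * i%:Z + 1); last lia.
  rewrite (_ : m + 2 + i%:Z - (1 + i%:Z) = m + 1); last lia.
  rewrite (_ : - (m + 2 + i%:Z) + (1 + i%:Z) = - (m + 1)); last lia.
  rewrite (_ : - (m + 2 + i%:Z) - (1 + i%:Z) = - (m + 2 + 2 * i%:Z + 1)); last lia.
  ring.
by rewrite oppr_eq0 mulf_neq0 // qpow_sub_neq0 //; lia.
Qed.

(** A Jordan block of [k] has length one.  Put y = (k - q^m) x, and suppose that
    y is non-zero.  By induction on the power of [e] that kills [x] the claim holds
    for e x, hence e y = 0 and m >= 0.  Apply to [x] a product of operators C - c_p
    with p > m: it kills e x but multiplies y by a non-zero scalar, so this reduces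
    the claim to the case e x = 0.  Then apply [e] to the powers f^t x.  For t > m
    they vanish, by descending induction on t; for t = m the result is a non-zero
    multiple of f^m y, which is not zero. *)
Lemma k_semisimple m x :
  (exists N, e ^+ N *: x = 0) -> (forall y, exists N, f ^+ N *: y = 0) ->
  wt m (k *: x - (q ^ m) *:: x) -> wt m x.
Proof.
move=> [N eN] fnil; elim: N m x eN => [|N IH] m x.
  by rewrite scale1r /weightvec => ->; rewrite kscaler0 scaler0.
rewrite exprSr -scalerA; set y := _ - _ => eN wy.
have q2 : q ^+ 2 != 0 by rewrite expf_neq0.
have kx : k *: x = (q ^ m) *:: x + y by rewrite /y addrC subrK.
have wex : k *: (e *: x) - (q ^ (m + 2)) *:: (e *: x) = (q ^+ 2) *:: (e *: y).
  rewrite actE kx scalerDr kscaleDr scaler_kscale kscaleA addrC addrA.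
  by rewrite expfzDr // [q ^ m * _]mulrC addNr add0r.
have {IH} IH : wt (m + 2) (e *: x).
  apply: IH => //; rewrite wex /weightvec scaler_kscale.
  by rewrite (weightvec_e wy) !kscaleA mulrC.
have ey : e *: y = 0.
  by move: wex; rewrite IH subrr => /esym/kscale_eq0[] // /eqP; rewrite (negbTE q2).
have [y0|y0] := eqVneq y 0; first by rewrite /weightvec kx y0 addr0.
have m0 : 0 <= m by have [Ny fy] := fnil y; apply: highest_weight_ge0 fy.
have [pB pZ pefk] := central_prod (m + 2) N.
(* e x has weight m + 2, so the values to remove start at m + 2 *)
pose s := \prod_(i < N) (casimir_value m - casimir_value (m + 2 + 2 * i%:Z)).
have s0 : s != 0 by rewrite prodf_seq_neq0; apply/allP => i _; apply: casimir_value_sep.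
pose x' := casimir_prod (m + 2) N x.
have ex' : e *: x' = 0.
  by have [<- _ _] := pefk x; apply: casimir_prod_kill.
pose y' := s *:: y.
have y'0 : y' != 0.
  by apply/eqP => /kscale_eq0[/eqP|/eqP]; rewrite ?(negbTE s0) ?(negbTE y0).
have wy' : wt m y' by rewrite /weightvec scaler_kscale wy !kscaleA mulrC.
have ey' : e *: y' = 0 by rewrite scaler_kscale ey kscaler0.
have kx' : k *: x' = (q ^ m) *:: x' + y'.
  have [_ _ <-] := pefk x; apply/eqP; rewrite [X in _ == X]addrC -subr_eq -pZ -pB -/y.
  by rewrite (casimir_prod_hw (m + 2) N ey wy).
have k'x' : k' *: x' = (q ^ (- m)) *:: x' - ((q ^ (- m)) ^+ 2) *:: y'.
  have := congr1 (fun z => (q ^ (- m)) *:: (k' *: z)) kx'.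
  rewrite actK'K scalerDr scaler_kscale kscaleDr kscaleA -expfzDr // addNr kscale1 => ->.
  by rewrite (weightvec_inv wy') expr2 -kscaleA addrK.
have step t : (`|m| <= t)%N ->
  e *: (f ^+ t.+1 *: x') =
  (ef_coef t * (q ^ (m - t%:Z) - q ^ (- (m - t%:Z)))) *:: (f ^+ t *: x') +
  (ef_coef t * (q ^- t + q ^+ t * (q ^ (- m)) ^+ 2)) *:: (f ^+ t *: y').
  move=> mt; rewrite ef_exp // kx' k'x'.
  rewrite [q ^- t *:: _]kscaleDr [q ^+ t *:: _]kscaleBr !kscaleA opprD opprK addrACA.
  rewrite -kscaleBl -kscaleDl scalerDr !scaler_kscale.
  rewrite kscaleDr !kscaleA; congr (_ * _ *:: _ + _ *:: _); last by ring.
  by rewrite opprB !expfzDr // exprnN [q ^ m * _]mulrC.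
have fy'0 t : (`|m| < t)%N -> f ^+ t *: y' = 0.
  move=> mt; suff fm : f ^+ `|m|.+1 *: y' = 0.
    by rewrite -(subnK mt) exprD -scalerA fm scaler0.
  have [//|f0] := eqVneq (f ^+ `|m|.+1 *: y') 0.
  have [Nf fN] := fnil (f ^+ `|m|.+1 *: y').
  have := highest_weight_ge0 f0 _ (weightvec_f_exp `|m|.+1 wy') fN.
  rewrite (ef_exp_weight _ ey' wy') (_ : m - `|m|%N%:Z = 0); last lia.
  by rewrite oppr0 subrr mulr0 kscale0 => /(_ erefl); lia.
(* for t > m the coefficient of f^t x' in [step] is non-zero *)
have fx'0 t : f ^+ (t + `|m|.+1)%N *: x' = 0 -> f ^+ `|m|.+1 *: x' = 0.
  elim: t => // t IHt ft; apply: IHt; have := step (t + `|m|.+1)%N.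
  rewrite -addSn ft scaler0 fy'0 ?kscaler0 ?addr0; last lia.
  case/(_ _)/esym/kscale_eq0 => //; first lia.
  by move/eqP; rewrite (negbTE (ef_weight_coef_neq0 _)) //; lia.
have [T' fT] := fnil x'.
have := fx'0 T'; rewrite exprD -scalerA.
have -> : f ^+ T' *: (f ^+ `|m|.+1 *: x') = 0.
  by rewrite scalerA -exprD addnC exprD -scalerA fT scaler0.
case/(_ erefl)/esym => fm; have := step `|m|%N (leqnn _).
rewrite -fm scaler0 (_ : m - `|m|%N%:Z = 0); last lia.
rewrite oppr0 subrr mulr0 kscale0 add0r => /esym/kscale_eq0[/eqP|/eqP].
  rewrite mulf_eq0 (negbTE (ef_coef_neq0 _)) /=.
  rewrite [X in _ + X * _](_ : _ = q ^ m).
    2: by rewrite -[LHS]/(q ^ `|m|%N%:Z); congr (_ ^ _); lia.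
  rewrite expr2 mulrA -expfzDr // subrr mul1r exprnN (_ : - `|m|%N%:Z = - m); last lia.
  rewrite -mulr2n -mulr_natl mulf_eq0 (negbTE two_neq0) expfz_eq0 (negbTE q_neq0) andbF //.
rewrite (negbTE (fexp_neq0 y'0 ey' wy' _)) // => t; lia.
Qed.
End SL2Theory.

(** * Presented algebras, spans and subquotients *)
Section FreeAlgebraMaps.
Context {K : fieldType}.

Lemma free_scaleE (G : choiceType) (c : K) (x : free_alg K G) :
  c *: x = alg_const c * x.
Proof. by rewrite /alg_const /= mulr_algl. Qed.

Definition free_mon (G : choiceType) (m : {fmonom G}) : free_alg K G := << m >>.

Lemma free_monM (G : choiceType) (m1 m2 : {fmonom G}) :
  free_mon (mmul m1 m2) = free_mon m1 * free_mon m2.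
Proof. by symmetry; apply: (etrans (fgmulUU _ _ _ _)); rewrite mulr1. Qed.

Lemma free_alg_ind (G : choiceType) (P : free_alg K G -> Prop) :
  (forall x y, P x -> P y -> P (x + y)) ->
  (forall c x, P x -> P (alg_const c * x)) ->
  P 1 -> (forall g x, P x -> P (free_gen K g * x)) -> forall x, P x.
Proof.
move=> PD PC P1 Pg x.
have P0 : P 0 by rewrite -(mul0r 1) -(rmorph0 alg_const); apply: PC.
rewrite [x]monalgE; elim/big_ind: _ => // m _.
suff Pm : P (free_mon m).
  have -> : << x@_m *g m >> = alg_const x@_m * free_mon m :> free_alg K G.
    rewrite -free_scaleE; apply/malgP => m'; rewrite mcoeffZ !mcoeffU.
    by rewrite mulrnAr mulr1.
  exact: PC.
case: m => s; elim: s => [|g s IH]; first by rewrite -fmoneE.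
suff -> : FMonom (g :: s) = mmul (fmu g) (FMonom s) by rewrite free_monM; apply: Pg.
by apply/eqP; rewrite fmP fmM fmU.
Qed.

Definition word_prod (G H : choiceType) (f : G -> free_alg K H) (m : {fmonom G}) :
  free_alg K H := \prod_(g <- (m : seq G)) f g.

Fact word_prod_morph (G H : choiceType) (f : G -> free_alg K H) :
  mmorphism (word_prod f).
Proof.
by split=> [m1 m2|]; rewrite /word_prod ?fm1 ?big_nil // fmM big_cat.
Qed.
HB.instance Definition _ (G H : choiceType) (f : G -> free_alg K H) :=
  isMultiplicative.Build {fmonom G} (free_alg K H) (word_prod f) (word_prod_morph f).

Section Lift.
Context {G H : choiceType} (f : G -> free_alg K H).

Definition free_lift : free_alg K G -> free_alg K H :=
  mmap (@alg_const K (free_alg K H)) (word_prod f).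

Fact free_lift_zmod : zmod_morphism free_lift.
Proof. exact: mmap_is_additive. Qed.

Fact free_lift_monoid : monoid_morphism free_lift.
Proof.
have [] := @commr_mmap_is_multiplicative {fmonom G} K (free_alg K H) alg_const (word_prod f).
  by move=> g m m'; rewrite /GRing.comm alg_const_central.
by move=> hM h1; split.
Qed.
HB.instance Definition _ := GRing.isZmodMorphism.Build _ _ free_lift free_lift_zmod.
HB.instance Definition _ := GRing.isMonoidMorphism.Build _ _ free_lift free_lift_monoid.

Lemma free_lift_gen g : free_lift (free_gen K g) = f g.
Proof.
apply: (etrans (mmapU _ _)); rewrite [X in X * _](rmorph1 alg_const) mul1r.
by rewrite /word_prod fmU big_seq1.
Qed.

Lemma free_lift_const c : free_lift (alg_const c) = alg_const c.
Proof.
rewrite -[in LHS](mulr1 (alg_const c)) -free_scaleE.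
by apply: (etrans (mmapZ _ _)); rewrite mmap1 mulr1.
Qed.
End Lift.
End FreeAlgebraMaps.

Section Presented.
Context {K : fieldType} {G : choiceType} (Rel : free_alg K G -> free_alg K G -> Prop).
Local Notation A := (presented_alg Rel).
Implicit Types (x y z : free_alg K G).

Definition presented_proj : {rmorphism free_alg K G -> A} := quot_proj (presented_ideal Rel).

Lemma presented_projZ c x : presented_proj (c *: x) = alg_const c * presented_proj x.
Proof. by rewrite free_scaleE rmorphM. Qed.

Lemma presented_proj_eq x y : Rel x y -> presented_proj x = presented_proj y.
Proof.
move=> Rxy; apply/(quotring_eqP (presented_ideal Rel))/ideal_predP => I [_]; apply.
by exists x, y.
Qed.

Lemma presented_projM x y : presented_proj (x * y) = presented_proj x * presented_proj y.
Proof. exact: rmorphM. Qed.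

Lemma presented_projB x y : presented_proj (x - y) = presented_proj x - presented_proj y.
Proof. exact: rmorphB. Qed.

Lemma presented_rel_mul x y x' y' : Rel (x * y) (x' * y') ->
  presented_proj x * presented_proj y = presented_proj x' * presented_proj y'.
Proof. by move=> h; rewrite -presented_projM (presented_proj_eq h) presented_projM. Qed.

Lemma presented_rel_mulZ x y c x' y' : Rel (x * y) (c *: (x' * y')) ->
  presented_proj x * presented_proj y =
  alg_const c * (presented_proj x' * presented_proj y').
Proof.
move=> h; rewrite -(presented_projM x y) (presented_proj_eq h) presented_projZ.
by rewrite presented_projM.
Qed.

Lemma presented_rel_inv x y : Rel (x * y) 1 -> presented_proj x * presented_proj y = 1.
Proof. by move=> h; rewrite -presented_projM (presented_proj_eq h) rmorph1. Qed.

Lemma presented_rel_commutator x y c z : Rel (x * y - y * x) (c *: z) ->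
  presented_proj x * presented_proj y - presented_proj y * presented_proj x =
  alg_const c * presented_proj z.
Proof.
move=> h; rewrite -presented_projZ -(presented_proj_eq h) presented_projB.
exact: esym (congr2 (fun s t => s - t) (presented_projM x y) (presented_projM y x)).
Qed.

Lemma presented_proj_surj (x : A) : exists y, x = presented_proj y.
Proof. by exists (repr x); rewrite /presented_proj /= /quot_proj reprK. Qed.

Lemma presented_ind (P : A -> Prop) :
  (forall x y : A, P x -> P y -> P (x + y)) ->
  (forall c (x : A), P x -> P (alg_const c * x)) ->
  P 1 -> (forall g (x : A), P x -> P (presented_gen Rel g * x)) -> forall x : A, P x.
Proof.
move=> PD PC P1 Pg x; have [y ->] := presented_proj_surj x.
move: y; apply: free_alg_ind => [y z Py Pz|c y Py||g y Py].
- by rewrite rmorphD; apply: PD.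
- by rewrite rmorphM; apply: PC.
- by rewrite rmorph1.
- by rewrite rmorphM; apply: Pg.
Qed.

End Presented.

Section QuotLift.
Context {A B : pzRingType} (I : ideal A) (phi : {rmorphism A -> B}).
Hypothesis phiI : forall x, ideal_set I x -> phi x = 0.

Definition quot_lift (x : quotring I) : B := phi (repr x).

Lemma quot_lift_proj x : quot_lift (quot_proj I x) = phi x.
Proof.
apply/eqP; rewrite -subr_eq0 -rmorphB; apply/eqP/phiI/ideal_predP/quotring_eqP.
by rewrite reprK.
Qed.

Fact quot_lift_zmod : zmod_morphism quot_lift.
Proof.
move=> x y; rewrite -[x]reprK -[y]reprK -!/(quot_proj I (repr _)) -rmorphB.
by rewrite !quot_lift_proj rmorphB.
Qed.

Fact quot_lift_monoid : monoid_morphism quot_lift.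
Proof.
split=> [|x y]; first by rewrite -(rmorph1 phi) -quot_lift_proj rmorph1.
rewrite -[x]reprK -[y]reprK -!/(quot_proj I (repr _)) -rmorphM.
by rewrite !quot_lift_proj rmorphM.
Qed.
HB.instance Definition _ := GRing.isZmodMorphism.Build _ _ quot_lift quot_lift_zmod.
HB.instance Definition _ := GRing.isMonoidMorphism.Build _ _ quot_lift quot_lift_monoid.

Lemma quot_lift_exists : exists psi : {rmorphism quotring I -> B},
  forall x, psi (quot_proj I x) = phi x.
Proof. by exists quot_lift; apply: quot_lift_proj. Qed.
End QuotLift.

Lemma presented_lift_exists (K : fieldType) (G : choiceType)
    (Rel : free_alg K G -> free_alg K G -> Prop) (B : pzAlgType K)
    (phi : {rmorphism free_alg K G -> B}) :
  (forall x y, Rel x y -> phi x = phi y) ->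
  exists psi : {rmorphism presented_alg Rel -> B},
    forall x, psi (presented_proj Rel x) = phi x.
Proof.
move=> phiR; apply: (quot_lift_exists (I := presented_ideal Rel)) => x.
move/(_ [set z | phi z = 0]); apply; split.
  2: by move=> _ [y [z [/phiR e ->]]]; rewrite /= rmorphB e subrr.
split=> [|y z|y z t] /=; first by rewrite rmorph0.
  by move=> ey ez; rewrite rmorphD ey ez addr0.
by move=> ez; rewrite !rmorphM ez mulr0 mul0r.
Qed.

Section Spans.
Context {K : fieldType} {A : pzAlgType K} {M : lmodType A}.
Implicit Types (P Q : M -> Prop) (x y : M) (u : A).

(** Spans are over the ground field: only scalars of [K] occur, although [M] is
    a module over the larger ring [A]. *)
Inductive span P : M -> Prop :=
| span_zero : span P 0
| span_cons c x y : P x -> span P y -> span P (c *:: x + y).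

Lemma span_in P x : P x -> span P x.
Proof. by move=> Px; rewrite -[x]addr0 -[x]kscale1; constructor=> //; constructor. Qed.

Lemma spanD P x y : span P x -> span P y -> span P (x + y).
Proof.
move=> sx sy; elim: sx => [|c z t Pz _ IH]; first by rewrite add0r.
by rewrite -addrA; constructor.
Qed.

Lemma spanZ P b x : span P x -> span P (b *:: x).
Proof.
elim=> [|c z t Pz _ IH]; first by rewrite kscaler0; constructor.
by rewrite kscaleDr kscaleA; constructor.
Qed.

Lemma span_map P Q u x : (forall y, P y -> span Q (u *: y)) -> span P x -> span Q (u *: x).
Proof.
move=> PQ; elim=> [|c z t Pz _ IH]; first by rewrite scaler0; constructor.
by rewrite scalerDr scaler_kscale; apply: spanD => //; apply/spanZ/PQ.
Qed.

Lemma span_trans P Q x : (forall y, P y -> span Q y) -> span P x -> span Q x.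
Proof.
by move=> PQ /(@span_map P Q 1); rewrite !scale1r; apply=> y; rewrite scale1r; apply: PQ.
Qed.

Lemma span_sum P (I : Type) (r : seq I) (F : I -> M) :
  (forall i, span P (F i)) -> span P (\sum_(i <- r) F i).
Proof.
by move=> PF; elim/big_rec: _ => [|i x _]; [constructor|apply: spanD].
Qed.

Lemma span_neq0 P x : span P x -> x != 0 -> exists2 y, P y & y != 0.
Proof.
elim=> [|c y z Py _ IH]; first by rewrite eqxx.
have [->|y0] := eqVneq y 0; last by exists y.
by rewrite kscaler0 add0r.
Qed.

Lemma span_seq (s : seq M) x : span (fun y => y \in s) x ->
  exists c : nat -> K, x = \sum_(i < size s) (alg_const (c i) : A) *: s`_i.
Proof.
elim=> [|b y z ys _ [c ->]].
  by exists (fun=> 0); rewrite big1 // => i _; rewrite rmorph0 scale0r.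
exists (fun i => (i == index y s)%:R * b + c i).
under [RHS]eq_bigr do rewrite rmorphD scalerDl.
rewrite big_split /=; congr (_ + _).
have ys' : (index y s < size s)%N by rewrite index_mem.
rewrite (bigD1 (Ordinal ys')) //= eqxx mul1r nth_index // big1 ?addr0 // => i.
by rewrite -val_eqE /= => /negbTE->; rewrite mul0r rmorph0 scale0r.
Qed.
End Spans.

Section Submod.
Context {R : pzRingType} {V : lmodType R} (P : V -> Prop).
Hypothesis P_closed :
  [/\ P 0, forall x y, P x -> P y -> P (x + y) & forall c x, P x -> P (c *: x)].

Definition prop_pred : {pred V} := fun x => `[< P x >].

Fact prop_pred_closed : submod_closed prop_pred.
Proof.
case: P_closed => P0 PD PZ; split; first exact/asboolP.
by move=> c x y /asboolP Px /asboolP Py; apply/asboolP/PD => //; apply: PZ.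
Qed.
HB.instance Definition _ := GRing.isSubmodClosed.Build R V prop_pred prop_pred_closed.

Lemma submod_exists : exists N : submodClosed V, forall x, x \in N <-> P x.
Proof.
by exists (GRing.SubmodClosed.clone R V prop_pred _) => x; split=> [/asboolP|/asboolP].
Qed.
End Submod.

Section FactorTheory.
Context {R : pzRingType} {V : lmodType R} (N' N : submodClosed V).

Definition fclass (x : submod N) : factor N' N := \pi_(quotmod (@pull_pred _ _ N' N)) x.

Lemma fclassP z : exists x : submod N, z = fclass x.
Proof. by exists (repr z); rewrite /fclass reprK. Qed.

Fact fclass_linear : linear fclass.
Proof.
move=> c x y; rewrite /fclass quotmodD; congr (_ + _).
by symmetry; apply: quotmod_scaleE.
Qed.
HB.instance Definition _ :=
  GRing.isLinear.Build R (submod N) (factor N' N) _ fclass fclass_linear.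

Lemma fclassZ c x : fclass (c *: x) = c *: fclass x.
Proof. exact: linearZ. Qed.

Lemma submod_valZ c (x : submod N) : val (c *: x) = c *: val x.
Proof. exact: linearZ. Qed.

Lemma submod_val_sum (I : Type) (r : seq I) (F : I -> submod N) :
  val (\sum_(i <- r) F i) = \sum_(i <- r) val (F i).
Proof. exact: linear_sum. Qed.

Lemma fclass_sum (I : Type) (r : seq I) (F : I -> submod N) :
  fclass (\sum_(i <- r) F i) = \sum_(i <- r) fclass (F i).
Proof. exact: linear_sum. Qed.

Lemma fclass_eq0 x : fclass x = 0 <-> val x \in N'.
Proof.
rewrite -(linear0 fclass); split.
  by move/quotmod_eqP; rewrite subr0.
by move=> xN; apply/quotmod_eqP; rewrite subr0.
Qed.

Lemma fclass_ex v : v \in N -> exists x : submod N, val x = v.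
Proof. by move=> vN; exists (Sub v vN). Qed.
End FactorTheory.

(** * Composition series *)
Section SimpleModules.
Context {R : pzRingType} {L : lmodType R}.
Hypothesis simpleL : simple_module L.

Lemma simple_closed_full (P : L -> Prop) :
  P 0 -> (forall x y, P x -> P y -> P (x + y)) -> (forall c x, P x -> P (c *: x)) ->
  (exists2 x, P x & x != 0) -> forall x, P x.
Proof.
move=> P0 PD PZ [x Px x0] y.
have [N NP] := submod_exists (And3 P0 PD PZ).
have [_ /(_ N)[z|a]] := simpleL; last exact/NP/a.
by move: x0; rewrite (z x) ?eqxx //; apply/NP.
Qed.
End SimpleModules.

Section CompositionSeries.
Context {K : fieldType} {A : pzAlgType K} {M : lmodType A}.

Definition strict_chain (r : nat) (N : nat -> submodClosed M) : Prop :=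
  [/\ forall x, x \in N 0%N -> x = 0, forall x, x \in N r,
      forall i, (i < r)%N -> {subset N i <= N i.+1}
    & forall i, (i < r)%N -> exists2 x, x \in N i.+1 & x \notin N i].

(** Vectors chosen in the successive differences are linearly independent: in a
    linear relation, the last vector with a non-zero coefficient would lie in the
    previous submodule. *)
Lemma strict_chain_bound (s : seq M) (r : nat) N :
  (forall x, exists c : nat -> K, x = \sum_(i < size s) (alg_const (c i) : A) *: s`_i) ->
  strict_chain r N -> (r <= size s)%N.
Proof.
move=> sP [_ _ inc strict]; rewrite leqNgt; apply/negP => lt_sr.
have /fin_all_exists2[x xN x'N] (i : 'I_r) : exists2 x, x \in N i.+1 & x \notin N i.
  exact: strict.
have /fin_all_exists[c xc] (i : 'I_r) := sP (x i).
pose C : 'M[K]_(r, size s) := \matrix_(i, j) c i j.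
have : kermx C != 0.
  apply: contraL lt_sr; rewrite kermx_eq0 -leqNgt => /eqP <-; exact: rank_leq_col.
case/rowV0Pn => b /sub_kermxP bC b0.
have bx : \sum_i b 0 i *:: x i = 0.
  rewrite (eq_bigr (fun i => \sum_(j < size s) b 0 i *:: ((alg_const (c i j) : A) *: s`_j))).
    2: by move=> i _; rewrite xc raddf_sum.
  rewrite exchange_big big1 //= => j _.
  transitivity ((b *m C) 0 j *:: s`_j); last by rewrite bC mxE kscale0.
  rewrite /kscale mxE rmorph_sum scaler_suml; apply: eq_bigr => i _.
  by rewrite !mxE rmorphM scalerA.
have [i0 bi0] : exists i, b 0 i != 0.
  apply/existsP; apply: contraNT b0; rewrite negb_exists => /forallP h.
  by apply/eqP/rowP => i; rewrite mxE; apply/eqP; rewrite -[_ == _]negbK.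
have [i bi imax] := @arg_maxnP _ i0 (fun i => b 0 i != 0) (fun i => i : nat) bi0.
have mono j (k : nat) : (k <= r)%N -> (j <= k)%N -> {subset N j <= N k}.
  elim: k => [|k IH] kr; first by rewrite leqn0 => /eqP->.
  rewrite leq_eqVlt => /orP[/eqP->//|jk] y yj; apply: inc => //.
  by apply: IH yj => //; apply: ltnW.
move: bx; rewrite (bigD1 i) //= => /eqP; rewrite addr_eq0 => /eqP bx.
have : b 0 i *:: x i \in N i.
  rewrite bx -scaleN1r rpredZ // rpred_sum // => j ji.
  have [->|bj] := eqVneq (b 0 j) 0; first by rewrite kscale0 rpred0.
  rewrite /kscale rpredZ //; apply: (mono j.+1 i (ltnW (ltn_ord i))) => //.
  rewrite ltn_neqAle (imax j bj : (j <= i)%N) andbT.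
  by apply: contra ji => /eqP/val_inj->.
move=> xi; move: (x'N i); rewrite -[x i]kscale1 -(mulVf bi) -kscaleA /kscale.
by rewrite rpredZ.
Qed.

(** A longest strict chain is a composition series, as a proper non-zero
    submodule of one of its factors could be inserted into the chain. *)
Lemma composition_series_exists : finite_dim M ->
  exists r N, @composition_series A M r N.
Proof.
move=> [s sP].
have [Z ZP] : exists N : submodClosed M, forall x, x \in N <-> x = 0.
  apply: submod_exists; split=> [//|x y -> ->|c x ->]; by rewrite ?addr0 ?scaler0.
have [T TP] : exists N : submodClosed M, forall x, x \in N <-> True.
  exact: submod_exists.
have exr : exists r, `[< exists N, strict_chain r N >].
  have [M0|/existsNP[x x0]] := pselect (forall x : M, x = 0).
    exists 0%N; apply/asboolP; exists (fun=> Z); split=> // x.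
    by apply/ZP/M0.
  exists 1%N; apply/asboolP; exists (fun i => if i is 0%N then Z else T).
  split=> [y yZ|y|i|i]; [exact/ZP|exact/TP| |].
    by rewrite ltnS leqn0 => /eqP-> y _; apply/TP.
  rewrite ltnS leqn0 => /eqP->; exists x; first exact/TP.
  by apply/negP => /ZP.
have bnd r : `[< exists N, strict_chain r N >] -> (r <= size s)%N.
  by move/asboolP => [N]; apply: strict_chain_bound.
case: (ex_maxnP exr bnd) => r /asboolP[N [N0 Nr inc strict]] rmax.
exists r, N; split=> // [x|i ir].
  by apply/idP/eqP => [/N0|->]; rewrite ?rpred0.
split.
  have [x xN x'N] := strict i ir; have [x' ex] := fclass_ex xN.
  exists (fclass (N i) x'); apply/eqP => /fclass_eq0; rewrite ex.
  by apply/negP.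
move=> P.
have [Q QP] : exists Q : submodClosed M, forall v, v \in Q <->
    exists2 x : submod (N i.+1), val x = v & fclass (N i) x \in P.
  apply: submod_exists; split.
  - by exists 0; rewrite ?linear0 ?rpred0.
  - by move=> _ _ [x <- xP] [y <- yP]; exists (x + y); rewrite ?linearD ?rpredD.
  - by move=> c _ [x <- xP]; exists (c *: x); rewrite ?linearZ ?rpredZ.
have NQ : {subset N i <= Q}.
  move=> v vN; apply/QP; have [x xv] := fclass_ex (inc i ir v vN); exists x => //.
  have -> : fclass (N i) x = 0 by apply/fclass_eq0; rewrite xv.
  exact: rpred0.
have QN : {subset Q <= N i.+1}.
  by move=> v /QP[x <- _]; apply: (valP x).
have [QNi|/existsNP[y /not_implyP[yQ /negP yN]]] := pselect (forall v, v \in Q -> v \in N i).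
  left=> z zP; have [x ez] := fclassP z; rewrite ez; apply/fclass_eq0/QNi/QP.
  by exists x; rewrite // -ez.
have [NQi|/existsNP[y' /not_implyP[y'N /negP y'Q]]] := pselect (forall v, v \in N i.+1 -> v \in Q).
  right=> z; have [x ->] := fclassP z; have [x' e] := (QP (val x)).1 (NQi _ (valP x)).
  by rewrite (val_inj e).
suff : (r.+1 <= r)%N by rewrite ltnn.
apply: rmax; apply/asboolP.
(* the chain with [Q] inserted between [N i] and [N i.+1] *)
pose ch t := if (t <= i)%N then N t else if t == i.+1 then Q else N t.-1.
have ch_le t : (t <= i)%N -> ch t = N t by rewrite /ch => ->.
have ch_mid : ch i.+1 = Q by rewrite /ch ltnn eqxx.
have ch_gt t : (i.+1 < t)%N -> ch t = N t.-1.
  by move=> it; rewrite /ch leqNgt (ltnW it) gtn_eqF.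
exists ch; split=> [x||t tr|t tr].
- by rewrite ch_le //; apply: N0.
- by move=> x; rewrite ch_gt.
- have [ti|it|->] := ltngtP t i.
  + by rewrite (ch_le t (ltnW ti)) ch_le //; apply: inc; lia.
  + have [ti'|it'|->] := ltngtP t i.+1; [lia| |by rewrite ch_mid ch_gt].
    rewrite (ch_gt t it') (ch_gt t.+1 (leqW it')) /=.
    by have := inc t.-1; rewrite prednK; [apply; lia|lia].
  + by rewrite ch_mid ch_le.
- have [ti|it|->] := ltngtP t i.
  + by rewrite (ch_le t (ltnW ti)) ch_le //; apply: strict; lia.
  + have [ti'|it'|->] := ltngtP t i.+1; [lia| |by rewrite ch_mid ch_gt //; exists y'].
    rewrite (ch_gt t it') (ch_gt t.+1 (leqW it')) /=.
    by have := strict t.-1; rewrite prednK; [apply; lia|lia].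
  + by rewrite ch_mid ch_le //; exists y.
Qed.
End CompositionSeries.

(** * Weight vectors *)
Lemma qv_neq0 : qv != 0.
Proof. by rewrite tofrac_eq0 polyX_eq0. Qed.

Lemma qv_free (m : int) : qv ^ m = 1 -> m = 0.
Proof.
have pow (k : nat) : qv ^+ k = 1 -> k = 0%N.
  rewrite -tofracXn -tofrac1 => /eqP; rewrite tofrac_eq => /eqP.
  by move/(congr1 (fun p : {poly rat} => size p)); rewrite size_polyXn size_poly1 => -[].
case: m => k; first by move/pow->.
by rewrite NegzE -exprnN => /(congr1 GRing.inv); rewrite invrK invr1 => /pow.
Qed.

Lemma two_neq0 : (2 : Qv) != 0.
Proof.
have -> : (2 : Qv) = tofrac 2 by rewrite tofracMn tofrac1.
by rewrite tofrac_eq0 -(polyC_natr _ 2) polyC_eq0.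
Qed.

Section QuantumParameters.
Context {n : nat} {a : 'M[int]_n} {d : 'I_n -> nat}.
Hypothesis aP : cartan_finite_type a d.
Local Notation v_ i := (qvi d i).

Lemma qvi_neq0 i : v_ i != 0.
Proof. by rewrite expf_neq0 // qv_neq0. Qed.

Lemma qvi_free i (m : int) : v_ i ^ m = 1 -> m = 0.
Proof.
rewrite /qvi -[qv ^+ d i]/(qv ^ (d i)%:Z) exprz_exp => /qv_free/eqP.
rewrite mulf_eq0 => /orP[|/eqP//]; have := d_gt0 aP i; rewrite ltr0n; lia.
Qed.

Lemma qvi_inj i (m p : int) : v_ i ^ m = v_ i ^ p -> m = p.
Proof.
move=> e; apply/eqP; rewrite -subr_eq0; apply/eqP/(@qvi_free i).
by rewrite expfzDr ?qvi_neq0 // e -expfzDr ?qvi_neq0 // subrr.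
Qed.
End QuantumParameters.

(** These relations hold for the generators of U and also for suitable elements
    of S(pi). *)
Record Uq_relations {n : nat} (a : 'M[int]_n) (d : 'I_n -> nat) (U : pzAlgType Qv)
    (E F Kg Kv : 'I_n -> U) : Prop := UqRelations {
  U_rel_KK : forall i j, Kg i * Kg j = Kg j * Kg i;
  U_rel_KKv : forall i, Kg i * Kv i = 1;
  U_rel_KvK : forall i, Kv i * Kg i = 1;
  U_rel_EF : forall i j, E i * F j - F j * E i =
    alg_const ((i == j)%:R / (qvi d i - (qvi d i)^-1)) * (Kg i - Kv i);
  U_rel_KE : forall i j, Kg i * E j = alg_const (qvi d i ^ a i j) * (E j * Kg i);
  U_rel_KF : forall i j, Kg i * F j = alg_const (qvi d i ^ (- a i j)) * (F j * Kg i)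
}.

Record Uq_generators {n : nat} (a : 'M[int]_n) (d : 'I_n -> nat) (U : pzAlgType Qv)
    (E F Kg Kv : 'I_n -> U) : Prop := UqGenerators {
  U_rels :> Uq_relations a d E F Kg Kv;
  U_gen_ind : forall P : U -> Prop,
    (forall x y, P x -> P y -> P (x + y)) ->
    (forall c x, P x -> P (alg_const c * x)) -> P 1 ->
    (forall i x, P x -> [/\ P (E i * x), P (F i * x), P (Kg i * x) & P (Kv i * x)]) ->
    forall x, P x
}.

Section UModules.
Context {n : nat} {a : 'M[int]_n} {d : 'I_n -> nat}.
Hypothesis aP : cartan_finite_type a d.
Context {U : pzAlgType Qv} {E F Kg Kv : 'I_n -> U}.
Hypothesis UP : Uq_generators a d E F Kg Kv.

Local Notation v_ i := (qvi d i).

Lemma Uq_sl2 i : sl2_triple (v_ i) (E i) (F i) (Kg i) (Kv i).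
Proof.
have a2 : a i i = 2 by case: aP.
split; first by rewrite (U_rel_KKv UP) (U_rel_KvK UP).
- by rewrite (U_rel_KE UP) a2.
- by rewrite (U_rel_KF UP) a2 -exprnN.
- by rewrite (U_rel_EF UP) eqxx mul1r.
Qed.

Section Weights.
Context {M : lmodType U}.
Implicit Types (x y : M) (nu mu : weight n).

Definition wt nu x : Prop := forall i, weightvec (v_ i) (Kg i) (pairing i nu) x.

Lemma wtE j nu x : wt nu x -> wt (nu + simple_root a j) (E j *: x).
Proof.
move=> wx i; rewrite /weightvec scalerA (U_rel_KE UP) kscale_scaler -scalerA wx.
by rewrite scaler_kscale kscaleA -expfzDr ?qvi_neq0 // addrC /pairing !mxE.
Qed.

Lemma wtF j nu x : wt nu x -> wt (nu - simple_root a j) (F j *: x).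
Proof.
move=> wx i; rewrite /weightvec scalerA (U_rel_KF UP) kscale_scaler -scalerA wx.
by rewrite scaler_kscale kscaleA -expfzDr ?qvi_neq0 // addrC /pairing !mxE.
Qed.

Lemma wt_Kinv i nu x : wt nu x -> Kv i *: x = (v_ i ^ (- pairing i nu)) *:: x.
Proof. by move=> wx; apply: (weightvec_inv (qvi_neq0 i) (Uq_sl2 i)). Qed.

Lemma wtZ c nu x : wt nu x -> wt nu (c *:: x).
Proof. by move=> wx i; apply: weightvecZ. Qed.

Lemma wtD nu x y : wt nu x -> wt nu y -> wt nu (x + y).
Proof. by move=> wx wy i; apply: weightvecD. Qed.

Lemma wt0 nu : wt nu 0.
Proof. by move=> i; rewrite /weightvec scaler0 kscaler0. Qed.

Lemma actU_EF i j x nu : wt nu x -> E i *: (F j *: x) =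
  F j *: (E i *: x) + ((i == j)%:R * qint (v_ i) (pairing i nu)) *:: x.
Proof.
move=> wx; apply/eqP; rewrite addrC -subr_eq !scalerA -scalerBl (U_rel_EF UP).
rewrite kscale_scaler scalerBl wx (wt_Kinv _ wx) -kscaleBl kscaleA.
by rewrite /qint mulrA mulrAC.
Qed.

Definition Eword (w : seq 'I_n) x := foldr (fun i y => E i *: y) x w.
Definition Fword (w : seq 'I_n) x := foldr (fun i y => F i *: y) x w.

Definition root_sum (w : seq 'I_n) : weight n := \sum_(i <- w) simple_root a i.

Lemma wt_Eword w nu x : wt nu x -> wt (nu + root_sum w) (Eword w x).
Proof.
move=> wx; rewrite /root_sum; elim: w => [|i w IH] /=; first by rewrite big_nil addr0.
by rewrite big_cons addrCA addrC; apply: wtE.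
Qed.

Lemma wt_Fword w nu x : wt nu x -> wt (nu - root_sum w) (Fword w x).
Proof.
move=> wx; rewrite /root_sum; elim: w => [|i w IH] /=; first by rewrite big_nil subr0.
by rewrite big_cons opprD addrCA addrC; apply: wtF.
Qed.

Lemma Eword0 w : Eword w 0 = 0.
Proof. by elim: w => //= i w ->; rewrite scaler0. Qed.

Lemma Fword0 w : Fword w 0 = 0.
Proof. by elim: w => //= i w ->; rewrite scaler0. Qed.

Lemma Eword_nseq k i x : Eword (nseq k i) x = E i ^+ k *: x.
Proof. by elim: k => [|k IH] /=; rewrite ?scale1r // IH exprS scalerA. Qed.

Lemma Fword_nseq k i x : Fword (nseq k i) x = F i ^+ k *: x.
Proof. by elim: k => [|k IH] /=; rewrite ?scale1r // IH exprS scalerA. Qed.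

Lemma height_root_sum w : height (a := a) (root_sum w) = (size w)%:R.
Proof.
rewrite /root_sum raddf_sum /=; elim: w => [|i w IH]; first by rewrite big_nil.
by rewrite big_cons IH (height_simple aP) -natr1 addrC.
Qed.

(** On a weight vector, the triangular decomposition of U leaves only the
    products of F's and E's. *)
Definition PBW_vector x y : Prop := exists w w', y = Fword w (Eword w' x).

Lemma U_stable (P : M -> Prop) :
  (forall x y, P x -> P y -> P (x + y)) -> (forall c x, P x -> P (c *:: x)) ->
  (forall i x, P x -> [/\ P (E i *: x), P (F i *: x), P (Kg i *: x) & P (Kv i *: x)]) ->
  forall u x, P x -> P (u *: x).
Proof.
move=> PD PZ Pg; apply: (U_gen_ind UP).
- by move=> u u' Pu Pu' x Px; rewrite scalerDl; apply: PD; [apply: Pu|apply: Pu'].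
- by move=> c u Pu x Px; rewrite kscale_scaler; apply/PZ/Pu.
- by move=> x Px; rewrite scale1r.
- move=> i u Pu; split=> x Px; rewrite -scalerA; by case: (Pg i _ (Pu x Px)).
Qed.

(** Move E_i to the right of the F's: every commutator acts on a weight vector
    as a scalar. *)
Lemma PBW_span_stable nu x : wt nu x ->
  forall u y, span (PBW_vector x) y -> span (PBW_vector x) (u *: y).
Proof.
move=> wx; apply: U_stable => [y z|c y|i y sy]; [exact: spanD|exact: spanZ|].
suff gens w w' (z := Fword w (Eword w' x)) : [/\ span (PBW_vector x) (E i *: z),
    span (PBW_vector x) (F i *: z), span (PBW_vector x) (Kg i *: z) & span (PBW_vector x) (Kv i *: z)].
  by split; apply: span_map sy => z [w [w' ->]]; case: (gens w w').
have wz : wt (nu + root_sum w' - root_sum w) (Fword w (Eword w' x)).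
  exact/wt_Fword/wt_Eword.
have Pz : span (PBW_vector x) (Fword w (Eword w' x)) by apply: span_in; exists w, w'.
split; last 2 first.
- by rewrite (wz i : _ = _); apply: spanZ.
- by rewrite (wt_Kinv i wz); apply: spanZ.
- rewrite {}/z; elim: w {wz Pz} => [|j w IH] /=; first by apply: span_in; exists [::], (i :: w').
  rewrite (actU_EF i j (wt_Fword w (wt_Eword w' wx))); apply: spanD.
    by apply: span_map IH => z [w1 [w2 ->]]; apply: span_in; exists (j :: w1), w2.
  by apply/spanZ/span_in; exists w, w'.
by apply: span_in; exists (i :: w), w'.
Qed.

Definition weighted (Q : weight n -> Prop) : Prop :=
  forall x, span (fun y => exists2 nu, Q nu & wt nu y) x.

Lemma wspan_list (Q : weight n -> Prop) x :
  span (fun y => exists2 nu, Q nu & wt nu y) x ->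
  exists2 s : seq (weight n), (forall nu, nu \in s -> Q nu) &
    span (fun y => exists2 nu, nu \in s & wt nu y) x.
Proof.
elim=> [|c y z [nu Qnu wy] _ [s sQ sz]]; first by exists [::] => //; constructor.
exists (nu :: s) => [mu|]; first by rewrite inE => /predU1P[->|/sQ].
constructor; first by exists nu; rewrite ?mem_head.
apply: span_trans sz => t [mu mus wmu]; apply: span_in; exists mu => //.
by rewrite inE mus orbT.
Qed.
End Weights.

(** For each mu in [s], multiply by a factor K_i - v_i^<alpha_i^vee, mu>, where i
    is chosen such that nu and mu differ at i. *)
Lemma separator (nu : weight n) (s : seq (weight n)) : nu \notin s ->
  exists (u : U) (chi : weight n -> Qv),
  [/\ chi nu = 1, forall mu, mu \in s -> chi mu = 0
    & forall (M : lmodType U) mu (x : M), wt mu x -> u *: x = chi mu *:: x].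
Proof.
elim: s => [|mu s IH].
  by exists 1, (fun=> 1); split=> // M mu x _; rewrite scale1r kscale1.
rewrite inE negb_or => /andP[numu /IH[u [chi [chinu chis uchi]]]].
have [i imu] : exists i, pairing i nu != pairing i mu.
  apply/existsP; apply: contraNT numu; rewrite negb_exists => /forallP h.
  by apply/eqP/rowP => i; apply/eqP; rewrite -[_ == _]negbK h.
pose D := v_ i ^ pairing i nu - v_ i ^ pairing i mu.
have D0 : D != 0 by rewrite subr_eq0; apply: contra imu => /eqP/(qvi_inj aP)->.
exists (alg_const D^-1 * (Kg i - alg_const (v_ i ^ pairing i mu)) * u).
exists (fun la => D^-1 * (v_ i ^ pairing i la - v_ i ^ pairing i mu) * chi la).
split=> [|la|M la x wx].
- by rewrite chinu mulr1 mulVf.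
- by rewrite inE => /predU1P[->|/chis->]; rewrite ?subrr ?mulr0 ?mul0r.
rewrite -scalerA (uchi _ _ _ wx) scaler_kscale kscale_scaler scalerBl.
rewrite (wx i : _ = _) -/(kscale _ _) -kscaleBl !kscaleA; congr (_ *:: _).
by rewrite [RHS]mulrC mulrA.
Qed.

Section Weighted.
Context {M : lmodType U}.
Implicit Types (x y : M) (nu mu : weight n).

(** An element that separates nu from the weights which occur in [x] would kill
    [x] and act on it as the identity. *)
Lemma wspan_weight (Q : weight n -> Prop) nu x :
  span (fun y => exists2 nu, Q nu & wt nu y) x -> x != 0 -> wt nu x -> Q nu.
Proof.
move=> sx x0 wx; apply: contrapT => Qnu.
have [s sQ ss] := wspan_list sx.
have nus : nu \notin s by apply/negP => /sQ.
have [u [chi [chinu chis uchi]]] := separator nus.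
move: x0; rewrite -[x]kscale1 -chinu -(uchi _ _ _ wx) => /eqP[].
elim: ss => [|c y z [mu mus wy] _ IH]; first by rewrite scaler0.
by rewrite scalerDr scaler_kscale (uchi _ _ _ wy) chis // kscale0 kscaler0 add0r.
Qed.

(** The components of [x] are obtained by the action of elements of U, and hence
    they lie in all submodules that contain [x]. *)
Lemma wspan_components (s : seq (weight n)) x : uniq s ->
  span (fun y => exists2 nu, nu \in s & wt nu y) x ->
  exists u : weight n -> U, x = \sum_(nu <- s) u nu *: x /\
    forall nu, nu \in s -> wt nu (u nu *: x).
Proof.
move=> us sx.
have /choice[u uP] nu : exists u : U, exists2 chi : weight n -> Qv,
    forall mu, mu \in s -> chi mu = (mu == nu)%:R & forall mu y, wt mu y -> u *: y = chi mu *:: y.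
  have [|u [chi [chinu chis uchi]]] := @separator nu (rem nu s).
    by rewrite mem_rem_uniqF.
  exists u, chi => [mu mus|mu y]; last exact: uchi.
  have [->//|numu] := eqVneq mu nu.
  by apply: chis; rewrite (rem_filter _ us) mem_filter /= numu.
exists u; elim: sx => [|c y z [mu mus wy] _ [ez wz]].
  split=> [|nu _]; last by rewrite scaler0; apply: wt0.
  by rewrite big1 // => nu _; rewrite scaler0.
have uy nu : u nu *: y = (mu == nu)%:R *:: y.
  by have [chi chiE uE] := uP nu; rewrite (uE _ _ wy) chiE.
split=> [|nu nus].
  rewrite {1}ez; under [RHS]eq_bigr do rewrite scalerDr scaler_kscale uy.
  rewrite big_split /=; congr (_ + _); rewrite (bigD1_seq mu) //= eqxx kscale1.
  rewrite big1 ?addr0 // => nu numu.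
  by rewrite eq_sym (negbTE numu) kscale0 kscaler0.
rewrite scalerDr scaler_kscale uy; apply: wtD (wz nu nus); apply: wtZ.
case: eqVneq => [<-|_]; first by rewrite kscale1.
by rewrite kscale0; apply: wt0.
Qed.
End Weighted.
End UModules.

(** * Simple modules with weights in W pi *)
Section Belonging.
Context {n : nat} {a : 'M[int]_n} {d : 'I_n -> nat}.
Hypothesis aP : cartan_finite_type a d.
Context {U : pzAlgType Qv} {E F Kg Kv : 'I_n -> U}.
Hypothesis UP : Uq_generators a d E F Kg Kv.

Local Notation v_ i := (qvi d i).
Local Notation wt := (@wt n d U Kg _).
Local Notation weighted M := (@weighted n d U Kg M).
Local Notation Eword := (@Eword n U E _).
Local Notation Fword := (@Fword n U F _).
Local Notation PBW_vector := (@PBW_vector n U E F _).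
Local Notation ht := (@height n a).

Lemma bounded_height (s : seq (weight n)) : exists B : nat,
  forall nu, nu \in s -> `|ht nu| <= B%:R.
Proof.
elim: s => [|mu s [B sB]]; first by exists 0%N.
exists (Num.bound `|ht mu| + B)%N => nu; rewrite inE natrD => /predU1P[->|/sB h].
  by rewrite -[leLHS]addr0 lerD // ltW // archi_boundP.
by rewrite -[leLHS]add0r lerD.
Qed.

Section Bounded.
Context {M : lmodType U} (Q : weight n -> Prop) (B : nat).
Hypothesis QM : weighted M Q.
Hypothesis QB : forall nu, Q nu -> `|ht nu| <= B%:R.

(** Each letter changes the height of the weight by one, and heights range over
    an interval of length 2B. *)
Lemma Eword_kill w nu (x : M) : wt nu x -> (B.*2 < size w)%N -> Eword w x = 0.
Proof.
move=> wx sw; apply/eqP; apply/negPn/negP => Ex.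
have x0 : x != 0 by apply: contraNneq Ex => ->; rewrite Eword0.
have q1 := QB (wspan_weight aP (QM x) x0 wx).
have q2 := QB (wspan_weight aP (QM _) Ex (wt_Eword UP w wx)).
move: q2; rewrite raddfD /= (height_root_sum aP) => q2.
have : (size w)%:R <= (B.*2)%:R :> rat.
  by rewrite -addnn natrD; move: q1 q2; rewrite !ler_norml => /andP[? ?] /andP[? ?]; lra.
by rewrite ler_nat leqNgt sw.
Qed.

Lemma Fword_kill w nu (x : M) : wt nu x -> (B.*2 < size w)%N -> Fword w x = 0.
Proof.
move=> wx sw; apply/eqP; apply/negPn/negP => Fx.
have x0 : x != 0 by apply: contraNneq Fx => ->; rewrite Fword0.
have q1 := QB (wspan_weight aP (QM x) x0 wx).
have q2 := QB (wspan_weight aP (QM _) Fx (wt_Fword UP w wx)).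
move: q2; rewrite raddfB /= (height_root_sum aP) => q2.
have : (size w)%:R <= (B.*2)%:R :> rat.
  by rewrite -addnn natrD; move: q1 q2; rewrite !ler_norml => /andP[? ?] /andP[? ?]; lra.
by rewrite ler_nat leqNgt sw.
Qed.

Lemma E_nilpotent i (x : M) : E i ^+ B.*2.+1 *: x = 0.
Proof.
elim: (QM x) => [|c y z [nu _ wy] _ IH]; first by rewrite scaler0.
rewrite scalerDr IH addr0 scaler_kscale -Eword_nseq (Eword_kill wy) ?kscaler0 //.
by rewrite size_nseq.
Qed.

Lemma F_nilpotent i (x : M) : F i ^+ B.*2.+1 *: x = 0.
Proof.
elim: (QM x) => [|c y z [nu _ wy] _ IH]; first by rewrite scaler0.
rewrite scalerDr IH addr0 scaler_kscale -Fword_nseq (Fword_kill wy) ?kscaler0 //.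
by rewrite size_nseq.
Qed.

Fixpoint words (k : nat) : seq (seq 'I_n) :=
  if k is k'.+1 then [::] :: [seq i :: w | i <- enum 'I_n, w <- words k'] else [:: [::]].

Lemma mem_words k w : (size w <= k)%N -> w \in words k.
Proof.
elim: k w => [|k IH] [|i w] //= sw.
rewrite inE; apply/orP; right; apply/allpairsP; exists (i, w).
by rewrite mem_enum IH.
Qed.

Lemma PBW_finite_dim (X : seq M) :
  (forall x, x \in X -> exists nu, wt nu x) ->
  (forall y, span (fun y => exists2 x, x \in X & PBW_vector x y) y) -> finite_dim M.
Proof.
move=> wX sX; pose W := words B.*2.
pose s := [seq Fword p.1 (Eword p.2 x) | x <- X, p <- [seq (w, w') | w <- W, w' <- W]].
exists s => y; apply: span_seq; apply: span_trans (sX y) => {}y [x xX [w [w' ->]]].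
have [nu wx] := wX x xX.
have [sw'|sw'] := leqP (size w') B.*2; last first.
  by rewrite (Eword_kill wx sw') Fword0; constructor.
have [sw|sw] := leqP (size w) B.*2; last first.
  by rewrite (Fword_kill (wt_Eword UP w' wx) sw); constructor.
apply: span_in; apply/allpairsP; exists (x, (w, w')); split=> //=.
by apply/allpairsP; exists (w, w'); split=> //=; apply: mem_words.
Qed.
End Bounded.

(** The property that characterizes Lambda_lam among U-modules, in terms of the
    given generators. *)
Definition highest_weight_simple (lam : weight n) (L : lmodType U) : Prop :=
  [/\ simple_module L, finite_dim L &
    exists x : L, [/\ x != 0, forall i, E i *: x = 0 &
      forall i, Kg i *: x = (alg_const (v_ i ^ pairing i lam) : U) *: x]].

Lemma root_sum_nseq k i : root_sum (a := a) (nseq k i) = simple_root a i *+ k.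
Proof.
rewrite /root_sum; elim: k => [|k IH]; rewrite ?big_nil ?mulr0n //=.
by rewrite big_cons IH mulrS.
Qed.

Lemma root_sum_count w :
  root_sum (a := a) w = \sum_i simple_root a i *+ count_mem i w.
Proof.
rewrite /root_sum; elim: w => [|i w IH]; first by rewrite big_nil big1.
rewrite big_cons IH; under [RHS]eq_bigr do rewrite /= mulrnDr.
rewrite big_split /=; congr (_ + _).
rewrite (bigD1 i) //= eqxx big1 ?addr0 // => j ij.
by rewrite eq_sym (negbTE ij).
Qed.

Section Pi.
Context (pi : set (weight n)).
Hypothesis pi_finite : finite_set pi.
Hypothesis pi_saturated : saturated a pi.
Local Notation P := (weyl_orbits a pi).

Lemma weyl_orbits_seq : exists2 s : seq (weight n), uniq s & forall nu, nu \in s <-> P nu.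
Proof.
have /finite_seqP[s es] := weyl_orbits_finite aP pi_finite.
exists (undup s) => [|nu]; first exact: undup_uniq.
by rewrite mem_undup es.
Qed.

Lemma weyl_orbits_bounded : exists B : nat, forall nu, P nu -> `|ht nu| <= B%:R.
Proof.
have [s _ sP] := weyl_orbits_seq; have [B sB] := bounded_height s.
by exists B => nu /sP/sB.
Qed.

Lemma highest_weight_dominant (M : lmodType U) nu (x : M) Q B : weighted M Q ->
  (forall nu, Q nu -> `|ht nu| <= B%:R) -> x != 0 -> (forall i, E i *: x = 0) ->
  wt nu x -> dominant nu.
Proof.
move=> QM QB x0 Ex wx i.
have := highest_weight_ge0 (qvi_neq0 i) (@qvi_free n a d aP i) (Uq_sl2 aP UP i) x0 (Ex i) (wx i).
by apply; apply: (F_nilpotent QM QB).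
Qed.

(** A longest product of E's that does not kill a given weight vector produces a
    highest weight vector.  Its weight is dominant and in W pi, hence in pi. *)
Lemma weighted_simple (L : lmodType U) : weighted L P -> simple_module L ->
  exists2 lam, pi lam & highest_weight_simple lam L.
Proof.
move=> PL simL; have [B PB] := weyl_orbits_bounded.
have [[x x0] _] := simL; have [z [nu Pnu wz] z0] := span_neq0 (PL x) x0.
pose len k := `[< exists2 w, size w = k & Eword w z != 0 >].
have len0 : exists k, len k by exists 0%N; apply/asboolP; exists [::].
have lenB k : len k -> (k <= B.*2)%N.
  move/asboolP=> [w <- Ew]; rewrite leqNgt; apply: contra Ew => sw.
  by rewrite (Eword_kill PL PB wz sw).
case: (ex_maxnP len0 lenB) => k /asboolP[w sw Ew] kmax.
set y := Eword w z in Ew.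
have Ey i : E i *: y = 0.
  apply/eqP; apply/negPn/negP => Eiy.
  have : len k.+1 by apply/asboolP; exists (i :: w); rewrite //= sw.
  by move/kmax; rewrite ltnn.
have wy := wt_Eword UP w wz; rewrite -/y in wy.
set lam := nu + _ in wy.
exists lam.
  apply: (weyl_orbits_dominant aP pi_saturated) (wspan_weight aP (PL y) Ew wy) _.
  exact: (highest_weight_dominant PL PB Ew Ey wy).
split=> //; last by exists y.
apply: (PBW_finite_dim PL PB (X := [:: y])).
  by move=> _ /[!inE]/eqP->; exists lam.
move=> t; apply: (@span_trans _ _ _ (PBW_vector y)).
  by move=> t' pt; apply: span_in; exists y; rewrite ?inE.
move: t; apply: (simple_closed_full simL).
- by constructor.
- by move=> *; apply: spanD.
- by move=> u t; apply: (PBW_span_stable aP UP wy).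
by exists y => //; apply: span_in; exists [::], [::].
Qed.

Lemma finite_weights (M : lmodType U) (Q : weight n -> Prop) : finite_dim M ->
  weighted M Q ->
  exists2 T : seq (weight n), (forall nu, nu \in T -> Q nu) & weighted M (fun nu => nu \in T).
Proof.
move=> [s sM] QM.
have [T TQ sT] : exists2 T : seq (weight n), (forall nu, nu \in T -> Q nu) &
    forall y, y \in s -> span (fun y => exists2 nu, nu \in T & wt nu y) y.
  elim: (s) => [|y t [T TQ tT]]; first by exists [::].
  have [T' TQ' tT'] := wspan_list (QM y).
  exists (T' ++ T) => [nu|z]; first by rewrite mem_cat => /orP[/TQ'|/TQ].
  rewrite inE => /predU1P[->|zt].
    apply: span_trans tT' => z' [nu nuT wz']; apply: span_in.
    by exists nu; rewrite // mem_cat nuT.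
  apply: span_trans (tT z zt) => z' [nu nuT wz']; apply: span_in.
  by exists nu; rewrite // mem_cat nuT orbT.
exists T => // x; have [c ->] := sM x.
by apply: span_sum => i; apply: spanZ; apply/sT/mem_nth.
Qed.

(** Let nu be a weight of [L]; then nu <= lam because [L] is spanned by products
    of F's applied to the highest weight vector.  If nu is dominant then it is in
    pi by saturation.  Otherwise nu is negative on some simple coroot, its
    reflection is a weight of [L] of larger height, and the claim follows by
    induction on the difference of the heights of lam and nu. *)
Lemma Lambda_weighted lam (L : lmodType U) : pi lam -> highest_weight_simple lam L -> weighted L P.
Proof.
move=> pilam [simL fdL [x [x0 Ex Kx]]].
have wx : wt lam x by [].
pose Q1 nu := exists w, nu = lam - root_sum (a := a) w.
have Ew w : Eword w x = x \/ Eword w x = 0.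
  by elim: w => [|i w [] /= ->]; [left|right; apply: Ex|right; apply: scaler0].
have QL : weighted L Q1.
  move=> y; apply: (@span_trans _ _ _ (PBW_vector x)) => [_ [w [w' ->]]|].
    have [->|->] := Ew w'; last by rewrite Fword0; constructor.
    by apply: span_in; exists (lam - root_sum (a := a) w); [exists w|apply: (wt_Fword UP)].
  move: y; apply: (simple_closed_full simL).
  - by constructor.
  - by move=> *; apply: spanD.
  - by move=> u y; apply: (PBW_span_stable aP UP wx).
  by exists x => //; apply: span_in; exists [::], [::].
have [T TQ TL] := finite_weights fdL QL.
have [B TB] := bounded_height T.
suff weightP k nu (y : L) : y != 0 -> wt nu y -> ht lam - ht nu < k%:R -> P nu.
  move=> y; apply: span_trans (QL y) => z [nu _ wz].
  have [->|z0] := eqVneq z 0; first by constructor.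
  apply: span_in; exists nu => //.
  apply: (weightP (Num.bound `|ht lam - ht nu|) nu z) => //.
  apply: (le_lt_trans (ler_norm _)); exact: archi_boundP.
elim: k nu y => [|k IH] nu y y0 wy hk.
  have [w ew] := wspan_weight aP (QL y) y0 wy.
  by move: hk; rewrite ew raddfB /= (height_root_sum aP) opprB addrC subrK ltrn0.
have [w ew] := wspan_weight aP (QL y) y0 wy.
have [dnu|/existsNP[i /negP]] := pselect (dominant nu).
  apply: weyl_orbits_sub; case: pi_saturated => _ sat; apply: (sat nu lam pilam dnu).
  exists (fun i => count_mem i w); rewrite -root_sum_count ew.
  by rewrite opprB addrC subrK.
rewrite -ltNge => nui.
(* E_i raises from the bottom of the string, so the roles of E_i and F_i are exchanged *)
have fl := sl2_flip (qvi_neq0 i) (Uq_sl2 aP UP i).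
have wy' := weightvec_flip (qvi_neq0 i) (Uq_sl2 aP UP i) (wy i).
have nui' : 0 <= - pairing i nu by lia.
have [s] := string_reflect (qvi_neq0 i) (@qvi_free n a d aP i) fl y0 wy' nui' (F_nilpotent TL TB i y).
set z := _ *: _ => z0.
have wz : wt (reflection a i nu) z.
  rewrite /z -Fword_nseq -Eword_nseq.
  have := wt_Eword UP (nseq (`|- pairing i nu| + s) i) (wt_Fword UP (nseq s i) wy).
  rewrite !root_sum_nseq mulrnDr [_ + _ *+ s]addrC addrA subrK.
  congr (wt _ _); rewrite /reflection -mulrNz pmulrn; congr (_ + _ *~ _); lia.
rewrite -[nu](reflectionK aP i); apply: weyl_orbits_refl.
apply: (IH _ _ z0 wz).
rewrite /reflection raddfB raddfMz /= (height_simple aP).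
have : 1 <= (- pairing i nu)%:~R :> rat by rewrite ler1z; lia.
move: hk; rewrite -natr1 mulrNz; lra.
Qed.
End Pi.
End Belonging.

(** * Subquotients and extensions of weighted modules *)
Section Extensions.
Context {n : nat} {a : 'M[int]_n} {d : 'I_n -> nat}.
Hypothesis aP : cartan_finite_type a d.
Context {U : pzAlgType Qv} {E F Kg Kv : 'I_n -> U}.
Hypothesis UP : Uq_generators a d E F Kg Kv.

Local Notation v_ i := (qvi d i).
Local Notation wt := (@wt n d U Kg _).
Local Notation weighted M := (@weighted n d U Kg M).
Local Notation ht := (@height n a).

Section Factors.
Context {M : lmodType U} (N' N : submodClosed M).

Lemma wt_fclass nu (x : submod N) : wt nu (val x) -> wt nu (fclass N' x).
Proof.
move=> wx i; rewrite /weightvec /kscale -!fclassZ; congr (fclass N' _).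
by apply: val_inj; rewrite !submod_valZ; apply: wx.
Qed.

(** The components of a vector of [N] are again in [N], by
    [wspan_components]. *)
Lemma factor_weighted (Q : weight n -> Prop) : weighted M Q -> weighted (factor N' N) Q.
Proof.
move=> QM z; have [x ->] := fclassP z.
have [s sQ sx] := wspan_list (QM (val x)).
have sx' : span (fun y => exists2 nu, nu \in undup s & wt nu y) (val x).
  by apply: span_trans sx => y [nu nus wy]; apply: span_in; exists nu; rewrite ?mem_undup.
have [u [ex wux]] := wspan_components aP (undup_uniq s) sx'.
have -> : x = \sum_(nu <- undup s) u nu *: x.
  by apply: val_inj; rewrite {1}ex submod_val_sum; apply: eq_bigr => nu _; rewrite submod_valZ.
rewrite fclass_sum big_seq.
elim/big_rec: _ => [|nu y nus sy]; first by constructor.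
apply: spanD => //; apply: span_in; exists nu; first by apply: sQ; rewrite -mem_undup.
by apply: wt_fclass; rewrite submod_valZ; apply: wux.
Qed.
End Factors.

Section Series.
Context {M : lmodType U} (r : nat) (N : nat -> submodClosed M).
Hypothesis MN : composition_series r N.

Lemma series_annihilated (u : nat -> U) :
  (forall j, (j < r)%N -> forall z : factor (N j) (N j.+1), u j *: z = 0) ->
  forall x : M, (foldr (fun j y => u j *: y) x (iota 0 r)) = 0.
Proof.
move=> uN x; have [N0 Nr _ _] := MN.
suff H j y : (j <= r)%N -> y \in N j -> foldr (fun j y => u j *: y) y (iota 0 j) = 0.
  exact: H.
elim: j y => [|j IH] y jr yN; first by apply/eqP; rewrite -N0.
rewrite -addn1 iotaD foldr_cat /= add0n; apply: IH; first exact: ltnW.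
have [y' ey] := fclass_ex yN.
have := uN j jr (fclass (N j) y'); rewrite -fclassZ => /fclass_eq0.
by rewrite submod_valZ ey.
Qed.

Lemma series_member (x : M) : x != 0 ->
  exists2 j, (j < r)%N & x \in N j.+1 /\ x \notin N j.
Proof.
move=> x0; have [N0 Nr _ _] := MN.
have ex : exists j, x \in N j by exists r.
case: (ex_minnP ex) => [[|j]] xj minj; first by move: x0; rewrite -N0 xj.
exists j; first by rewrite -ltnS ltnS; apply: minj.
by split=> //; apply/negP => /minj; rewrite ltnn.
Qed.
End Series.

Definition K_product_act (i : 'I_n) (M : lmodType U) (l : seq int) (x : M) : M :=
  foldr (fun m y => Kg i *: y - (v_ i ^ m) *:: y) x l.

Definition K_product (i : 'I_n) (l : seq int) : U :=
  foldr (fun m u => (Kg i - alg_const (v_ i ^ m)) * u) 1 l.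

Lemma K_productE i (M : lmodType U) l (x : M) : K_product i l *: x = K_product_act i l x.
Proof.
by elim: l => [|m l IH] /=; rewrite ?scale1r // -scalerA IH scalerBl.
Qed.

Lemma K_product_cat i l l' : K_product i (l ++ l') = K_product i l * K_product i l'.
Proof. by elim: l => [|m l IH] /=; rewrite ?mul1r // IH mulrA. Qed.

Lemma K_product_wt i (M : lmodType U) (l : seq int) nu (x : M) : wt nu x ->
  K_product_act i l x = (\prod_(m <- l) (v_ i ^ pairing i nu - v_ i ^ m)) *:: x.
Proof.
move=> wx; elim: l => [|m l IH] /=; first by rewrite big_nil kscale1.
by rewrite big_cons IH scaler_kscale (wx i : _ = _) !kscaleA -kscaleBl; congr (_ *:: _); ring.
Qed.

Section Diagonalize.
Context {M : lmodType U}.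
Hypothesis E_nil : forall i (x : M), exists N, E i ^+ N *: x = 0.
Hypothesis F_nil : forall i (x : M), exists N, F i ^+ N *: x = 0.

Local Notation wv i := (weightvec (v_ i) (Kg i)).

(** Induction on the number of linear factors.  For the last factor K_i - v_i^m,
    the vector y = (K_i - v_i^m) x is a sum of eigenvectors; those with another
    eigenvalue are in the image of K_i - v_i^m on the span, and subtracting a
    preimage from [x] leaves a vector on which K_i - v_i^m acts with square 0, that
    is, an eigenvector. *)
Lemma eigenvector_span i (P : M -> Prop) (l : seq int) :
  (forall x y, P x -> P y -> P (x + y)) -> (forall c x, P x -> P (c *:: x)) ->
  (forall x, P x -> P (Kg i *: x)) ->
  forall x, P x -> K_product i l *: x = 0 ->
  span (fun y => P y /\ exists m, wv i m y) x.
Proof.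
move=> PD PZ PK; elim/last_ind: l => [|l m IH] x Px.
  by rewrite scale1r => ->; constructor.
rewrite -cats1 K_product_cat -scalerA /= mulr1 scalerBl -/(kscale _ _).
have PN y : P y -> P (- y) by move=> /(PZ (-1)); rewrite kscaleNl kscale1.
set y := _ - _ => ly.
have Py : P y by apply: PD; [apply: PK|apply/PN/PZ].
have {ly IH} sy := IH y Py ly.
have [z [y0 [sz Pz wy0 ey]]] : exists z y0, [/\ span (fun y => P y /\ exists m, wv i m y) z,
    P z \/ z = 0, wv i m y0 & y = (Kg i *: z - (v_ i ^ m) *:: z) + y0].
  elim: sy => [|c t t' [Pt [p wp]] _ [z [y0 [sz Pz wy0 ->]]]].
    exists 0, 0; split; [by constructor|by right| |by rewrite scaler0 kscaler0 subrr addr0].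
    by rewrite /weightvec scaler0 kscaler0.
  have [pm|pm] := eqVneq p m.
    exists z, (c *:: t + y0); split=> //; last by rewrite addrCA.
    by apply: weightvecD => //; apply: weightvecZ; rewrite -pm.
  pose b := c / (v_ i ^ p - v_ i ^ m).
  have D0 : v_ i ^ p - v_ i ^ m != 0.
    by rewrite subr_eq0; apply: contra pm => /eqP/(qvi_inj aP)->.
  exists (b *:: t + z), y0; split=> //.
  - by constructor=> //; split=> //; exists p.
  - by left; case: Pz => [Pz|->]; rewrite ?addr0; [apply: PD => //|]; apply: PZ.
  - rewrite addrA; congr (_ + y0); rewrite scalerDr kscaleDr opprD addrACA; congr (_ + _).
    rewrite scaler_kscale (wp : _ = _) !kscaleA -kscaleBl [_ * b]mulrC -mulrBr.
    by rewrite /b mulfVK.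
have wxz : wv i m (x - z).
  have [Ne eN] := E_nil i (x - z).
  apply: (k_semisimple (qvi_neq0 i) (@qvi_free n a d aP i) (Uq_sl2 aP UP i) two_neq0).
  - by exists Ne.
  - by move=> t; apply: F_nil.
  suff -> : Kg i *: (x - z) - v_ i ^ m *:: (x - z) = y0 by [].
  rewrite scalerBr kscaleBr opprD opprK addrACA -/y ey [- (Kg i *: z) + _]addrC -[_ - Kg i *: z]opprB.
  by rewrite [LHS]addrC addKr.
rewrite -(subrK z x); apply: spanD => //; apply: span_in; split; last by exists m.
by case: Pz => [Pz|->]; rewrite ?subr0 //; apply: PD => //; apply: PN.
Qed.

Lemma weight_vector_span (l : 'I_n -> seq int) :
  (forall i (x : M), K_product i (l i) *: x = 0) ->
  forall x : M, span (fun y => exists nu, wt nu y) x.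
Proof.
move=> lM x.
suff H (s : seq 'I_n) :
    span (fun y => exists nu : weight n, forall i, i \in s -> wv i (pairing i nu) y) x.
  apply: span_trans (H (enum 'I_n)) => y [nu wy]; apply: span_in; exists nu => i.
  by apply: wy; rewrite mem_enum.
elim: s => [|i s IH]; first by apply: span_in; exists 0.
apply: span_trans IH => y [nu wy].
have := @eigenvector_span i (fun y => forall j, j \in s -> wv j (pairing j nu) y) (l i).
move/(_ _ _ _ y wy (lM i y)) => H.
apply: (span_trans _ (H _ _ _)).
- move=> z [wz [m wm]]; apply: span_in.
  exists (\row_k if k == i then m else pairing k nu) => k; rewrite inE /pairing mxE.
  by have [->|ki] //= := eqVneq k i => ks; apply: wz.
- by move=> z t wz wt' j js; apply: weightvecD; [apply: wz|apply: wt'].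
- by move=> c z wz j js; apply/weightvecZ/wz.
- move=> z wz j js; rewrite /weightvec scalerA (U_rel_KK UP) -scalerA wz //.
  by rewrite scaler_kscale.
Qed.
End Diagonalize.

Section Pi.
Context (pi : set (weight n)).
Hypothesis pi_finite : finite_set pi.
Local Notation P := (weyl_orbits a pi).

(** Powers of E_i and F_i vanish on [M], and a polynomial with roots v_i^m
    annihilates K_i, since this holds on the factors; so [M] is spanned by weight
    vectors.  A non-zero weight vector stays non-zero in the factor where it first
    appears, so that its weight is in W pi. *)
Lemma extension_weighted (M : lmodType U) r N : @composition_series U M r N ->
  (forall j, (j < r)%N -> weighted (factor (N j) (N j.+1)) P) -> weighted M P.
Proof.
move=> MN PN x.
have [s us sP] := weyl_orbits_seq aP pi_finite.
have [B PB] := weyl_orbits_bounded aP pi_finite.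
have E_nil i (y : M) : exists N, E i ^+ N *: y = 0.
  exists (B.*2.+1 * r)%N.
  have := series_annihilated MN (u := fun=> E i ^+ B.*2.+1)
    (fun j jr => E_nilpotent aP UP (PN j jr) PB i) y.
  move=> <-; elim: (r) 0%N => [|k IH] p; first by rewrite muln0 scale1r.
  by rewrite mulnS exprD -scalerA (IH p.+1).
have F_nil i (y : M) : exists N, F i ^+ N *: y = 0.
  exists (B.*2.+1 * r)%N.
  have := series_annihilated MN (u := fun=> F i ^+ B.*2.+1)
    (fun j jr => F_nilpotent aP UP (PN j jr) PB i) y.
  move=> <-; elim: (r) 0%N => [|k IH] p; first by rewrite muln0 scale1r.
  by rewrite mulnS exprD -scalerA (IH p.+1).
(* on the factors, the product of K_i - v_i^<alpha_i^vee, nu> over W pi is zero *)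
pose l0 i := [seq pairing i nu | nu <- s].
have l0_kill i j (jr : (j < r)%N) (z : factor (N j) (N j.+1)) : K_product i (l0 i) *: z = 0.
  elim: (PN j jr z) => [|c y t [nu Pnu wy] _ IH]; first by rewrite scaler0.
  rewrite scalerDr IH addr0 scaler_kscale K_productE (K_product_wt _ _ wy).
  have nus : nu \in s by apply/sP.
  rewrite big_map (bigD1_seq nu) //= subrr mul0r kscale0 kscaler0 //.
have lM i (y : M) : K_product i (flatten (nseq r (l0 i))) *: y = 0.
  have <- := series_annihilated MN (u := fun=> K_product i (l0 i)) (l0_kill i) y.
  elim: (r) 0%N => [|k IH] p; first by rewrite scale1r.
  by rewrite /= K_product_cat -scalerA (IH p.+1).
apply: span_trans (weight_vector_span E_nil F_nil lM x) => y [nu wy].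
have [->|y0] := eqVneq y 0; first by constructor.
apply: span_in; exists nu => //.
have [j jr [yN yN']] := series_member MN y0.
have [y' ey] := fclass_ex yN.
apply: (wspan_weight aP (PN j jr (fclass (N j) y'))).
  by apply/eqP => /fclass_eq0; rewrite ey; apply/negP.
by apply: wt_fclass; rewrite ey.
Qed.
End Pi.
End Extensions.

(** * S(pi) as a module over U *)
(** The relations of S(pi) in a uniform shape: with 1_lam extended by zero to the
    weights outside of W pi, moving an idempotent past E_i or F_i takes one
    equation in all cases. *)
Record Sq_relations {n : nat} (a : 'M[int]_n) (d : 'I_n -> nat) (s : seq (weight n))
    (S : pzAlgType Qv) (E F : 'I_n -> S) (e : weight n -> S) : Prop := SqRelations {
  S_rel_idem : forall lam mu, e lam * e mu = if lam == mu then e lam else 0;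
  S_rel_sum : \sum_(lam <- s) e lam = 1;
  S_rel_out : forall lam, lam \notin s -> e lam = 0;
  S_rel_EF : forall i j, E i * F j - F j * E i = alg_const (i == j)%:R *
    \sum_(lam <- s) alg_const (qint (qvi d i) (pairing i lam)) * e lam;
  S_rel_E_idem : forall i lam, E i * e lam = e (lam + simple_root a i) * E i;
  S_rel_F_idem : forall i lam, F i * e lam = e (lam - simple_root a i) * F i
}.

Record Sq_generators {n : nat} (a : 'M[int]_n) (d : 'I_n -> nat) (s : seq (weight n))
    (S : pzAlgType Qv) (E F : 'I_n -> S) (e : weight n -> S) : Prop := SqGenerators {
  S_rels :> Sq_relations a d s E F e;
  S_gen_ind : forall P : S -> Prop,
    (forall x y, P x -> P y -> P (x + y)) ->
    (forall c x, P x -> P (alg_const c * x)) -> P 1 ->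
    (forall x, P x -> [/\ forall i, P (E i * x), forall i, P (F i * x) & forall lam, P (e lam * x)]) ->
    forall x, P x
}.

Section PullBack.
Context {U S : pzRingType} (phi : {rmorphism U -> S}).
Definition pullmod of {rmorphism U -> S} : Type := S.
Local Notation M := (pullmod phi).
HB.instance Definition _ := GRing.Zmodule.on M.
Definition pull_scale (u : U) (x : M) : M := phi u * (x : S).
Fact pull_scaleA u w x : pull_scale u (pull_scale w x) = pull_scale (u * w) x.
Proof. by rewrite /pull_scale rmorphM mulrA. Qed.
Fact pull_scale1 : left_id 1 pull_scale.
Proof. by move=> x; rewrite /pull_scale rmorph1 mul1r. Qed.
Fact pull_scaleDr : right_distributive pull_scale +%R.
Proof. by move=> u x y; rewrite /pull_scale mulrDr. Qed.
Fact pull_scaleDl x : {morph pull_scale^~ x : u w / u + w}.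
Proof. by move=> u w; rewrite /pull_scale rmorphD mulrDl. Qed.
HB.instance Definition _ := GRing.Zmodule_isLmodule.Build U M
  pull_scaleA pull_scale1 pull_scaleDr pull_scaleDl.

Lemma pull_scaleE u (x : M) : u *: x = phi u * (x : S) :> S.
Proof. by []. Qed.
End PullBack.

Section SRelations.
Context {n : nat} {a : 'M[int]_n} {d : 'I_n -> nat}.
Hypothesis aP : cartan_finite_type a d.
Context {s : seq (weight n)} {S : pzAlgType Qv} {E F : 'I_n -> S} {e : weight n -> S}.
Hypothesis us : uniq s.
Hypothesis SP : Sq_generators a d s E F e.
Local Notation v_ i := (qvi d i).

Definition toral (f : weight n -> Qv) : S := \sum_(lam <- s) alg_const (f lam) * e lam.
Definition S_K i := toral (fun lam => v_ i ^ pairing i lam).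
Definition S_Kinv i := toral (fun lam => v_ i ^ (- pairing i lam)).

Lemma S_eq_on_idem x y : (forall lam, x * e lam = y * e lam) -> x = y.
Proof.
move=> xy; rewrite -[x]mulr1 -[y]mulr1 -(S_rel_sum SP) !mulr_sumr.
by apply: eq_bigr => lam _; rewrite xy.
Qed.

Lemma toral_e f lam : toral f * e lam = alg_const (f lam) * e lam.
Proof.
rewrite /toral mulr_suml; have [ls|ls] := boolP (lam \in s); last first.
  by rewrite (S_rel_out SP ls) mulr0 big1 // => mu _; rewrite mulr0.
rewrite (bigD1_seq lam) //= -mulrA (S_rel_idem SP) eqxx big1 ?addr0 // => mu ml.
by rewrite -mulrA (S_rel_idem SP) (negbTE ml) mulr0.
Qed.

Lemma const_mulCA (c : Qv) (x y : S) : x * (alg_const c * y) = alg_const c * (x * y).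
Proof. by rewrite mulrA -alg_const_central mulrA. Qed.

Lemma const_mulA (b c : Qv) (x : S) : alg_const b * (alg_const c * x) = alg_const (b * c) * x.
Proof. by rewrite mulrA rmorphM. Qed.

Lemma toralC f g : toral f * toral g = toral g * toral f.
Proof.
apply: S_eq_on_idem => lam; rewrite -!mulrA !toral_e !const_mulCA !toral_e !const_mulA.
by rewrite mulrC.
Qed.

Lemma S_K_Kinv i : S_K i * S_Kinv i = 1.
Proof.
apply: S_eq_on_idem => lam; rewrite -mulrA toral_e const_mulCA toral_e const_mulA mul1r.
by rewrite -expfzDr ?qvi_neq0 // addNr rmorph1 mul1r.
Qed.

Lemma S_Kinv_K i : S_Kinv i * S_K i = 1.
Proof. by rewrite toralC S_K_Kinv. Qed.

Lemma S_EF_K i j : E i * F j - F j * E i =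
  alg_const ((i == j)%:R / (v_ i - (v_ i)^-1)) * (S_K i - S_Kinv i).
Proof.
rewrite (S_rel_EF SP) -/(toral _); apply: S_eq_on_idem => lam.
rewrite -!mulrA mulrBl !toral_e -mulrBl -rmorphB !const_mulA; congr (alg_const _ * _).
by rewrite /qint mulrA mulrAC.
Qed.

Lemma toral_E f j : toral f * E j = E j * toral (fun lam => f (lam + simple_root a j)).
Proof.
apply: S_eq_on_idem => lam; rewrite -!mulrA toral_e (S_rel_E_idem SP) mulrA toral_e -mulrA.
by rewrite const_mulCA (S_rel_E_idem SP).
Qed.

Lemma toral_F f j : toral f * F j = F j * toral (fun lam => f (lam - simple_root a j)).
Proof.
apply: S_eq_on_idem => lam; rewrite -!mulrA toral_e (S_rel_F_idem SP) mulrA toral_e -mulrA.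
by rewrite const_mulCA (S_rel_F_idem SP).
Qed.

Lemma toralZ c f : alg_const c * toral f = toral (fun lam => c * f lam).
Proof. by rewrite /toral mulr_sumr; apply: eq_bigr => lam _; rewrite const_mulA. Qed.

Lemma S_K_E i j : S_K i * E j = alg_const (v_ i ^ a i j) * (E j * S_K i).
Proof.
rewrite toral_E -const_mulCA toralZ; congr (_ * _); apply: eq_bigr => lam _.
by rewrite -expfzDr ?qvi_neq0 // /pairing !mxE addrC.
Qed.

Lemma S_K_F i j : S_K i * F j = alg_const (v_ i ^ (- a i j)) * (F j * S_K i).
Proof.
rewrite toral_F -const_mulCA toralZ; congr (_ * _); apply: eq_bigr => lam _.
by rewrite -expfzDr ?qvi_neq0 // /pairing !mxE addrC.
Qed.

Section SModule.
Context {U : pzAlgType Qv} {EU FU Kg Kv : 'I_n -> U}.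
Hypothesis UP : Uq_generators a d EU FU Kg Kv.
Context (phi : {rmorphism U -> S}).
Hypothesis phi_const : forall c, phi (alg_const c) = alg_const c.
Hypothesis phiE : forall i, phi (EU i) = E i.
Hypothesis phiF : forall i, phi (FU i) = F i.
Hypothesis phiK : forall i, phi (Kg i) = S_K i.
Local Notation M := (pullmod phi).
Local Notation wt := (@wt n d U Kg M).

Lemma kscale_pull c (x : M) : c *:: x = alg_const c * (x : S) :> S.
Proof. by rewrite /kscale pull_scaleE phi_const. Qed.

Lemma wt_e lam (x : S) : wt lam (e lam * x : S).
Proof.
move=> i; rewrite /weightvec kscale_pull pull_scaleE phiK.
by rewrite mulrA toral_e mulrA.
Qed.

Lemma S_weighted : @weighted n d U Kg M (fun lam => lam \in s).
Proof.
move=> x; rewrite -[x](mul1r (x : S)) -(S_rel_sum SP) mulr_suml big_seq.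
elim/big_rec: _ => [|lam y ls sy]; first by constructor.
by apply: spanD => //; apply: span_in; exists lam => //; apply: wt_e.
Qed.

(** Moving an idempotent through a word of E's and F's shifts its weight. *)
Lemma idem_PBW lam w w' : exists mu, forall nu,
  e nu * (@Fword n U FU M w (@Eword n U EU M w' (e lam : S)) : S) =
  if nu == mu then (@Fword n U FU M w (@Eword n U EU M w' (e lam : S)) : S) else 0.
Proof.
have shift (t : S) mu al (X : S) : (forall nu, e nu * t = if nu == mu then t else 0) ->
   (forall nu, X * e nu = e (nu + al) * X) ->
   forall nu, e nu * (X * t) = if nu == mu + al then X * t else 0.
  move=> et eX nu; rewrite mulrA -[nu](subrK al) -eX -mulrA et (subrK al).
  by rewrite subr_eq; case: eqP => // _; rewrite mulr0.
elim: w => [|i w [mu IH]] /=; last first.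
  exists (mu - simple_root a i); rewrite !pull_scaleE phiF; apply: shift => // nu.
  by rewrite (S_rel_F_idem SP).
elim: w' => [|i w' [mu IH]] /=; last first.
  exists (mu + simple_root a i); rewrite !pull_scaleE phiE; apply: shift => // nu.
  by rewrite (S_rel_E_idem SP).
by exists lam => nu; rewrite (S_rel_idem SP); case: eqP => // ->.
Qed.

(** The span of the words F..F E..E 1_lam contains 1, and it is stable under
    multiplication by the E_i and F_i (which act through U) and by the idempotents. *)
Lemma S_finite_dim : finite_dim (M : lmodType U).
Proof.
have [B sB] := @bounded_height n a s.
apply: (PBW_finite_dim aP UP S_weighted sB (X := [seq (e lam : M) | lam <- s])).
  by move=> _ /mapP[lam _ ->]; exists lam; rewrite -[e lam](mulr1 (e lam)); apply: wt_e.
set W := span _.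
have wte lam : wt lam (e lam : S) by rewrite -[e lam]mulr1; apply: wt_e.
apply: (S_gen_ind SP).
- by move=> x y; apply: spanD.
- by move=> c x Wx; rewrite -(kscale_pull c (x : M)); apply: spanZ.
- rewrite -(S_rel_sum SP) big_seq; elim/big_rec: _ => [|lam y ls Wy]; first exact: span_zero.
  apply: spanD => //; apply: span_in; exists (e lam); first by apply/mapP; exists lam.
  by exists [::], [::].
move=> x Wx.
have stable (u : U) : W (u *: (x : M)).
  apply: span_map Wx => y [x' /mapP[lam ls ->] py].
  have := PBW_span_stable aP UP (wte lam) u (span_in py).
  by apply: span_trans => z pz; apply: span_in; exists (e lam : M) => //; apply/mapP; exists lam.
split=> [i|i|nu].
- by rewrite -phiE; apply: (stable (EU i)).
- by rewrite -phiF; apply: (stable (FU i)).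
elim: Wx => [|c y z [x' x's [w [w' ey]]] _ IH]; first by rewrite mulr0; exact: span_zero.
rewrite mulrDr kscale_pull const_mulCA -(kscale_pull c (e nu * (y : S) : S)).
apply: spanD => //; apply: spanZ.
have /mapP[lam ls ex'] := x's.
have [mu ew] := idem_PBW lam w w'.
rewrite ey ex' ew; case: eqP => _; last exact: span_zero.
by apply: span_in; exists (e lam : M); [rewrite -ex'|exists w, w'].
Qed.
End SModule.
End SRelations.

(** * The defining relations of U *)
Section ConstMorphism.
Context {K : fieldType} {G : choiceType} {B : pzAlgType K}.
Context (Phi : {rmorphism free_alg K G -> B}).
Hypothesis Phi_const : forall c, Phi (alg_const c) = alg_const c.
Implicit Types (x y z t : free_alg K G).

Lemma hom_scale c x : Phi (c *: x) = alg_const c * Phi x.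
Proof. by rewrite free_scaleE rmorphM Phi_const. Qed.

Lemma hom_lincomb (I : Type) (r : seq I) (c : I -> K) (x : I -> free_alg K G) :
  Phi (\sum_(i <- r) c i *: x i) = \sum_(i <- r) alg_const (c i) * Phi (x i).
Proof. by rewrite rmorph_sum; apply: eq_bigr => i _; rewrite hom_scale. Qed.

Lemma hom_mul x y z t : Phi x * Phi y = Phi z * Phi t -> Phi (x * y) = Phi (z * t).
Proof. by move=> h; exact: etrans (rmorphM Phi x y) (etrans h (esym (rmorphM Phi z t))). Qed.

Lemma hom_mul0 x y : Phi x * Phi y = 0 -> Phi (x * y) = Phi 0.
Proof. by move=> h; exact: etrans (rmorphM Phi x y) (etrans h (esym (rmorph0 Phi))). Qed.

Lemma hom_mul1 x y : Phi x * Phi y = 1 -> Phi (x * y) = Phi 1.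
Proof. by move=> h; exact: etrans (rmorphM Phi x y) (etrans h (esym (rmorph1 Phi))). Qed.

Lemma hom_mulZ1 x y c z : Phi x * Phi y = alg_const c * Phi z ->
  Phi (x * y) = Phi (c *: z).
Proof. by move=> h; exact: etrans (rmorphM Phi x y) (etrans h (esym (hom_scale c z))). Qed.

Lemma hom_mulZ x y c z t : Phi x * Phi y = alg_const c * (Phi z * Phi t) ->
  Phi (x * y) = Phi (c *: (z * t)).
Proof.
move=> h; apply: hom_mulZ1; apply: etrans h _; congr (_ * _).
exact: esym (rmorphM Phi z t).
Qed.

Lemma hom_commutator x y c z : Phi x * Phi y - Phi y * Phi x = alg_const c * Phi z ->
  Phi (x * y - y * x) = Phi (c *: z).
Proof.
move=> h; apply: etrans (rmorphB Phi _ _) _; apply: etrans (esym (hom_scale c z)).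
by apply: etrans h; congr (_ - _); exact: rmorphM.
Qed.
End ConstMorphism.

Section Serre.
Context {n : nat} (a : 'M[int]_n) (d : 'I_n -> nat).

Lemma free_lift_serre (G H : choiceType) (f : G -> free_alg Qv H)
    (x : 'I_n -> free_alg Qv G) i j :
  free_lift f (serre a d x i j) = serre a d (fun k => free_lift f (x k)) i j.
Proof.
rewrite /serre rmorph_sum; apply: eq_bigr => t _.
rewrite (hom_scale (free_lift_const f)) -free_scaleE; congr (_ *: _).
rewrite (rmorphM _ (x i ^+ _ * x j) (x i ^+ t)) (rmorphM _ (x i ^+ _) (x j)).
by rewrite (rmorphXn _ _ (x i)) (rmorphXn _ t (x i)).
Qed.
End Serre.

Section UConcrete.
Context {n : nat} (a : 'M[int]_n) (d : 'I_n -> nat).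

Lemma U_alg_generators : Uq_generators a d
  (fun i => U_gen a d (U_E i)) (fun i => U_gen a d (U_F i))
  (fun i => U_gen a d (U_K i)) (fun i => U_gen a d (U_Kinv i)).
Proof.
split; first split.
- by move=> i j; exact: (presented_rel_mul (U_K_comm a d i j)).
- by move=> i; exact: (presented_rel_inv (U_K_Kinv a d i)).
- by move=> i; exact: (presented_rel_inv (U_Kinv_K a d i)).
- move=> i j; apply: etrans (presented_rel_commutator (U_EF a d i j)) _.
  exact: (congr1 (fun z => _ * z) (presented_projB _ _ _)).
- by move=> i j; exact: (presented_rel_mulZ (U_K_E a d i j)).
- by move=> i j; exact: (presented_rel_mulZ (U_K_F a d i j)).
move=> P PD PZ P1 Pg; apply: (presented_ind (Rel := @U_relation n a d)) => // g x Px.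
by case: g => i; have [PE PF PK PKv] := Pg i x Px; [exact: PE|exact: PF|exact: PK|exact: PKv].
Qed.

Lemma U_relation_sound (B : pzAlgType Qv) (E F Kg Kv : 'I_n -> B)
    (Phi : {rmorphism free_alg Qv (@U_generator n) -> B}) :
  (forall c, Phi (alg_const c) = alg_const c) ->
  (forall i, Phi (free_gen Qv (U_E i)) = E i) ->
  (forall i, Phi (free_gen Qv (U_F i)) = F i) ->
  (forall i, Phi (free_gen Qv (U_K i)) = Kg i) ->
  (forall i, Phi (free_gen Qv (U_Kinv i)) = Kv i) ->
  Uq_relations a d E F Kg Kv ->
  (forall i j, i != j -> Phi (serre a d (fun k => free_gen Qv (U_E k)) i j) = 0) ->
  (forall i j, i != j -> Phi (serre a d (fun k => free_gen Qv (U_F k)) i j) = 0) ->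
  forall x y, U_relation a d x y -> Phi x = Phi y.
Proof.
move=> Phi_const PhiE PhiF PhiK PhiKv R serreE serreF x y [] => [i j|i|i|i j|i j|i j|i j ij|i j ij].
- apply: hom_mul; rewrite !PhiK; exact: U_rel_KK R i j.
- apply: hom_mul1; rewrite PhiK PhiKv; exact: U_rel_KKv R i.
- apply: hom_mul1; rewrite PhiK PhiKv; exact: U_rel_KvK R i.
- apply: hom_commutator => //; rewrite rmorphB PhiE PhiF PhiK PhiKv; exact: U_rel_EF R i j.
- apply: hom_mulZ => //; rewrite PhiE PhiK; exact: U_rel_KE R i j.
- apply: hom_mulZ => //; rewrite PhiF PhiK; exact: U_rel_KF R i j.
- by rewrite serreE // rmorph0.
- by rewrite serreF // rmorph0.
Qed.
End UConcrete.

(** * The defining relations of S(pi) *)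
Section SConcrete.
Context {n : nat} (a : 'M[int]_n) (d : 'I_n -> nat) (pi : set (weight n)).
Context (s : seq (weight n)).
Hypothesis us : uniq s.
Hypothesis sP : forall nu, nu \in s <-> weyl_orbits a pi nu.
Local Notation P := (weyl_orbits a pi).
Local Notation fS := (free_alg Qv (S_generator a pi)).
Local Notation S := (S_alg a d pi).

Definition extend_by_zero (A : zmodType) (f : set_type P -> A) (nu : weight n) : A :=
  if insub nu is Some lam then f lam else 0.

Lemma extend_by_zero_val (A : zmodType) (f : set_type P -> A) lam : extend_by_zero f (val lam) = f lam.
Proof. by rewrite /extend_by_zero valK. Qed.

Lemma extend_by_zero_out (A : zmodType) (f : set_type P -> A) nu : ~ P nu -> extend_by_zero f nu = 0.
Proof.
by move=> Pn; rewrite /extend_by_zero; case: insubP => // lam; rewrite inE => /Pn.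
Qed.

Lemma weight_cases nu : (exists lam : set_type P, val lam = nu) \/ ~ P nu.
Proof.
have [p|np] := pselect (P nu); [left|by right].
have h : nu \in P by rewrite inE.
by exists (Sub nu h).
Qed.

Lemma sum_orbits (A : zmodType) (f : set_type P -> A) :
  \sum_(lam \in [set: set_type P]) f lam = \sum_(nu <- s) extend_by_zero f nu.
Proof.
rewrite (fsbigE (pmap insub s)) //; first last.
- move=> lam _; rewrite mem_pmap_sub => /negP[]; apply/sP.
  by have := valP lam; rewrite inE.
- exact: pmap_sub_uniq.
transitivity (\sum_(lam <- (pmap insub s : seq (set_type P))) extend_by_zero f (val lam)).
  by apply: eq_big => [lam|lam _]; rewrite ?in_setT ?extend_by_zero_val.
rewrite -(big_map val xpredT (extend_by_zero f)) /= pmap_filter; last exact: insubK.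
rewrite big_filter big_seq_cond [RHS]big_seq; apply: eq_bigl => nu.
case: (boolP (nu \in s)) => //= /sP p.
by case: insubP => // /negP[]; rewrite inE.
Qed.

Local Notation one lam := (free_gen Qv (S_one lam : S_generator a pi)).
Definition free_idem : weight n -> fS := extend_by_zero (fun lam => one lam).

Section Sound.
Context (B : pzAlgType Qv) (E F : 'I_n -> B) (e : weight n -> B).
Context (Phi : {rmorphism fS -> B}).
Hypothesis Phi_const : forall c, Phi (alg_const c) = alg_const c.
Hypothesis PhiE : forall i, Phi (free_gen Qv (S_E a pi i)) = E i.
Hypothesis PhiF : forall i, Phi (free_gen Qv (S_F a pi i)) = F i.
Hypothesis Phi_one : forall lam : set_type P, Phi (one lam) = e (val lam).

Lemma Phi_idem nu : (forall mu, ~ P mu -> e mu = 0) -> Phi (free_idem nu) = e nu.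
Proof.
move=> eout; have [[lam <-]|np] := weight_cases nu.
  by rewrite /free_idem extend_by_zero_val Phi_one.
by rewrite /free_idem extend_by_zero_out // rmorph0 eout.
Qed.

Lemma Phi_toral (c : weight n -> Qv) : (forall mu, ~ P mu -> e mu = 0) ->
  Phi (\sum_(lam \in [set: set_type P]) c (val lam) *: one lam) =
  \sum_(nu <- s) alg_const (c nu) * e nu.
Proof.
move=> eout; rewrite sum_orbits rmorph_sum; apply: eq_bigr => nu _.
have [[lam <-]|np] := weight_cases nu.
  by rewrite extend_by_zero_val (hom_scale Phi_const) Phi_one.
by rewrite extend_by_zero_out // rmorph0 eout // mulr0.
Qed.

Lemma Phi_sum : (forall mu, ~ P mu -> e mu = 0) ->
  Phi (\sum_(lam \in [set: set_type P]) one lam) = \sum_(nu <- s) e nu.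
Proof.
move=> eout; rewrite sum_orbits rmorph_sum; apply: eq_bigr => nu _.
exact: Phi_idem.
Qed.

Lemma S_relation_sound : Sq_relations a d s E F e ->
  (forall i j, i != j -> Phi (serre a d (fun k => free_gen Qv (S_E a pi k)) i j) = 0) ->
  (forall i j, i != j -> Phi (serre a d (fun k => free_gen Qv (S_F a pi k)) i j) = 0) ->
  forall x y, S_relation d x y -> Phi x = Phi y.
Proof.
move=> R serreE serreF.
have eout mu : ~ P mu -> e mu = 0.
  by move=> np; apply: (S_rel_out R); apply/negP => /sP.
move=> x y []; clear x y.
- move=> lam mu; apply: (hom_mulZ1 Phi_const); rewrite !Phi_one (S_rel_idem R) val_eqE.
  by case: eqP => _; rewrite ?rmorph1 ?mul1r // rmorph0 mul0r.
- by rewrite Phi_sum // (S_rel_sum R) rmorph1.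
- move=> i j; apply: (hom_commutator Phi_const); rewrite PhiE PhiF (S_rel_EF R); congr (_ * _).
  by rewrite (Phi_toral (fun nu => qint (qvi d i) (pairing i nu))).
- by move=> i lam mu emu; apply: hom_mul; rewrite PhiE !Phi_one emu (S_rel_E_idem R).
- by move=> i lam np; apply: hom_mul0; rewrite PhiE Phi_one (S_rel_E_idem R) eout // mul0r.
- by move=> i lam mu emu; apply: hom_mul; rewrite PhiF !Phi_one emu (S_rel_F_idem R).
- by move=> i lam np; apply: hom_mul0; rewrite PhiF Phi_one (S_rel_F_idem R) eout // mul0r.
- by move=> i lam mu emu; apply: hom_mul; rewrite PhiE !Phi_one emu (S_rel_E_idem R) subrK.
- move=> i lam np; apply: hom_mul0; rewrite PhiE Phi_one -[val lam](subrK (simple_root a i)).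
  by rewrite -(S_rel_E_idem R) eout // mulr0.
- by move=> i lam mu emu; apply: hom_mul; rewrite PhiF !Phi_one emu (S_rel_F_idem R) addrK.
- move=> i lam np; apply: hom_mul0; rewrite PhiF Phi_one -[val lam](addrK (simple_root a i)).
  by rewrite -(S_rel_F_idem R) eout // mulr0.
- by move=> i j ij; rewrite serreE // rmorph0.
- by move=> i j ij; rewrite serreF // rmorph0.
Qed.
End Sound.

Local Notation projS := (presented_proj (@S_relation n a d pi)).

Definition S_idem : weight n -> S := fun nu => projS (free_idem nu).
Definition S_E_elt i : S := projS (free_gen Qv (S_E a pi i)).
Definition S_F_elt i : S := projS (free_gen Qv (S_F a pi i)).

Lemma projS_eq x y : S_relation d x y -> projS x = projS y.
Proof. exact: presented_proj_eq. Qed.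

Lemma projS_const c : projS (alg_const c) = alg_const c.
Proof. by []. Qed.

Lemma projS_one (lam : set_type P) : projS (one lam) = S_idem (val lam).
Proof. by rewrite /S_idem /free_idem extend_by_zero_val. Qed.

Lemma S_alg_relations : Sq_relations a d s S_E_elt S_F_elt S_idem.
Proof.
have idem_in lam : S_idem (val lam) = projS (one lam).
  by rewrite /S_idem /free_idem extend_by_zero_val.
have idem_out nu : ~ P nu -> S_idem nu = 0.
  by move=> np; rewrite /S_idem /free_idem extend_by_zero_out // rmorph0.
have projM x y : projS (x * y) = projS x * projS y by exact: rmorphM.
have rel_comm x y c z : S_relation d (x * y - y * x) (c *: z) ->
    projS x * projS y - projS y * projS x = alg_const c * projS z.
  exact: presented_rel_commutator.
have rel_mul x y z t : S_relation d (x * y) (z * t) -> projS x * projS y = projS z * projS t.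
  exact: presented_rel_mul.
have rel_mul0 x y : S_relation d (x * y) 0 -> projS x * projS y = 0.
  by move/projS_eq => h; apply: etrans (esym (projM x y)) _; rewrite h rmorph0.
split.
- move=> lam mu; have [[lam' <-]|np] := weight_cases lam.
    2: by rewrite idem_out // mul0r; case: ifP.
  have [[mu' <-]|np] := weight_cases mu; last first.
    rewrite (idem_out mu) // mulr0; case: eqP => // e; case: np; rewrite -e.
    by have := valP lam'; rewrite inE.
  rewrite !idem_in -projM (projS_eq (S_one_mul d lam' mu')) presented_projZ val_eqE.
  by case: eqP => _; rewrite ?rmorph1 ?mul1r // rmorph0 mul0r.
- have := Phi_sum projS_one idem_out.
  by move=> <-; rewrite (projS_eq (S_one_sum a d pi)) rmorph1.
- by move=> lam ls; apply: idem_out => p; move/negP: ls; apply; apply/sP.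
- move=> i j; apply: etrans (rel_comm _ _ _ _ (Defs.S_EF a d pi i j)) _.
  congr (_ * _).
  exact: (Phi_toral projS_const projS_one (fun nu => qint (qvi d i) (pairing i nu)) idem_out).
- move=> i lam; have [[lam' <-]|np] := weight_cases lam.
    have [[mu emu]|np] := weight_cases (val lam' + simple_root a i).
      by rewrite -emu !idem_in; apply/rel_mul/S_E_one.
    by rewrite idem_in (idem_out _ np) mul0r; apply/rel_mul0/S_E_one0.
  rewrite (idem_out _ np) mulr0; have [[mu emu]|np'] := weight_cases (lam + simple_root a i).
    by rewrite -emu idem_in; apply/esym/rel_mul0/S_one_E0; rewrite emu addrK.
  by rewrite idem_out // mul0r.
- move=> i lam; have [[lam' <-]|np] := weight_cases lam.
    have [[mu emu]|np] := weight_cases (val lam' - simple_root a i).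
      by rewrite -emu !idem_in; apply/rel_mul/S_F_one.
    by rewrite idem_in (idem_out _ np) mul0r; apply/rel_mul0/S_F_one0.
  rewrite (idem_out _ np) mulr0; have [[mu emu]|np'] := weight_cases (lam - simple_root a i).
    by rewrite -emu idem_in; apply/esym/rel_mul0/S_one_F0; rewrite emu subrK.
  by rewrite idem_out // mul0r.
Qed.

Lemma S_alg_generators : Sq_generators a d s S_E_elt S_F_elt S_idem.
Proof.
split; first exact: S_alg_relations.
move=> Q QD QZ Q1 Qg; apply: (presented_ind (Rel := @S_relation n a d pi)) => // g x Qx.
have [QE QF Qe] := Qg x Qx.
case: g => [i|i|lam]; [exact: QE|exact: QF|].
have := Qe (val lam); rewrite -projS_one; exact.
Qed.
End SConcrete.

(** * The idempotents of S(pi) in quotients of U *)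
Section QuotientRelations.
Context {n : nat} {a : 'M[int]_n} {d : 'I_n -> nat}.
Hypothesis aP : cartan_finite_type a d.
Context {U : pzAlgType Qv} {E F Kg Kv : 'I_n -> U}.
Hypothesis UP : Uq_generators a d E F Kg Kv.
Context (s : seq (weight n)).
Hypothesis us : uniq s.
Local Notation v_ i := (qvi d i).
Local Notation wtM M := (@wt n d U Kg M).
Local Notation s_weighted M := (@weighted n d U Kg M (fun nu => nu \in s)).

(** The element [u nu] acts on all weighted modules as 1_nu is to act. *)
Definition weight_projector (u : weight n -> U) : Prop :=
  (forall nu, nu \notin s -> u nu = 0) /\
  forall (M : lmodType U), s_weighted M -> forall nu mu (x : M),
    wtM M mu x -> u nu *: x = if mu == nu then x else 0.

Lemma weight_projector_exists : exists u, weight_projector u.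
Proof.
have /choice[u uP] nu : exists u : U, (nu \notin s -> u = 0) /\
  forall (M : lmodType U), s_weighted M -> forall mu (x : M),
    wtM M mu x -> u *: x = if mu == nu then x else 0.
  have [ns|ns] := boolP (nu \in s); last first.
    exists 0; split=> // M sM mu x wx; rewrite scale0r; case: eqP => // e.
    apply/esym/eqP; apply: contraNT ns => x0.
    by rewrite -e; apply: (wspan_weight aP (sM x) x0 wx).
  have [|u [chi [chinu chis uchi]]] := @separator n a d aP U Kg nu (rem nu s).
    by rewrite mem_rem_uniqF.
  exists u; split=> // M sM mu x wx; rewrite (uchi _ _ _ wx).
  have [->|numu] := eqVneq mu nu; first by rewrite chinu kscale1.
  have [->|x0] := eqVneq x 0; first by rewrite kscaler0.
  rewrite chis ?kscale0 // (rem_filter _ us) mem_filter /= numu.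
  exact: (wspan_weight aP (sM x) x0 wx).
by exists u; split=> [nu|M sM nu mu x]; case: (uP nu) => // _; apply.
Qed.

Context (u : weight n -> U) (uP : weight_projector u).
Context {B : pzAlgType Qv} (p : {rmorphism U -> B}).
Hypothesis p_const : forall c, p (alg_const c) = alg_const c.
Hypothesis p_eq : forall t t', (forall M : lmodType U, s_weighted M ->
  forall mu (x : M), wtM M mu x -> t *: x = t' *: x) -> p t = p t'.

Lemma sum_projector (M : lmodType U) (f : weight n -> Qv) mu (x : M) :
  s_weighted M -> wtM M mu x ->
  (\sum_(nu <- s) alg_const (f nu) * u nu) *: x = f mu *:: x.
Proof.
case: uP => u0 ux sM wx; have [->|x0] := eqVneq x 0; first by rewrite scaler0 kscaler0.
have ms := wspan_weight aP (sM x) x0 wx.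
rewrite scaler_suml (bigD1_seq mu) //= kscale_scaler (ux M sM _ _ _ wx) eqxx.
rewrite big1 ?addr0 // => nu nm.
by rewrite kscale_scaler (ux M sM _ _ _ wx) eq_sym (negbTE nm) kscaler0.
Qed.

(** Each side of a relation sends a weight vector to a multiple of the same
    vector, and the two multiples agree on the weights that occur. *)
Lemma quotient_Sq_relations :
  Sq_relations a d s (fun i => p (E i)) (fun i => p (F i)) (fun nu => p (u nu)).
Proof.
case: (uP) => u0 ux; split.
- move=> lam mu; rewrite -rmorphM.
  have -> : (if lam == mu then p (u lam) else 0) = p (if lam == mu then u lam else 0).
    by case: ifP => // _; rewrite rmorph0.
  apply: p_eq => M sM nu x wx; rewrite -scalerA !(ux M sM _ _ _ wx).
  have [e|numu] := eqVneq nu mu; last first.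
    rewrite scaler0; case: eqP => [e|_]; last by rewrite scale0r.
    by rewrite (ux M sM _ _ _ wx) e (negbTE numu).
  rewrite (ux M sM _ _ _ wx) e eq_sym; case: eqP => [->|_]; last by rewrite scale0r.
  by rewrite (ux M sM _ _ _ wx) e eqxx.
- rewrite -(rmorph1 p) -rmorph_sum; apply: p_eq => M sM mu x wx.
  rewrite scale1r -[RHS]kscale1 -(sum_projector (fun=> 1) sM wx); congr (_ *: _).
  by apply: eq_bigr => nu _; rewrite rmorph1 mul1r.
- by move=> lam /u0->; rewrite rmorph0.
- move=> i j; have -> : \sum_(lam <- s) alg_const (qint (v_ i) (pairing i lam)) * p (u lam) =
      p (\sum_(lam <- s) alg_const (qint (v_ i) (pairing i lam)) * u lam).
    by rewrite rmorph_sum; apply: eq_bigr => nu _; rewrite (rmorphM p) p_const.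
  rewrite -p_const -!rmorphM -rmorphB; apply: p_eq => M sM mu x wx.
  rewrite kscale_scaler (sum_projector (fun nu => qint (v_ i) (pairing i nu)) sM wx) scalerBl -!scalerA.
  by rewrite (actU_EF aP UP i j wx) addrAC subrr add0r kscaleA.
- move=> i lam; rewrite -!rmorphM; apply: p_eq => M sM mu x wx.
  rewrite -!scalerA (ux M sM _ _ _ wx) (ux M sM _ _ _ (wtE UP i wx)) (inj_eq (addIr _)).
  by case: ifP => // _; rewrite scaler0.
- move=> i lam; rewrite -!rmorphM; apply: p_eq => M sM mu x wx.
  rewrite -!scalerA (ux M sM _ _ _ wx) (ux M sM _ _ _ (wtF UP i wx)) (inj_eq (addIr _)).
  by case: ifP => // _; rewrite scaler0.
Qed.

Lemma quotient_K i :
  p (Kg i) = \sum_(nu <- s) alg_const (v_ i ^ pairing i nu) * p (u nu).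
Proof.
have -> : \sum_(nu <- s) alg_const (v_ i ^ pairing i nu) * p (u nu) =
      p (\sum_(nu <- s) alg_const (v_ i ^ pairing i nu) * u nu).
  by rewrite rmorph_sum; apply: eq_bigr => nu _; rewrite (rmorphM p) p_const.
apply: p_eq => M sM mu x wx.
by rewrite (sum_projector (fun nu => v_ i ^ pairing i nu) sM wx); apply: wx.
Qed.

Lemma quotient_Kinv i :
  p (Kv i) = \sum_(nu <- s) alg_const (v_ i ^ (- pairing i nu)) * p (u nu).
Proof.
have -> : \sum_(nu <- s) alg_const (v_ i ^ (- pairing i nu)) * p (u nu) =
      p (\sum_(nu <- s) alg_const (v_ i ^ (- pairing i nu)) * u nu).
  by rewrite rmorph_sum; apply: eq_bigr => nu _; rewrite (rmorphM p) p_const.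
apply: p_eq => M sM mu x wx.
rewrite (sum_projector (fun nu => v_ i ^ (- pairing i nu)) sM wx).
exact: (wt_Kinv aP UP i wx).
Qed.
End QuotientRelations.

(** * The isomorphism *)
Section Main.
Context {n : nat} {a : 'M[int]_n} {d : 'I_n -> nat} (pi : set (weight n)).
Hypothesis aP : cartan_finite_type a d.
Hypothesis pi_finite : finite_set pi.
Hypothesis pi_saturated : saturated a pi.
Local Notation U := (U_alg a d).
Local Notation Kg := (fun i => U_gen a d (U_K i)).
Local Notation P := (weyl_orbits a pi).

Lemma belongs_weighted (M : lmodType U) : belongs_to pi M -> @weighted n d U Kg M P.
Proof.
move=> [fdM MN]; have [r [N rN]] := composition_series_exists fdM.
apply: (extension_weighted aP (U_alg_generators a d) pi_finite rN) => j jr.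
have [lam pilam L] := MN r N rN j jr.
exact: (Lambda_weighted aP (U_alg_generators a d) pi_saturated pilam L).
Qed.

Lemma weighted_belongs (M : lmodType U) : finite_dim M -> @weighted n d U Kg M P ->
  belongs_to pi M.
Proof.
move=> fdM PM; split=> // r N [_ _ _ simN] j jr.
have [lam pilam L] := weighted_simple aP (U_alg_generators a d) pi_finite pi_saturated
  (factor_weighted aP (N' := N j) (N := N j.+1) PM) (simN j jr).
by exists lam.
Qed.

Context (s : seq (weight n)).
Hypothesis us : uniq s.
Hypothesis sP : forall nu, nu \in s <-> P nu.
Local Notation S := (S_alg a d pi).
Local Notation projU := (presented_proj (@U_relation n a d)).
Local Notation projS := (presented_proj (@S_relation n a d pi)).
Local Notation I := (annihilator a d pi).
Local Notation D := (donkin_qSchur_alg a d pi).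
Local Notation SK := (@S_K n d s S (S_idem a d pi)).
Local Notation SKinv := (@S_Kinv n d s S (S_idem a d pi)).

Definition U_to_S (g : @U_generator n) : free_alg Qv (S_generator a pi) :=
  match g with
  | U_E i => free_gen Qv (S_E a pi i)
  | U_F i => free_gen Qv (S_F a pi i)
  | U_K i => \sum_(nu <- s) qvi d i ^ pairing i nu *: free_idem a pi nu
  | U_Kinv i => \sum_(nu <- s) qvi d i ^ (- pairing i nu) *: free_idem a pi nu
  end.

Lemma projU_const c : projU (alg_const c) = alg_const c.
Proof. by []. Qed.

Lemma phi_exists : exists phi : {rmorphism U -> S},
  [/\ forall c, phi (alg_const c) = alg_const c,
      forall i, phi (U_gen a d (U_E i)) = S_E_elt a d pi i,
      forall i, phi (U_gen a d (U_F i)) = S_F_elt a d pi i,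
      forall i, phi (U_gen a d (U_K i)) = SK i &
      forall i, phi (U_gen a d (U_Kinv i)) = SKinv i].
Proof.
pose Phi : {rmorphism free_alg Qv (@U_generator n) -> S} := projS \o free_lift U_to_S.
have PhiE x : Phi x = projS (free_lift U_to_S x) by [].
have Phi_const c : Phi (alg_const c) = alg_const c by rewrite PhiE free_lift_const.
have Phi_E i : Phi (free_gen Qv (U_E i)) = S_E_elt a d pi i by rewrite PhiE free_lift_gen.
have Phi_F i : Phi (free_gen Qv (U_F i)) = S_F_elt a d pi i by rewrite PhiE free_lift_gen.
have Phi_K i : Phi (free_gen Qv (U_K i)) = SK i.
  by rewrite PhiE free_lift_gen (hom_lincomb (@projS_const n a d pi)).
have Phi_Kinv i : Phi (free_gen Qv (U_Kinv i)) = SKinv i.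
  by rewrite PhiE free_lift_gen (hom_lincomb (@projS_const n a d pi)).
have R := S_alg_generators d us sP.
have UR : Uq_relations a d (S_E_elt a d pi) (S_F_elt a d pi) SK SKinv.
  split=> *; [exact: (toralC us R)|exact: (S_K_Kinv us R)|exact: (S_Kinv_K us R)
    |exact: (S_EF_K us R)|exact: (S_K_E us R)|exact: (S_K_F us R)].
have serreE i j : i != j -> Phi (serre a d (fun k => free_gen Qv (U_E k)) i j) = 0.
  move=> ij; rewrite PhiE free_lift_serre.
  have -> : (fun k => free_lift U_to_S (free_gen Qv (U_E k))) = (fun k => free_gen Qv (S_E a pi k)).
    by apply/funext => k; rewrite free_lift_gen.
  by rewrite (projS_eq (S_serre_E a d pi ij)) rmorph0.
have serreF i j : i != j -> Phi (serre a d (fun k => free_gen Qv (U_F k)) i j) = 0.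
  move=> ij; rewrite PhiE free_lift_serre.
  have -> : (fun k => free_lift U_to_S (free_gen Qv (U_F k))) = (fun k => free_gen Qv (S_F a pi k)).
    by apply/funext => k; rewrite free_lift_gen.
  by rewrite (projS_eq (S_serre_F a d pi ij)) rmorph0.
have [phi phiP] := presented_lift_exists
  (U_relation_sound Phi_const Phi_E Phi_F Phi_K Phi_Kinv UR serreE serreF).
exists phi; split.
- by move=> c; rewrite -(projU_const c) phiP Phi_const.
- by move=> i; apply: etrans (phiP _) (Phi_E i).
- by move=> i; apply: etrans (phiP _) (Phi_F i).
- by move=> i; apply: etrans (phiP _) (Phi_K i).
- by move=> i; apply: etrans (phiP _) (Phi_Kinv i).
Qed.

Local Notation E := (fun i => U_gen a d (U_E i)).
Local Notation F := (fun i => U_gen a d (U_F i)).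
Local Notation Kinv := (fun i => U_gen a d (U_Kinv i)).
Local Notation projI := (quot_proj I : {rmorphism U -> D}).

Lemma weighted_iff (M : lmodType U) :
  @weighted n d U Kg M P <-> @weighted n d U Kg M (fun nu => nu \in s).
Proof.
split=> PM x; apply: span_trans (PM x) => y [nu /sP nus wy]; apply: span_in.
  by exists nu.
by exists nu => //; apply/sP.
Qed.

Lemma projI_eq (t t' : U) :
  (forall M : lmodType U, @weighted n d U Kg M (fun nu => nu \in s) ->
    forall mu (x : M), @wt n d U Kg M mu x -> t *: x = t' *: x) -> projI t = projI t'.
Proof.
move=> tt'; apply/(quotring_eqP I)/ideal_predP => M /belongs_weighted PM x.
elim: (PM x) => [|c y z [nu _ wy] _ IH]; first exact: scaler0.
rewrite scalerDr IH addr0 scaler_kscale scalerBl.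
by rewrite (tt' M ((weighted_iff M).1 PM) nu y wy) subrr kscaler0.
Qed.

Lemma projI_const c : projI (alg_const c) = alg_const c.
Proof. by []. Qed.

Lemma psi_exists (u : weight n -> U) : @weight_projector n d U Kg s u ->
  exists psi : {rmorphism S -> D},
  [/\ forall c, psi (alg_const c) = alg_const c,
      forall i, psi (S_E_elt a d pi i) = projI (E i),
      forall i, psi (S_F_elt a d pi i) = projI (F i) &
      forall nu, psi (S_idem a d pi nu) = projI (u nu)].
Proof.
move=> uP.
have /choice[pre preE] nu : exists x, u nu = projU x by exact: presented_proj_surj.
pose gS (g : S_generator a pi) : free_alg Qv (@U_generator n) :=
  match g with
  | S_E i => free_gen Qv (U_E i)
  | S_F i => free_gen Qv (U_F i)
  | S_one lam => pre (val lam)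
  end.
pose Phi : {rmorphism free_alg Qv (S_generator a pi) -> D} := projI \o projU \o free_lift gS.
have PhiE x : Phi x = projI (projU (free_lift gS x)) by [].
have Phi_const c : Phi (alg_const c) = alg_const c by rewrite PhiE free_lift_const.
have Phi_E i : Phi (free_gen Qv (S_E a pi i)) = projI (E i) by rewrite PhiE free_lift_gen.
have Phi_F i : Phi (free_gen Qv (S_F a pi i)) = projI (F i) by rewrite PhiE free_lift_gen.
have Phi_one (lam : set_type P) : Phi (free_gen Qv (S_one lam : S_generator a pi)) = projI (u (val lam)).
  by rewrite PhiE free_lift_gen preE.
have R : Sq_relations a d s (fun i => projI (E i)) (fun i => projI (F i)) (fun nu => projI (u nu)).
  exact: (quotient_Sq_relations (B := D) (p := projI) aP (U_alg_generators a d) us uP projI_const projI_eq).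
have serreE i j : i != j -> Phi (serre a d (fun k => free_gen Qv (S_E a pi k)) i j) = 0.
  move=> ij; rewrite PhiE free_lift_serre.
  have -> : (fun k => free_lift gS (free_gen Qv (S_E a pi k))) = (fun k => free_gen Qv (U_E k)).
    by apply/funext => k; rewrite free_lift_gen.
  by rewrite (presented_proj_eq (U_serre_E a d ij)) !rmorph0.
have serreF i j : i != j -> Phi (serre a d (fun k => free_gen Qv (S_F a pi k)) i j) = 0.
  move=> ij; rewrite PhiE free_lift_serre.
  have -> : (fun k => free_lift gS (free_gen Qv (S_F a pi k))) = (fun k => free_gen Qv (U_F k)).
    by apply/funext => k; rewrite free_lift_gen.
  by rewrite (presented_proj_eq (U_serre_F a d ij)) !rmorph0.
have [psi psiP] := presented_lift_exists
  (S_relation_sound us sP Phi_const Phi_E Phi_F Phi_one R serreE serreF).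
exists psi; split.
- by move=> c; rewrite -(projS_const a d pi c) psiP Phi_const.
- by move=> i; apply: etrans (psiP _) (Phi_E i).
- by move=> i; apply: etrans (psiP _) (Phi_F i).
- move=> nu; apply: etrans (psiP _) _; apply: (Phi_idem (e := fun nu => projI (u nu))) => //.
  by move=> mu np; rewrite (proj1 uP) ?rmorph0 //; apply/negP => /sP.
Qed.


Section Comparison.
Context (phi : {rmorphism U -> S}).
Hypothesis phi_const : forall c, phi (alg_const c) = alg_const c.
Hypothesis phiE : forall i, phi (E i) = S_E_elt a d pi i.
Hypothesis phiF : forall i, phi (F i) = S_F_elt a d pi i.
Hypothesis phiK : forall i, phi (Kg i) = SK i.
Hypothesis phiKinv : forall i, phi (Kinv i) = SKinv i.

Lemma S_module_weighted : @weighted n d U Kg (pullmod phi) (fun nu => nu \in s).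
Proof. exact: (S_weighted us (S_alg_generators d us sP) phi_const phiK). Qed.

(** S(pi) is itself a module that belongs to pi, and [t] sends its unit to
    [phi t]. *)
Lemma phi_annihilator t : ideal_set I t -> phi t = 0.
Proof.
move=> It; have fdS : finite_dim (pullmod phi : lmodType U).
  exact: (S_finite_dim aP us (S_alg_generators d us sP) (U_alg_generators a d) phi_const phiE phiF phiK).
have bS : belongs_to pi (pullmod phi : lmodType U).
  by apply: weighted_belongs fdS _; apply/weighted_iff; apply: S_module_weighted.
by have := It _ bS (1 : S); rewrite pull_scaleE mulr1.
Qed.

(** The idempotent 1_lam is a vector of weight lam in S(pi), so [u nu] multiplies
    it by 1 or 0. *)
Lemma phi_projector (u : weight n -> U) nu : @weight_projector n d U Kg s u ->
  phi (u nu) = S_idem a d pi nu.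
Proof.
move=> [_ uP]; have R := S_alg_generators d us sP.
apply: (S_eq_on_idem R) => lam.
have we := wt_e us R phi_const phiK lam 1.
have := uP _ S_module_weighted nu lam _ we; rewrite pull_scaleE mulr1 => ->.
by rewrite (S_rel_idem R) eq_sym; case: eqP => // ->.
Qed.

Lemma alg_isomorphic_donkin : alg_isomorphic S D.
Proof.
have [u uP] := @weight_projector_exists n a d aP U Kg s us.
have [psi [psi_const psiE psiF psi_idem]] := psi_exists uP.
have [g gP] := quot_lift_exists phi_annihilator.
have R := S_alg_generators d us sP.
exists psi; split; first exact: psi_const.
have psiK x : g (psi x) = x.
  have gM y z : g (psi (y * z)) = g (psi y) * g (psi z).
    by rewrite (rmorphM psi y z) (rmorphM g (psi y) (psi z)).
  have gstep y z : g (psi y) = y -> g (psi z) = z -> g (psi (y * z)) = y * z.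
    by move=> ey ez; rewrite gM ey ez.
  move: x; apply: (S_gen_ind R).
  - by move=> x y gx gy; rewrite !rmorphD gx gy.
  - by move=> c x gx; apply: gstep gx; rewrite psi_const -projI_const gP phi_const.
  - by rewrite !rmorph1.
  move=> x gx; split=> [i|i|nu]; apply: gstep gx.
  - by rewrite psiE gP phiE.
  - by rewrite psiF gP phiF.
  - by rewrite psi_idem gP (phi_projector nu uP).
have gK t : psi (phi t) = projI t.
  have gstep y z : psi (phi y) = projI y -> psi (phi z) = projI z ->
      psi (phi (y * z)) = projI (y * z).
    move=> ey ez; rewrite (rmorphM phi y z) (rmorphM psi (phi y) (phi z)) ey ez.
    exact: esym (rmorphM projI y z).
  have psi_toral f : psi (toral (s := s) (e := S_idem a d pi) f) =
      \sum_(nu <- s) alg_const (f nu) * projI (u nu).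
    rewrite rmorph_sum; apply: eq_bigr => nu _.
    by rewrite (rmorphM psi (alg_const (f nu)) (S_idem a d pi nu)) psi_const psi_idem.
  move: t; apply: (U_gen_ind (U_alg_generators a d)).
  - by move=> x y gx gy; rewrite !rmorphD gx gy.
  - by move=> c x gx; apply: gstep gx; rewrite phi_const psi_const.
  - by rewrite !rmorph1.
  move=> i x gx; split; apply: gstep gx.
  - by rewrite phiE psiE.
  - by rewrite phiF psiF.
  - rewrite phiK psi_toral; symmetry.
    exact: (quotient_K (B := D) (p := projI) aP us uP projI_const projI_eq).
  - rewrite phiKinv psi_toral; symmetry.
    exact: (quotient_Kinv (B := D) (p := projI) aP (U_alg_generators a d) us uP projI_const projI_eq).
exists g => [x|t]; first exact: psiK.
have [t' ->] : exists t', t = projI t' by exists (repr t); rewrite /= /quot_proj reprK.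
by rewrite gP gK.
Qed.
End Comparison.
End Main.

Theorem corollary3p13 (n : nat) (a : 'M[int]_n) (d : 'I_n -> nat)
    (pi : set (weight n))
    (aP : cartan_finite_type a d)
    (pi_finite : finite_set pi)
    (pi_saturated : saturated a pi) :
  alg_isomorphic (S_alg a d pi) (donkin_qSchur_alg a d pi).
Proof.
have [s us sP] := weyl_orbits_seq aP pi_finite.
have [phi [phi_const phiE phiF phiK phiKinv]] := phi_exists (d := d) us sP.
exact: (alg_isomorphic_donkin aP pi_finite pi_saturated us sP phi_const phiE phiF phiK phiKinv).
Qed.
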